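(* There is a randomised algorithm that, given any sequence $P=(p_1,\dots,p_n)$ of $n$ points in $\mathbb{R}^2$ in general position (no two points share an $x$-coordinate and no two share a $y$-coordinate) that fulfils the Pareto-front promise, computes the Pareto front of $P$ in expected time $O(n\cdot 2^{O(\sqrt{\log\log n})})$. There is also such a randomised algorithm with expected time $n\cdot 2^{O(\sqrt{\log\log h})}$, where $h$ is the number of points on the Pareto front of $P$.
   Context: The index of a point $p_i$ in the sequence is $\mathrm{index}(p_i)=i$, and $x(p)$ denotes the $x$-coordinate of $p$. The Pareto front of $P$ is the sequence, ordered by $x$-coordinate, of exactly those points $p\in P$ for which there is no $q\in P$ with both larger $x$- and larger $y$-coordinate. $P$ fulfils the Pareto-front promise if for any two points $p,q$ on the Pareto front, $\mathrm{index}(p)<\mathrm{index}(q)\iff x(p)<x(q)$. Expectations are over the random choices of the algorithm; the value $h$ is not known to the algorithm in advance. The running time is measured in the standard real-RAM model. As usual, iterated logarithms of small arguments are understood to be replaced by a positive constant. *)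

(* Defs.v *)
(* MathComp / MathComp-Analysis. *)
From HB Require Import structures.
From mathcomp Require Import all_boot all_order all_algebra.
From mathcomp Require Import all_classical all_reals all_analysis.

Set Implicit Arguments.
Unset Strict Implicit.
Unset Printing Implicit Defensive.

Import Order.TTheory GRing.Theory Num.Theory.

Local Open Scope ring_scope.

Section ParetoFront.
Variable R : realType.
Implicit Types (P : seq (R * R)) (p q : R * R).

Definition general_position P : bool :=
  uniq [seq p.1 | p <- P] && uniq [seq p.2 | p <- P].

Definition dominated P p : bool :=
  has (fun q => (p.1 < q.1) && (p.2 < q.2)) P.

Definition pareto_front P : seq (R * R) :=
  sort (fun p q => p.1 <= q.1) [seq p <- P | ~~ dominated P p].

(* Indices start at 0 here; only their order matters. *)
Definition pareto_promise P : Prop :=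
  forall i j : nat, (i < size P)%N -> (j < size P)%N ->
    nth (0, 0) P i \in pareto_front P ->
    nth (0, 0) P j \in pareto_front P ->
    (i < j)%N <-> (nth (0, 0) P i).1 < (nth (0, 0) P j).1.

End ParetoFront.

(* A randomised real RAM with two unbounded arrays of memory cells: W, holding
   w-bit words, and X, holding arbitrary real numbers.  Every instruction takes
   unit time.  Words can be used as addresses and cast to reals, but nothing
   converts a real to a word: reals can only be compared. *)

Inductive word_op := WAdd | WSub | WMul | WDiv.
Inductive real_op := RAdd | RSub | RMul | RDiv.

Inductive instr :=
| WConst of nat & nat             (* W[i] := k               *)
| WOp of word_op & nat & nat & nat(* W[i] := W[j] op W[k]    *)
| WLoad of nat & nat              (* W[i] := W[W[j]]         *)
| WStore of nat & nat             (* W[W[i]] := W[j]         *)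
| WRand of nat & nat              (* W[i] := uniformly random in {0, ..., W[j]},
                                     independent of all previous choices *)
| ROp of real_op & nat & nat & nat(* X[i] := X[j] op X[k]    *)
| RCast of nat & nat              (* X[i] := W[j]            *)
| RLoad of nat & nat              (* X[i] := X[W[j]]         *)
| RStore of nat & nat             (* X[W[i]] := X[j]         *)
| WJump of nat & nat & nat        (* if W[i] < W[j] goto l   *)
| RJump of nat & nat & nat        (* if X[i] < X[j] goto l   *)
| Halt.

(* On an input of n points the machine has words of
   (factor + 1) * (floor (log2 n) + 1) = Theta(log n) bits. *)
Record algorithm := Algorithm { code : seq instr; factor : nat }.

Definition word_size (A : algorithm) (n : nat) : nat :=
  ((factor A).+1 * (trunc_log 2 n).+1)%N.

Section Semantics.
Variable R : realType.

Record config := Config { pc : nat; wmem : nat -> nat; rmem : nat -> R }.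

(* Addition and multiplication wrap around, subtraction is truncated at 0;
   division is rounded down, and division by 0 returns 0. *)
Definition eval_wop (w : nat) (op : word_op) (a b : nat) : nat :=
  match op with
  | WAdd => (a + b) %% 2 ^ w
  | WSub => a - b
  | WMul => (a * b) %% 2 ^ w
  | WDiv => a %/ b
  end%N.

Definition eval_rop (op : real_op) (x y : R) : R :=
  match op with
  | RAdd => x + y
  | RSub => x - y
  | RMul => x * y
  | RDiv => x / y
  end.

(* None: the machine has halted (also when the program counter leaves the
   program).  Some s: the next configuration is drawn uniformly from the
   nonempty list s, a singleton unless the instruction is WRand. *)
Definition step (A : algorithm) (w : nat) (c : config) : option (seq config) :=
  let: Config l W X := c in
  let setW i a := Config l.+1 [eta W with i |-> a] X in
  let setX i x := Config l.+1 W [eta X with i |-> x] in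
  let jump (b : bool) l' := Config (if b then l' else l.+1) W X in
  match nth Halt (code A) l with
  | WConst i k => Some [:: setW i (k %% 2 ^ w)%N]
  | WOp op i j k => Some [:: setW i (eval_wop w op (W j) (W k))]
  | WLoad i j => Some [:: setW i (W (W j))]
  | WStore i j => Some [:: setW (W i) (W j)]
  | WRand i j => Some [seq setW i r | r <- iota 0 (W j).+1]
  | ROp op i j k => Some [:: setX i (eval_rop op (X j) (X k))]
  | RCast i j => Some [:: setX i (W j)%:R]
  | RLoad i j => Some [:: setX i (X (W j))]
  | RStore i j => Some [:: setX (W i) (X j)]
  | WJump i j l' => Some [:: jump (W i < W j)%N l']
  | RJump i j l' => Some [:: jump (X i < X j) l']
  | Halt => None
  end.

(* A sequence of k points is stored as W[0] = k and, for i < k, the point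
   number i as (X[2i], X[2i+1]).  All other cells are initially 0. *)
Definition initial (P : seq (R * R)) : config :=
  Config 0 (fun a => if a == 0 then size P else 0)%N
    (fun a => let p := nth (0, 0) P a./2 in if odd a then p.2 else p.1).

Definition output (c : config) : seq (R * R) :=
  [seq (rmem c i.*2, rmem c i.*2.+1) | i <- iota 0 (wmem c 0)].

(* Probability that the run from c halts after exactly t steps, in a
   configuration satisfying Q. *)
Fixpoint halt_prob (A : algorithm) (w : nat) (Q : pred config) (t : nat)
    (c : config) : R :=
  match step A w c, t with
  | None, 0%N => (Q c)%:R
  | None, _.+1 => 0
  | Some _, 0%N => 0
  | Some s, t'.+1 => (\sum_(c' <- s) halt_prob A w Q t' c') / (size s)%:R
  end.

Definition run_prob (A : algorithm) (P : seq (R * R)) (Q : pred config)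
    (t : nat) : R :=
  halt_prob A (word_size A (size P)) Q t (initial P).

(* The running time T takes values in nat and +oo; the second term is
   +oo * Pr[T = +oo], with the convention +oo * 0 = 0. *)
Definition expected_time (A : algorithm) (P : seq (R * R)) : \bar R :=
  (\sum_(0 <= t <oo) (t%:R * run_prob A P predT t)%:E
   + +oo * (1 - \sum_(0 <= t <oo) (run_prob A P predT t)%:E))%E.

(* With probability 1 the run halts with the Pareto front as its output. *)
Definition computes_pareto_front (A : algorithm) : Prop :=
  forall P : seq (R * R), general_position P -> pareto_promise P ->
    (\sum_(0 <= t <oo)
       (run_prob A P (fun c => output c == pareto_front P) t)%:E = 1)%E.

Definition log2 (x : R) : R := ln x / ln 2.

Definition loglog (x : R) : R := Num.max 1 (log2 (log2 x)).

End Semantics.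

(* Main.v *)
Require Import Defs.
From mathcomp Require Import all_boot all_order all_algebra.
From mathcomp Require Import all_classical all_reals all_analysis.
From mathcomp Require Import zify ring lra.

(* Phase j merges the fronts of groups of 2^j consecutive points, in linear time,
   into staircases (blocks) sorted by x-coordinate.  By the promise, front points
   of different blocks are ordered like the blocks.  Let f be the highest point
   that is not to the left of a random pivot p, and let c be its block: then f is
   on the front, the front points to the right of f lie in the blocks from c on,
   those to the left of f in the blocks up to c, and binary searches in all
   blocks delete the points that f dominates.  Thus the excess k - 1 over one
   block is not increased in total by a split, and the potential
   (k - 1) (2 + ln (h N / (k - 1))), where N is the number of points, decreases
   by at least (k - 1) / 8 in expectation, since a random pivot is likely to
   leave at most 3/4 of the points on either side.  Initially the potential is
   O((n / 2^j) (j + log h)), so that a search that is given up after n binary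
   searches fails with probability at most 1/4 once 2^j exceeds a multiple of
   j + log h, i.e. from some j0 = log log h + O(1) on.  As phase j takes time
   O(n j), the expected time is O(n j0^2), which is n 2^O(sqrt (log log h)). *)

Set Implicit Arguments.
Unset Strict Implicit.
Unset Printing Implicit Defensive.

Import Order.TTheory GRing.Theory Num.Theory.

Local Open Scope ring_scope.

(** * Expected running time *)

(** The front size h is unknown, so no block length can be fixed beforehand: a search that is given
    up is the sign that the blocks are still too short. Only the time is random, never the answer,
    and the time is bounded over all random choices. The excess k - 1 is measured instead of k
    because the block of f goes to both sides of a split, and because a node with one block needs no
    further split: its points all lie on the front. This, and the fact that f lies on the front
    although only one node is inspected, rest on one invariant: a dominated point of a node is
    dominated by a front point of the same node. It survives a split because the left part is cut by
    height and the right part by x-coordinate, and a dominating point passes either cut along with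
    the point it dominates. The pivot is the only random choice, so all other parts of the program
    get worst-case bounds. The bound n (log log h)^2 takes the required form by x^4 <= 2^(8 x) with
    x = sqrt (log log h); as h <= n, one program proves both claims. *)

Section ExpectedTime.
Variables (R : realType) (A : algorithm) (w : nat) (Q : pred (config R)).
Implicit Types (c : config R) (v : R).

(** A derivation is a finitely branching, well-founded tree of runs: all of them halt, in
    configurations satisfying [Q], and the averages along the tree bound the expected time. The
    successors may have different bounds [vs i], which is what an amortised analysis of a random
    choice needs. *)
Inductive runs_within : config R -> R -> Prop :=
| runs_halt c v : step A w c = None -> Q c -> 0 <= v -> runs_within c v
| runs_step c v s (vs : nat -> R) : step A w c = Some s ->
    (forall i, (i < size s)%N -> runs_within (nth c s i) (vs i)) ->
    1 + (\sum_(i < size s) vs i) / (size s)%:R <= v -> runs_within c v.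

Lemma runs_within_le c v v' : runs_within c v -> v <= v' -> runs_within c v'.
Proof.
case=> {}c {}v; first by move=> h q v0 vv; apply: runs_halt => //; exact: le_trans vv.
by move=> s vs h hs hv vv; apply: (runs_step h hs); exact: le_trans vv.
Qed.

Lemma runs_within_det c c' v :
  step A w c = Some [:: c'] -> runs_within c' (v - 1) -> runs_within c v.
Proof.
move=> h hc; apply: (runs_step (vs := fun=> v - 1) h); first by case.
by rewrite /= big_ord1 divr1 addrC subrK.
Qed.

Lemma size_step_gt0 c s : step A w c = Some s -> (0 < size s)%N.
Proof. by case: c => l W X /=; case: nth => //= > [<-]. Qed.

Lemma halt_prob_ge0 (Q' : pred (config R)) t c : 0 <= halt_prob A w Q' t c.
Proof.
elim: t c => [|t IH] c; rewrite /=; case: step => // s.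
by rewrite divr_ge0 // sumr_ge0.
Qed.

(** All leaves of the derivation satisfy [Q], so correctness with probability 1 reduces to halting
    with probability 1. *)
Lemma runs_within_post c v t :
  runs_within c v -> halt_prob A w Q t c = halt_prob A w predT t c.
Proof.
move=> h; elim: h t => {c v} [c v sc q _|c v s vs sc _ IH _] [|t] /=; rewrite sc //=.
  by rewrite q.
congr (_ / _); rewrite !(big_nth c) !big_mkord.
by apply: eq_bigr => i _; exact: IH.
Qed.

(** Finite branching yields one horizon [T] by which every branch has halted. From there on both
    sums are constant, so the series of the theorem become finite sums. *)
Lemma runs_within_sums c v : runs_within c v ->
  exists T, forall T', (T <= T')%N ->
    \sum_(t < T') halt_prob A w predT t c = 1 /\
    \sum_(t < T') t%:R * halt_prob A w predT t c <= v.
Proof.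
elim=> {c v} [c v sc q v0|c v s vs sc _ IH hv].
  have hS t : halt_prob A w predT t.+1 c = 0 by rewrite /= sc.
  exists 1%N => -[//|T'] _; rewrite !big_ord_recl /= sc mul0r add0r.
  by rewrite !big1 ?addr0 // => i _; rewrite mulr0.
have [T HT] : exists T, forall i, (i < size s)%N -> forall T', (T <= T')%N ->
    \sum_(t < T') halt_prob A w predT t (nth c s i) = 1 /\
    \sum_(t < T') t%:R * halt_prob A w predT t (nth c s i) <= vs i.
  elim: (size s) IH => [|k IHk] IH; first by exists 0%N.
  have [|T1 H1] := IHk; first by move=> i ik; apply: IH; exact: ltnW.
  have [T2 H2] := IH k (leqnn _).
  exists (maxn T1 T2) => i; rewrite ltnS leq_eqVlt => /orP[/eqP->|ik] T' hT'.
    by apply: H2; apply: leq_trans hT'; exact: leq_maxr.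
  by apply: H1 => //; apply: leq_trans hT'; exact: leq_maxl.
have spos : 0 < (size s)%:R :> R by rewrite ltr0n (size_step_gt0 sc).
have s0 : (size s)%:R != 0 :> R by rewrite gt_eqF.
exists T.+1 => -[//|T']; rewrite ltnS => hT'.
have hS t : halt_prob A w predT t.+1 c =
    (\sum_(i < size s) halt_prob A w predT t (nth c s i)) / (size s)%:R.
  by rewrite /= sc (big_nth c) big_mkord.
have S1 : \sum_(t < T') halt_prob A w predT t.+1 c = 1.
  under eq_bigr do rewrite hS.
  rewrite -mulr_suml exchange_big /=.
  rewrite (eq_bigr (fun=> 1)); first by rewrite sumr_const card_ord mulfV.
  by move=> i _; have [] := HT i (ltn_ord i) _ hT'.
have h0 : halt_prob A w predT 0 c = 0 by rewrite /= sc.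
rewrite -(big_mkord xpredT (fun t => halt_prob A w predT t c)).
rewrite -(big_mkord xpredT (fun t => t%:R * halt_prob A w predT t c)).
rewrite !big_nat_recl // h0 mulr0 !add0r !big_mkord; split=> //.
(* Writing the time as [t + 1] splits off the total probability, which is 1 and accounts for the
   current step; the rest is the average over the successors. *)
rewrite (eq_bigr (fun t : 'I_T' => t%:R * halt_prob A w predT t.+1 c +
    halt_prob A w predT t.+1 c)); last first.
  by move=> t _; rewrite -natr1 mulrDl mul1r.
rewrite big_split S1 [X in X <= _]addrC; apply: le_trans hv; rewrite lerD2l.
under eq_bigr do rewrite hS mulrA mulr_sumr.
rewrite -mulr_suml ler_pdivrMr ?divfK // exchange_big.
by apply: ler_sum => i _; have [] := HT i (ltn_ord i) _ hT'.
Qed.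

End ExpectedTime.

Lemma nneseries_stationary (R : realType) (u : nat -> R) (T : nat) (v : R) :
  (forall n, 0 <= u n) ->
  (forall T', (T <= T')%N -> \sum_(t < T') u t = v) ->
  (\sum_(0 <= t <oo) (u t)%:E = v%:E)%E.
Proof.
move=> u0 hT; apply: lim_near_cst => //; exists T => //= n hn.
by rewrite sumEFin big_mkord hT.
Qed.

(** Links derivations to the notions of the theorem. As the halting probabilities sum to 1, the term
    for infinite runs is [+oo * 0], that is 0. *)
Lemma runs_within_correct (R : realType) (A : algorithm) (P : seq (R * R)) v :
  runs_within A (word_size A (size P))
    (fun c => output c == pareto_front P) (initial P) v ->
  (\sum_(0 <= t <oo)
     (run_prob A P (fun c => output c == pareto_front P) t)%:E = 1)%E /\
  (expected_time A P <= v%:E)%E.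
Proof.
move=> h; have [T hT] := runs_within_sums h.
have p1 : (\sum_(0 <= t <oo) (run_prob A P predT t)%:E = 1)%E.
  apply: (nneseries_stationary (T := T)) => [n|T' hT']; first exact: halt_prob_ge0.
  by have [] := hT _ hT'.
split.
  under eq_eseriesr => t _ do rewrite /run_prob (runs_within_post t h).
  exact: p1.
rewrite /expected_time p1 subee // mule0 adde0.
apply: lime_le; first by apply: is_cvg_nneseries => n _ _;
  rewrite lee_fin mulr_ge0 // halt_prob_ge0.
near=> n; rewrite sumEFin big_mkord lee_fin.
by have [|_] := hT n; first by near: n; exact: nbhs_infty_ge.
Unshelve. all: by end_near.
Qed.

(** * A structured language and its compilation *)

Inductive atom :=
| ASet of nat & nat
| AOp of word_op & nat & nat & nat
| ALd of nat & nat & nat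
| ASt of nat & nat & nat
| PLd of nat & nat & nat
| PSt of nat & nat & nat.

Inductive cond := CLt of nat & nat | CRlt of nat & nat.

Inductive cmd :=
| Block of seq atom
| Seq of cmd & cmd
| If of cond & cmd & cmd
| While of cond & cmd
| Rand of nat & nat.

(* Scalar i lives at W[16 i] (scalars 40 and 41 are scratch cells of the
   compiled code), entry i of the array a, 0 < a < 16, at W[16 i + a], real
   register r < 8 at X[r], and coordinate c < 2 of slot p at X[2 p + c + 8]. *)
Definition array_addr (a v : nat) : seq instr :=
  [:: WConst (16 * 40) 16; WOp WMul (16 * 40) (16 * 40) (16 * v);
      WConst (16 * 41) a; WOp WAdd (16 * 40) (16 * 40) (16 * 41)].

Definition point_addr (c v : nat) : seq instr :=
  [:: WOp WAdd (16 * 40) (16 * v) (16 * v);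
      WConst (16 * 41) (c + 8); WOp WAdd (16 * 40) (16 * 40) (16 * 41)].

Definition compile_atom (a : atom) : seq instr :=
  match a with
  | ASet u k => [:: WConst (16 * u) k]
  | AOp op u v w => [:: WOp op (16 * u) (16 * v) (16 * w)]
  | ALd u a v => array_addr a v ++ [:: WLoad (16 * u) (16 * 40)]
  | ASt a v u => array_addr a v ++ [:: WStore (16 * 40) (16 * u)]
  | PLd r c v => point_addr c v ++ [:: RLoad r (16 * 40)]
  | PSt c v r => point_addr c v ++ [:: RStore (16 * 40) r]
  end.

(** All jumps of the machine are conditional; comparing the constants 0 and 1 gives an unconditional
    one of length 3. *)
Definition goto (l : nat) : seq instr :=
  [:: WConst (16 * 40) 0; WConst (16 * 41) 1; WJump (16 * 40) (16 * 41) l].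

Definition compile_cond (b : cond) (l : nat) : instr :=
  match b with
  | CLt u v => WJump (16 * u) (16 * v) l
  | CRlt u v => RJump u v l
  end.

(** A jump is taken when its test holds, so the else branch precedes the then branch, and a loop
    starts with a test that skips the exit jump. The number 3 is the length of a [goto], and 4 that
    of a test followed by a [goto]. *)
Fixpoint compile (l : nat) (c : cmd) : seq instr :=
  match c with
  | Block s => flatten [seq compile_atom a | a <- s]
  | Seq c1 c2 => let s1 := compile l c1 in s1 ++ compile (l + size s1) c2
  | If b c1 c2 =>
      let s2 := compile l.+1 c2 in
      let l1 := (l.+1 + size s2 + 3)%N in
      let s1 := compile l1 c1 in
      compile_cond b l1 :: s2 ++ goto (l1 + size s1) ++ s1
  | While b c =>
      let s := compile (l + 4) c in
      compile_cond b (l + 4) :: goto (l + 4 + size s + 3) ++ s ++ goto l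
  | Rand u v => [:: WRand (16 * u) (16 * v)]
  end.

Definition wf_atom (a : atom) : bool :=
  match a with
  | ASet u k => (u < 40)%N
  | AOp op u v w => [&& (u < 40), (v < 40) & (w < 40)]%N
  | ALd u a v | ASt a v u => [&& (u < 40), (v < 40), (0 < a) & (a < 16)]%N
  | PLd r c v | PSt c v r => [&& (r < 8), (c < 2) & (v < 40)]%N
  end.

Definition wf_cond (b : cond) : bool :=
  match b with
  | CLt u v => (u < 40) && (v < 40)
  | CRlt u v => (u < 8) && (v < 8)
  end%N.

Fixpoint wf_cmd (c : cmd) : bool :=
  match c with
  | Block s => all wf_atom s
  | Seq c1 c2 => wf_cmd c1 && wf_cmd c2
  | If b c1 c2 => [&& wf_cond b, wf_cmd c1 & wf_cmd c2]
  | While b c => wf_cond b && wf_cmd c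
  | Rand u v => (u < 40)%N && (v < 40)%N
  end.

Section Language.
Variables (R : realType) (lim : nat).

Record state := State {
  sc : nat -> nat;
  ar : nat -> nat -> nat;
  rg : nat -> R;
  pt : nat -> nat -> R }.

Implicit Types (s : state) (v : R) (K : state -> R -> Prop).

Definition upd T (f : nat -> T) i x : nat -> T := fun j => if j == i then x else f j.

Definition set_sc s u x := State (upd (sc s) u x) (ar s) (rg s) (pt s).
Definition set_ar s a i x :=
  State (sc s) (upd (ar s) a (upd (ar s a) i x)) (rg s) (pt s).
Definition set_rg s r x := State (sc s) (ar s) (upd (rg s) r x) (pt s).
Definition set_pt s c p x :=
  State (sc s) (ar s) (rg s) (upd (pt s) c (upd (pt s c) p x)).

Definition wop_val (op : word_op) (a b : nat) : nat :=
  match op with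
  | WAdd => a + b | WSub => a - b | WMul => a * b | WDiv => a %/ b
  end%N.

Definition atom_run (a : atom) s : state :=
  match a with
  | ASet u k => set_sc s u k
  | AOp op u v w => set_sc s u (wop_val op (sc s v) (sc s w))
  | ALd u a v => set_sc s u (ar s a (sc s v))
  | ASt a v u => set_ar s a (sc s v) (sc s u)
  | PLd r c v => set_rg s r (pt s c (sc s v))
  | PSt c v r => set_pt s c (sc s v) (rg s r)
  end.

(* No addition or multiplication wraps around, and no address does. *)
Definition atom_pre (a : atom) s : Prop :=
  match a with
  | ASet u k => k <= lim
  | AOp WAdd u v w => sc s v + sc s w <= lim
  | AOp WMul u v w => sc s v * sc s w <= lim
  | AOp _ _ _ _ => True
  | ALd _ _ v | ASt _ v _ | PLd _ _ v | PSt _ v _ => sc s v <= lim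
  end%N.

Fixpoint block_run (l : seq atom) s : state :=
  if l is a :: l' then block_run l' (atom_run a s) else s.

Fixpoint block_pre (l : seq atom) s : Prop :=
  if l is a :: l' then atom_pre a s /\ block_pre l' (atom_run a s) else True.

Definition cond_val (b : cond) s : bool :=
  match b with
  | CLt u v => (sc s u < sc s v)%N
  | CRlt u v => rg s u < rg s v
  end.

(* ert c K s v: running c from s, and then a continuation that takes expected
   time x from any state s' with K s' x, takes expected time at most v. *)
Fixpoint ert (c : cmd) (K : state -> R -> Prop) : state -> R -> Prop :=
  match c with
  | Block l => fun s v => block_pre l s /\ K (block_run l s) (v - (size l)%:R)
  | Seq c1 c2 => ert c1 (ert c2 K)
  | If b c1 c2 => fun s v =>
      if cond_val b s then ert c1 K s (v - 1) else ert c2 K s (v - 1)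
  | While b c => fun s v => forall I : state -> R -> Prop,
      (forall s v,
        (if cond_val b s then ert c I s (v - 1) else K s (v - 1)) -> I s v) ->
      I s v
  | Rand i j => fun s v => exists vs : nat -> R,
      (forall r, (r <= sc s j)%N -> K (set_sc s i r) (vs r)) /\
      1 + (\sum_(r < (sc s j).+1) vs r) / (sc s j).+1%:R <= v
  end.

Lemma ert_mono c K K' : (forall s v, K s v -> K' s v) ->
  forall s v, ert c K s v -> ert c K' s v.
Proof.
elim: c K K' => [l|c1 IH1 c2 IH2|b c1 IH1 c2 IH2|b c IH|i j] K K' KK' s v /=.
- by case=> ? /KK'.
- by apply: IH1; exact: IH2.
- by case: ifP => _; [apply: IH1|apply: IH2].
- move=> h I HI; apply: h => s' v' hs'; apply: HI; move: hs'.
  by case: ifP => // _; exact: KK'.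
- by move=> [vs [hvs hv]]; exists vs; split=> // r /hvs /KK'.
Qed.

(** The loop clause of [ert] is the least fixed point, encoded as the intersection of all prefixed
    points. This unfolding is what the analysis of programs uses; soundness of compilation
    instantiates the clause itself. *)
Lemma ert_while_unfold b c K s v :
  (if cond_val b s then ert c (ert (While b c) K) s (v - 1) else K s (v - 1)) ->
  ert (While b c) K s v.
Proof.
move=> h I HI; apply: (HI); move: h; case: ifP => // _.
by apply: ert_mono => s' v' /(_ _ HI).
Qed.

(** * Soundness of the compilation *)

Variables (A : algorithm) (w : nat) (Q : pred (config R)).
(** Leaves room for the largest address, [16 * lim + 15], and for the constants of the address
    computations. *)
Hypothesis lim_word : (16 * lim + 32 <= 2 ^ w)%N.

Definition represents s (W : nat -> nat) (X : nat -> R) : Prop :=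
  [/\ forall i, (i < 40)%N -> W (16 * i)%N = sc s i,
      forall a i, (0 < a < 16)%N -> W (16 * i + a)%N = ar s a i,
      forall r, (r < 8)%N -> X r = rg s r &
      forall c p, (c < 2)%N -> X (2 * p + (c + 8))%N = pt s c p].

Definition runs_from (l : nat) s v : Prop :=
  forall W X, represents s W X -> runs_within A w Q (Config l W X) v.

Definition code_at (l : nat) (cs : seq instr) : Prop :=
  forall i, (i < size cs)%N -> nth Halt (Defs.code A) (l + i) = nth Halt cs i.

Lemma code_at_cat l c1 c2 :
  code_at l (c1 ++ c2) -> code_at l c1 /\ code_at (l + size c1) c2.
Proof.
move=> h; split=> i hi.
  by rewrite h ?size_cat ?nth_cat ?hi // (leq_trans hi) // leq_addr.
rewrite -addnA h ?size_cat ?ltn_add2l // nth_cat ltnNge leq_addr /=.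
by rewrite addKn.
Qed.

Lemma code_at_cons l a cs :
  code_at l (a :: cs) -> nth Halt (Defs.code A) l = a /\ code_at l.+1 cs.
Proof.
move=> /(@code_at_cat l [:: a])[h1 h2]; split; last by rewrite -addn1.
by have := h1 0%N isT; rewrite addn0.
Qed.

Lemma represents_scratch s W X k x :
  represents s W X -> (40 <= k)%N -> represents s [eta W with 16 * k |-> x]%N X.
Proof.
move=> [h1 h2 h3 h4] hk; split=> //= [i hi|a i hi]; rewrite /upd.
  by case: eqP => [|_]; [lia|exact: h1].
by case: eqP => [|_]; [lia|exact: h2].
Qed.

Lemma represents_sc s W X u x : represents s W X -> (u < 40)%N ->
  represents (set_sc s u x) [eta W with (16 * u)%N |-> x] X.
Proof.
move=> [h1 h2 h3 h4] hk; split=> //= [i hi|a i hi]; rewrite /upd.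
  by rewrite eqn_pmul2l //; case: eqP => // _; exact: h1.
by case: eqP => [|_]; [lia|exact: h2].
Qed.

Lemma represents_ar s W X a i x : represents s W X -> (0 < a < 16)%N ->
  represents (set_ar s a i x) [eta W with (16 * i + a)%N |-> x] X.
Proof.
move=> [h1 h2 h3 h4] hk; split=> //= [j hi|b j hb]; rewrite /upd.
  by case: eqP => [|_]; [lia|exact: h1].
case: eqP => [e|ne].
  have -> : b = a by lia.
  have -> : j = i by lia.
  by rewrite !eqxx /= ?eqxx.
case: eqP => [e|_] /=; last exact: h2.
by case: eqP => [|_]; [lia|rewrite e; exact: h2].
Qed.

Lemma represents_rg s W X r x : represents s W X -> (r < 8)%N ->
  represents (set_rg s r x) W [eta X with r |-> x].
Proof.
move=> [h1 h2 h3 h4] hk; split=> //= [i hi|c p hc]; rewrite /upd.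
  by case: eqP => // _; exact: h3.
by case: eqP => [|_]; [lia|exact: h4].
Qed.

Lemma represents_pt s W X c p x : represents s W X -> (c < 2)%N ->
  represents (set_pt s c p x) W [eta X with (2 * p + (c + 8))%N |-> x].
Proof.
move=> [h1 h2 h3 h4] hc; split=> //= [i hi|d q hd]; rewrite /upd.
  by case: eqP => [|_]; [lia|exact: h3].
case: eqP => [e|ne].
  have -> : d = c by lia.
  have -> : q = p by lia.
  by rewrite !eqxx /= ?eqxx.
case: eqP => [e|_] /=; last exact: h4.
by case: eqP => [|_]; [lia|rewrite e; exact: h4].
Qed.

Lemma runs_within_instr l W X c' v :
  step A w (Config l W X) = Some [:: c'] ->
  runs_within A w Q c' (v - 1) -> runs_within A w Q (Config l W X) v.
Proof. exact: runs_within_det. Qed.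

Lemma runs_array_addr l a u s W X v : code_at l (array_addr a u) ->
  (u < 40)%N -> (a < 16)%N -> (sc s u <= lim)%N -> represents s W X ->
  (forall W', represents s W' X -> W' (16 * 40)%N = (16 * sc s u + a)%N ->
    runs_within A w Q (Config (l + 4) W' X) (v - 4)) ->
  runs_within A w Q (Config l W X) v.
Proof.
move=> /code_at_cons[c1 /code_at_cons[c2 /code_at_cons[c3 /code_at_cons[c4 _]]]].
move=> hu ha hl hr hk.
apply: runs_within_instr; first by rewrite /= c1.
apply: runs_within_instr; first by rewrite /= c2.
apply: runs_within_instr; first by rewrite /= c3.
apply: runs_within_instr; first by rewrite /= c4.
have [h1 _ _ _] := hr.
rewrite -[l.+4]addn4; have -> : v - 1 - 1 - 1 - 1 = v - 4 by ring.
apply: hk; first by do 4 (apply: represents_scratch => //).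
rewrite /=.
have -> : (16 * u == 16 * 40)%N = false by lia.
by rewrite h1 // !modn_small; lia.
Qed.

Lemma runs_point_addr l c u s W X v : code_at l (point_addr c u) ->
  (u < 40)%N -> (c < 2)%N -> (sc s u <= lim)%N -> represents s W X ->
  (forall W', represents s W' X -> W' (16 * 40)%N = (2 * sc s u + (c + 8))%N ->
    runs_within A w Q (Config (l + 3) W' X) (v - 3)) ->
  runs_within A w Q (Config l W X) v.
Proof.
move=> /code_at_cons[c1 /code_at_cons[c2 /code_at_cons[c3 _]]].
move=> hu ha hl hr hk.
apply: runs_within_instr; first by rewrite /= c1.
apply: runs_within_instr; first by rewrite /= c2.
apply: runs_within_instr; first by rewrite /= c3.
have [h1 _ _ _] := hr.
rewrite -[l.+3]addn3; have -> : v - 1 - 1 - 1 = v - 3 by ring.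
apply: hk; first by do 3 (apply: represents_scratch => //).
by rewrite /= h1 // !modn_small; lia.
Qed.

Lemma runs_goto l l' s W X v : code_at l (goto l') -> represents s W X ->
  runs_from l' s (v - 3) -> runs_within A w Q (Config l W X) v.
Proof.
move=> /code_at_cons[c1 /code_at_cons[c2 /code_at_cons[c3 _]]] hr hk.
apply: runs_within_instr; first by rewrite /= c1.
apply: runs_within_instr; first by rewrite /= c2.
apply: runs_within_instr; first by rewrite /= c3.
rewrite /= mod0n modn_small; last by lia.
have -> : v - 1 - 1 - 1 = v - 3 by ring.
by apply: hk; do 2 (apply: represents_scratch => //).
Qed.

Lemma runs_cond l l' b s W X v :
  nth Halt (Defs.code A) l = compile_cond b l' -> wf_cond b -> represents s W X ->
  runs_from (if cond_val b s then l' else l.+1) s (v - 1) ->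
  runs_within A w Q (Config l W X) v.
Proof.
move=> hc hwf hr hk; have [h1 _ h3 _] := hr.
case: b hc hwf hk => u u' /= hc /andP[hu hu'] hk.
  by apply: runs_within_instr; first (by rewrite /= hc); rewrite !h1 //; exact: hk.
by apply: runs_within_instr; first (by rewrite /= hc); rewrite !h3 //; exact: hk.
Qed.

Lemma runs_from_le l s v v' : runs_from l s v -> v <= v' -> runs_from l s v'.
Proof. by move=> h vv W X /h; move/runs_within_le; apply. Qed.

(** The worst case is an array access: four instructions for the address and one for the access.
    Shorter atoms are charged the same. *)
Lemma runs_atom l a s v : code_at l (compile_atom a) -> wf_atom a ->
  atom_pre a s -> runs_from (l + size (compile_atom a)) (atom_run a s) (v - 5) ->
  runs_from l s v.
Proof.
move=> hc hwf hpre hk W X hr; have [h1 h2 h3 h4] := hr.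
case: a hc hwf hpre hk => [u k|op u i j|u a i|a i u|r c i|c i r] /=.
- move=> /code_at_cons[c1 _] hu hpre hk.
  apply: runs_within_instr; first by rewrite /= c1.
  clear c1.
  apply: (@runs_from_le _ _ (v - 5)); [|lra|exact: (represents_sc _ hr hu)].
  by rewrite modn_small ?addn1 in hk *; last lia.
- move=> /code_at_cons[c1 _] /and3P[hu hi hj] hpre hk.
  apply: runs_within_instr; first by rewrite /= c1.
  clear c1.
  rewrite !h1 //.
  apply: (@runs_from_le _ _ (v - 5)); [|lra|exact: (represents_sc _ hr hu)].
  suff -> : eval_wop w op (sc s i) (sc s j) = wop_val op (sc s i) (sc s j).
    by rewrite addn1 in hk.
  by case: op hpre {hk} => //= hpre; rewrite modn_small //; lia.
- move=> /(@code_at_cat _ (array_addr a i) [:: _])[ca /code_at_cons[c1 _]] /and4P[hu hi ha ha'] hpre hk.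
  apply: (runs_array_addr ca hi ha' hpre hr) => W' hr' hW'.
  apply: runs_within_instr; first by rewrite /= c1.
  clear c1.
  have [h1' h2' _ _] := hr'.
  rewrite hW' h2' ?ha //.
  apply: (@runs_from_le _ _ (v - 5)); [|lra|exact: (represents_sc _ hr' hu)].
  by rewrite -addnS.
- move=> /(@code_at_cat _ (array_addr a i) [:: _])[ca /code_at_cons[c1 _]] /and4P[hu hi ha ha'] hpre hk.
  apply: (runs_array_addr ca hi ha' hpre hr) => W' hr' hW'.
  apply: runs_within_instr; first by rewrite /= c1.
  clear c1.
  have [h1' h2' _ _] := hr'.
  rewrite hW' h1' //.
  apply: (@runs_from_le _ _ (v - 5)); [|lra|by apply: (represents_ar _ _ hr'); rewrite ha].
  by rewrite -addnS.
- move=> /(@code_at_cat _ (point_addr c i) [:: _])[ca /code_at_cons[c1 _]] /and3P[hr0 hc hi] hpre hk.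
  apply: (runs_point_addr ca hi hc hpre hr) => W' hr' hW'.
  apply: runs_within_instr; first by rewrite /= c1.
  clear c1.
  rewrite hW' h4 //.
  apply: (@runs_from_le _ _ (v - 5)); [|lra|exact: (represents_rg _ hr' hr0)].
  by rewrite -addnS.
- move=> /(@code_at_cat _ (point_addr c i) [:: _])[ca /code_at_cons[c1 _]] /and3P[hr0 hc hi] hpre hk.
  apply: (runs_point_addr ca hi hc hpre hr) => W' hr' hW'.
  apply: runs_within_instr; first by rewrite /= c1.
  clear c1.
  rewrite hW' h3 //.
  apply: (@runs_from_le _ _ (v - 5)); [|lra|exact: (represents_pt _ _ hr' hc)].
  by rewrite -addnS.
Qed.

Lemma runs_block l cs s v :
  code_at l (flatten [seq compile_atom a | a <- cs]) -> all wf_atom cs ->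
  block_pre cs s ->
  runs_from (l + size (flatten [seq compile_atom a | a <- cs])) (block_run cs s)
    (v - 5 * (size cs)%:R) ->
  runs_from l s v.
Proof.
elim: cs l s v => [|a cs IH] l s v /=; first by rewrite addn0 mulr0 subr0.
move=> /code_at_cat[c1 c2] /andP[hwa hwcs] [hpa hpcs] hk.
apply: (runs_atom c1 hwa hpa); apply: (IH _ _ _ c2 hwcs hpcs).
rewrite size_cat addnA in hk; apply: runs_from_le hk _.
by rewrite -natr1; lra.
Qed.

Lemma runs_rand l u i s K v d : nth Halt (Defs.code A) l = WRand (16 * u) (16 * i) ->
  (u < 40)%N -> (i < 40)%N ->
  (forall s v, K s v -> runs_from l.+1 s (8 * v + d)) ->
  ert (Rand u i) K s v -> runs_from l s (8 * v + d).
Proof.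
move=> hc hu hi hK [vs [hvs hv]] W X hr; have [h1 _ _ _] := hr.
pose cs := [seq Config l.+1 [eta W with (16 * u)%N |-> r] X
  | r <- iota 0 (sc s i).+1].
have szcs : size cs = (sc s i).+1 by rewrite size_map size_iota.
apply: (@runs_step _ _ _ _ _ _ cs (fun r => 8 * vs r + d)).
- by rewrite /= hc h1.
- clear hc; move=> r; rewrite szcs => hr'.
  rewrite (nth_map 0%N) ?size_iota // nth_iota // add0n.
  by apply: hK (represents_sc r hr hu); exact: hvs.
- clear hc; rewrite szcs big_split /= sumr_const card_ord -mulr_sumr mulrDl -[d *+ _]mulr_natr mulfK ?pnatr_eq0 //.
  by rewrite -mulrA; move: hv; set y := _ / _ => hv; lra.
Qed.

(* One unit of ert pays for 8 machine steps, which covers the longest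
   compiled atom and the jumps around a branch or a loop body. *)
Lemma ert_sound c : wf_cmd c -> forall l K d, code_at l (compile l c) ->
  (forall s v, K s v -> runs_from (l + size (compile l c)) s (8 * v + d)) ->
  forall s v, ert c K s v -> runs_from l s (8 * v + d).
Proof.
elim: c => [cs|c1 IH1 c2 IH2|b c1 IH1 c2 IH2|b c IH|i j].
- move=> hwf l K d hc hK s v /= [hpre /hK hk].
  apply: (runs_block hc hwf hpre); apply: runs_from_le hk _.
  have : 0 <= (size cs)%:R :> R by [].
  by lra.
- move=> /= /andP[w1 w2] l K d hc hK s v; have [hc1 hc2] := code_at_cat hc.
  apply: (IH1 w1 _ _ _ hc1); apply: (IH2 w2 _ _ _ hc2) => s' v' /hK.
  by rewrite size_cat addnA.
- move=> /= /and3P[wb w1 w2] l K d.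
  move=> /code_at_cons[hb hc] hK s v h W X hr.
  have [hc2 /(@code_at_cat _ (goto _))[hg hc1]] := code_at_cat hc.
  apply: (runs_cond hb wb hr); clear hb; move: h; case: ifP => _ h.
    have := IH1 w1 _ K (d + 3) hc1 _ _ _ h.
    move=> H; apply: (@runs_from_le _ _ (8 * (v - 1) + (d + 3))); last lra.
    apply: H => s' v' /hK; rewrite /= !size_cat /= => H.
    apply: (@runs_from_le _ _ (8 * v' + d)); last lra.
    by move: H; congr (runs_from _ _ _); lia.
  (* The additive part of the bound is raised by 3 to pay for the jump over the then branch. *)
  have := IH2 w2 _ K (d + 3) hc2 _ _ _ h.
  move=> H; apply: (@runs_from_le _ _ (8 * (v - 1) + (d + 3))); last lra.
  apply: H => s' v' /hK; rewrite /= !size_cat /= => H W' X' hr'.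
  apply: (runs_goto hg hr').
  apply: (@runs_from_le _ _ (8 * v' + d)); last lra.
  by move: H; congr (runs_from _ _ _); lia.
- move=> /= /andP[wb wc] l K d.
  move=> /code_at_cons[hb /(@code_at_cat _ (goto _))[hg /code_at_cat[hc hg']]] hK s v h.
  apply: (@runs_from_le _ _ (8 * v + (d - 4))); last by clear hb; lra.
  (* The least fixed point is instantiated with the machine bound itself. With the offset [d - 4]
     the exit path, a test and a jump of length 3, balances exactly:
     [8 * v + (d - 4) - 4 = 8 * (v - 1) + d]. *)
  move: s v h; pose I s v := runs_from l s (8 * v + (d - 4)).
  move=> s v /(_ I); apply=> {}s {}v h W X hr.
  apply: (runs_cond hb wb hr); clear hb; move: h; case: ifP => _ h.
    have {}hc : code_at (l + 4) (compile (l + 4) c).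
      by move: hc; congr (code_at _ _); rewrite /=; lia.
    apply: (@runs_from_le _ _ (8 * (v - 1) + (d - 1))); last lra.
    apply: (IH wc _ _ _ hc _ _ _ h) => s' v' hI W' X' hr'.
    move: hg'; have -> : (l.+1 + size (goto (l + 4 + size (compile (l + 4) c) + 3))
      + size (compile (l + 4) c) = l + 4 + size (compile (l + 4) c))%N.
      by rewrite /=; lia.
    move=> hg'; apply: (runs_goto hg' hr').
    by apply: runs_from_le hI _; lra.
  move=> W' X' hr'; apply: (runs_goto hg hr').
  have := hK _ _ h; rewrite /= !size_cat /= => H.
  apply: (@runs_from_le _ _ (8 * (v - 1) + d)); last lra.
  by move: H; congr (runs_from _ _ _); lia.
- move=> /= /andP[hi hj] l K d /code_at_cons[hc _] hK s v h.
  by apply: (runs_rand hc hi hj _ h) => s' v' /hK; rewrite addn1.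
Qed.

End Language.

(** * Program logic *)

(* Locations are tagged 0 for scalars, 1 for arrays, 2 for real registers and
   3 for the two coordinates of the slots. *)
Definition atom_mod (a : atom) : nat * nat :=
  match a with
  | ASet u _ | AOp _ u _ _ | ALd u _ _ => (0, u)
  | ASt a _ _ => (1, a)
  | PLd r _ _ => (2, r)
  | PSt c _ _ => (3, c)
  end%N.

Fixpoint cmd_mod (c : cmd) : seq (nat * nat) :=
  match c with
  | Block l => map atom_mod l
  | Seq c1 c2 | If _ c1 c2 => cmd_mod c1 ++ cmd_mod c2
  | While _ c => cmd_mod c
  | Rand u _ => [:: (0, u)]%N
  end.

Section Logic.
Variables (R : realType) (lim : nat).
Implicit Types (s : state R) (v : R) (K : state R -> R -> Prop) (t : nat).
Local Notation ert := (@ert R lim).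

Definition frame (L : seq (nat * nat)) s s' : Prop :=
  [/\ forall u, (0, u)%N \notin L -> sc s' u = sc s u,
      forall a, (1, a)%N \notin L -> ar s' a = ar s a,
      forall r, (2, r)%N \notin L -> rg s' r = rg s r &
      forall c, (3, c)%N \notin L -> pt s' c = pt s c].

Lemma frame_refl L s : frame L s s. Proof. by []. Qed.

Lemma frame_trans L s1 s2 s3 : frame L s1 s2 -> frame L s2 s3 -> frame L s1 s3.
Proof.
by move=> [a1 a2 a3 a4] [b1 b2 b3 b4]; split=> i hi;
  rewrite ?b1 ?b2 ?b3 ?b4 ?a1 ?a2 ?a3 ?a4.
Qed.

Lemma frame_sub L L' s s' : {subset L <= L'} -> frame L s s' -> frame L' s s'.
Proof.
move=> h [h1 h2 h3 h4]; split=> x hx; [apply: h1|apply: h2|apply: h3|apply: h4];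
  by apply: contra hx; exact: h.
Qed.

Lemma frame_atom L a s : atom_mod a \in L -> frame L s (atom_run a s).
Proof.
have upd_id T (f : nat -> T) i j x : i != j -> upd f i x j = f j.
  by rewrite /upd eq_sym => /negbTE->.
have ne k i j : (k, i)%N \in L -> (k, j)%N \notin L -> i != j.
  by move=> hi; apply: contraNneq => <-.
by case: a => [u k|op u i j|u x i|x i u|r c i|c i r] /= h; split=> //= m hm;
  rewrite upd_id //; exact: ne hm.
Qed.

Lemma frame_block L l s : {subset map atom_mod l <= L} -> frame L s (block_run l s).
Proof.
elim: l s => [|a l IH] s //= h.
apply: (@frame_trans _ _ (atom_run a s)).
  by apply: frame_atom; apply: h; rewrite inE eqxx.
by apply: IH => x hx; apply: h; rewrite inE hx orbT.
Qed.

(** The set of modified locations is read off the syntax, so loop invariants need to mention only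
    what the body changes. *)
Lemma ert_frame L c K s0 s v : {subset cmd_mod c <= L} -> frame L s0 s ->
  ert c K s v -> ert c (fun s' v' => K s' v' /\ frame L s0 s') s v.
Proof.
elim: c K s v => [l|c1 IH1 c2 IH2|b c1 IH1 c2 IH2|b c IH|i j] K s v /= hL hs.
- move=> [hp hK]; split=> //; split=> //.
  exact: (frame_trans hs (frame_block _ hL)).
- move=> h; have hL1 : {subset cmd_mod c1 <= L}.
    by move=> x hx; apply: hL; rewrite mem_cat hx.
  apply: ert_mono (IH1 _ _ _ hL1 hs h) => s' v' [h' hs'].
  by apply: IH2 => // x hx; apply: hL; rewrite mem_cat hx orbT.
- case: ifP => _ h; [apply: IH1|apply: IH2] => // x hx; apply: hL;
    by rewrite mem_cat hx ?orbT.
- move=> h I HI; move: hs.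
  apply: (h (fun s v => frame L s0 s -> I s v)) => {h}s {}v h hs.
  apply: HI; move: h; case: ifP => _ h; last by split.
  by apply: ert_mono (IH _ _ _ hL hs h) => s' v' [].
- move=> [vs [hvs hv]]; exists vs; split=> // r hr; split; first exact: hvs.
  apply: (frame_trans hs).
  by apply: (@frame_atom _ (ASet i r)); apply: hL; rewrite inE eqxx.
Qed.

Lemma ert_if b c1 c2 K s v :
  (if cond_val b s then ert c1 K s (v - 1) else ert c2 K s (v - 1)) ->
  ert (If b c1 c2) K s v.
Proof. by []. Qed.

(* From s, the command c takes at most t units of time, whatever the random
   choices, and ends in a state satisfying Q. *)
Definition tri (c : cmd) s t (Q : state R -> Prop) : Prop :=
  forall K v, (forall s' v', Q s' -> v - t%:R <= v' -> K s' v') -> ert c K s v.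

Lemma tri_weak c s t t' (Q Q' : state R -> Prop) :
  tri c s t Q -> (t <= t')%N -> (forall s', Q s' -> Q' s') -> tri c s t' Q'.
Proof.
move=> h tt' QQ' K v hK; apply: h => s' v' /QQ' hQ' hv; apply: hK => //.
by apply: le_trans hv; rewrite lerD2l lerN2 ler_nat.
Qed.

Lemma tri_frame c s t Q :
  tri c s t Q -> tri c s t (fun s' => Q s' /\ frame (cmd_mod c) s s').
Proof.
move=> h K v hK.
have := h (fun s' v' => Q s' /\ v - t%:R <= v') v.
move=> /(_ (fun s' v' a b => conj a b)) h'.
apply: ert_mono (ert_frame (fun x => id) (frame_refl _ s) h') => s' v' [[hQ hv] hf].
by apply: hK.
Qed.

Lemma tri_block l s t (Q : state R -> Prop) : block_pre lim l s -> (size l <= t)%N ->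
  Q (block_run l s) -> tri (Block l) s t Q.
Proof.
move=> hp ht hQ K v hK; split=> //; apply: hK => //.
by rewrite lerD2l lerN2 ler_nat.
Qed.

Lemma tri_block_seq l c s t Q : block_pre lim l s -> (size l <= t)%N ->
  tri c (block_run l s) (t - size l) Q -> tri (Seq (Block l) c) s t Q.
Proof.
move=> hp ht hQ K v hK; split=> //; apply: hQ => s' v' hQ' hv; apply: hK => //.
by move: hv; rewrite natrB //; lra.
Qed.

Lemma tri_seq c1 c2 s t1 t2 t Q1 Q : tri c1 s t1 Q1 ->
  (forall s1, Q1 s1 -> frame (cmd_mod c1) s s1 -> tri c2 s1 t2 Q) ->
  (t1 + t2 <= t)%N -> tri (Seq c1 c2) s t Q.
Proof.
move=> /tri_frame h1 h2 ht K v hK; apply: h1 => s1 v1 [hQ1 hf] hv1.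
apply: (h2 _ hQ1 hf) => s2 v2 hQ2 hv2; apply: hK => //.
move: ht; rewrite -(ler_nat R) natrD; lra.
Qed.

Lemma tri_if b c1 c2 s t Q : (0 < t)%N ->
  (cond_val b s -> tri c1 s t.-1 Q) -> (~~ cond_val b s -> tri c2 s t.-1 Q) ->
  tri (If b c1 c2) s t Q.
Proof.
case: t => // t _ /= h1 h2 K v hK /=.
have e v' : v - 1 - t%:R <= v' -> v - t.+1%:R <= v'.
  by rewrite -natr1; lra.
by case: ifPn => hb; [apply: h1|apply: h2] => // s' v' hQ /e; exact: hK.
Qed.

Lemma tri_while (I : nat -> state R -> Prop) b c s0 k Q :
  (forall k s, I k s -> frame (cmd_mod c) s0 s -> cond_val b s ->
     exists tb, tri c s tb (fun s' => exists k', (k' + tb < k)%N /\ I k' s')) ->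
  (forall k s, I k s -> frame (cmd_mod c) s0 s -> ~~ cond_val b s ->
     (0 < k)%N /\ Q s) ->
  I k s0 -> tri (While b c) s0 k Q.
Proof.
move=> h1 h2 h0 K v hK.
suff H : forall n k s v, (k <= n)%N -> I k s -> frame (cmd_mod c) s0 s ->
    (forall s' v', Q s' -> v - k%:R <= v' -> K s' v') -> ert (While b c) K s v.
  exact: (H k k s0 v (leqnn k) h0 (frame_refl _ _) hK).
elim=> [|n IH] {h0 hK v}k s v hkn hI hf hK; apply: ert_while_unfold;
    case: ifPn => hb.
- have [tb htb] := h1 _ _ hI hf hb.
  by apply: htb => s' v' [k' [hk']]; lia.
- by have [] := h2 _ _ hI hf hb; lia.
- have [tb /tri_frame htb] := h1 _ _ hI hf hb.
  apply: htb => s' v' [[k' [hk' hI']] hf'] hv'.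
  apply: (IH k' s' v' _ hI' (frame_trans hf hf')) => [|s2 v2 hQ hv2]; first lia.
  apply: hK => //; move: hk'; rewrite -(ler_nat R) -natr1 natrD => hk'; lra.
- have [k0 hQ] := h2 _ _ hI hf hb.
  by apply: hK => //; rewrite lerD2l lerN2 ler1n.
Qed.

Lemma tri_for (I : state R -> Prop) (f : state R -> nat) tb b c s0 t Q :
  (forall s, I s -> frame (cmd_mod c) s0 s -> cond_val b s ->
     tri c s tb (fun s' => I s' /\ (f s' < f s)%N)) ->
  (forall s, I s -> frame (cmd_mod c) s0 s -> ~~ cond_val b s -> Q s) ->
  I s0 -> (f s0 * tb.+1 < t)%N -> tri (While b c) s0 t Q.
Proof.
move=> h1 h2 h0 ht.
apply: (@tri_while (fun k s => I s /\ (f s * tb.+1 < k)%N)) => //.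
- move=> k s [hI hk] hf hb; exists tb.
  apply: tri_weak (h1 s hI hf hb) (leqnn _) _ => s' [hI' hlt].
  by exists (f s' * tb.+1).+1; split=> //; nia.
- by move=> k s [hI hk] hf hb; split; [lia|exact: h2].
Qed.

End Logic.

(** * Staircases *)

Section Staircases.
Variable R : realType.
Implicit Types X Y : nat -> R * R.

(** With x decreasing and y increasing along the slots, the points to the right of a vertical line
    form a prefix and those above a horizontal line a suffix, so each is found by one binary
    search. *)
Definition stair X (lo hi : nat) : Prop :=
  forall a b, (lo <= a)%N -> (a < b)%N -> (b < hi)%N ->
    (X b).1 < (X a).1 /\ (X a).2 < (X b).2.

Definition below (p q : R * R) : Prop := p.1 <= q.1 /\ p.2 <= q.2.

Lemma below_trans q p r : below p q -> below q r -> below p r.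
Proof. by move=> [a b] [c d]; split; [exact: le_trans c|exact: le_trans d]. Qed.

(* The staircase of the points S i with a0 <= i < a1, stored in slots
   lo, ..., hi - 1 by decreasing x-coordinate. *)
Definition stair_of (S : nat -> R * R) X (lo hi a0 a1 : nat) : Prop :=
  [/\ stair X lo hi,
      forall a, (lo <= a < hi)%N -> exists i, (a0 <= i < a1)%N /\ X a = S i &
      forall i, (a0 <= i < a1)%N -> exists a, (lo <= a < hi)%N /\ below (S i) (X a)].

Lemma stair_of_ext S X Y lo hi a0 a1 : stair_of S X lo hi a0 a1 ->
  (forall a, (lo <= a < hi)%N -> Y a = X a) -> stair_of S Y lo hi a0 a1.
Proof.
move=> [h1 h2 h3] hXY; split.
- by move=> a b ha hab hb; rewrite !hXY; [exact: h1|lia|lia].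
- by move=> a ha; rewrite hXY //; exact: h2.
- by move=> i /h3[a [ha hb]]; exists a; rewrite hXY.
Qed.

Lemma stair_of_shift S X Y lo hi lo' a0 a1 : stair_of S X lo hi a0 a1 ->
  (forall a, (lo + a < hi)%N -> Y (lo' + a)%N = X (lo + a)%N) ->
  stair_of S Y lo' (lo' + (hi - lo)) a0 a1.
Proof.
move=> [h1 h2 h3] hXY; split.
- move=> a b ha hab hb.
  have := h1 (lo + (a - lo'))%N (lo + (b - lo'))%N.
  rewrite -!hXY; [|lia|lia].
  have -> : (lo' + (b - lo') = b)%N by lia.
  have -> : (lo' + (a - lo') = a)%N by lia.
  by apply; lia.
- move=> a ha; have := h2 (lo + (a - lo'))%N.
  rewrite -!hXY; last lia.
  have -> : (lo' + (a - lo') = a)%N by lia.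
  by apply; lia.
- move=> i /h3[a [ha hb]]; exists (lo' + (a - lo))%N; split; first lia.
  by rewrite hXY; [have -> : (lo + (a - lo) = a)%N by lia|lia].
Qed.

(* Invariant of the merge: the slots q0, ..., q - 1 of Y hold the staircase of
   the slots of X in D, and Rm contains those still to be merged. *)
Record merging X Y (D Rm : nat -> Prop) (q0 q : nat) : Prop := Merging {
  merging_stair : stair Y q0 q;
  merging_src : forall a, (q0 <= a < q)%N -> exists r, D r /\ Y a = X r;
  merging_cover : forall r, D r -> exists a, (q0 <= a < q)%N /\ below (X r) (Y a);
  merging_lt : forall a r, (q0 <= a < q)%N -> Rm r -> (X r).1 < (Y a).1 }.

(** Candidates arrive by decreasing x, so the last slot written lies to the right of [c]; if it is
    also at least as high, it covers [c]. *)
Lemma merging_skip X Y (D Rm D' Rm' : nat -> Prop) q0 q c :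
  merging X Y D Rm q0 q -> Rm c -> (q0 < q)%N -> (X c).2 <= (Y q.-1).2 ->
  (forall r, D r -> D' r) -> (forall r, D' r -> D r \/ r = c) ->
  (forall r, Rm' r -> Rm r) -> merging X Y D' Rm' q0 q.
Proof.
move=> [h1 h2 h3 h4] hc hq hy d1 d2 hr; split=> //.
- by move=> a /h2[r [/d1 hr' e]]; exists r.
- move=> r /d2[/h3//|->]; exists q.-1; split; first lia.
  by split=> //; apply/ltW/h4 => //; lia.
- by move=> a r ha /hr; exact: h4.
Qed.

(** The last slot is the highest one so far, hence comparing [c] with it alone keeps the
    staircase. *)
Lemma merging_append X Y Y' (D Rm D' Rm' : nat -> Prop) q0 q c :
  merging X Y D Rm q0 q -> Rm c -> (q0 <= q)%N ->
  ((q0 < q)%N -> (Y q.-1).2 < (X c).2) ->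
  (forall r, D r -> D' r) -> D' c -> (forall r, D' r -> D r \/ r = c) ->
  (forall r, Rm' r -> Rm r /\ (X r).1 < (X c).1) ->
  (forall a, (q0 <= a < q)%N -> Y' a = Y a) -> Y' q = X c ->
  merging X Y' D' Rm' q0 q.+1.
Proof.
move=> [h1 h2 h3 h4] hc hq hy d1 d1' d2 hr hY hYq; split.
- move=> a b ha hab hb; have [hbq|hbq] := ltnP b q.
    by rewrite !hY; [exact: h1|lia|lia].
  have -> : b = q by lia.
  rewrite hYq hY; last lia.
  split; first by apply: h4 => //; lia.
  have [e|hne] := eqVneq a q.-1; first by rewrite e; apply: hy; lia.
  by apply: lt_trans (hy _); [apply: (h1 a q.-1 _ _ _).2; lia|lia].
- move=> a ha; have [haq|haq] := ltnP a q.
    have [|r [hr' e]] := h2 a; first lia.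
    by exists r; rewrite hY; [split; [exact: d1|]|lia].
  have -> : a = q by lia.
  by exists c.
- move=> r /d2[/h3[a [ha hb]]|->].
    by exists a; rewrite hY //; split=> //; lia.
  by exists q; rewrite hYq; split; [lia|split].
- move=> a r ha /hr[hr1 hr2]; have [haq|haq] := ltnP a q.
    by rewrite hY; [apply: h4 => //|]; lia.
  have -> : a = q by lia.
  by rewrite hYq.
Qed.

End Staircases.

(** * The program *)

(* Slots n, ..., 2n - 1 hold the staircases of the blocks, slots 2n, ..., 3n - 1
   are the merge buffer, and the front is collected from slot 3n on.  Points
   0, ..., 3 of the input and of the output lie in the registers, point i > 3
   in slot i - 4.  The array aOff contains the block boundaries.  A node is a
   range of entries, given by aStart and aCount; an entry is an interval of
   slots, given by aLo and aHi. *)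
Notation vN := 0%N (only parsing).
Notation vOne := 1%N (only parsing).
Notation vTwo := 2%N (only parsing).
Notation vZero := 3%N (only parsing).
Notation vBuf := 4%N (only parsing).
Notation vRes := 5%N (only parsing).
Notation vM := 6%N (only parsing).
Notation vI := 7%N (only parsing).
Notation vI1 := 8%N (only parsing).
Notation vJ := 9%N (only parsing).
Notation vJ1 := 10%N (only parsing).
Notation vBlk := 11%N (only parsing).
Notation vNew := 12%N (only parsing).
Notation vQ := 13%N (only parsing).
Notation vDst := 14%N (only parsing).
Notation vRem := 15%N (only parsing).
Notation vC := 16%N (only parsing).
Notation vU := 17%N (only parsing).
Notation vV := 18%N (only parsing).
Notation vSp := 19%N (only parsing).
Notation vT := 20%N (only parsing).
Notation vOut := 21%N (only parsing).
Notation vTop := 22%N (only parsing).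
Notation vE := 23%N (only parsing).
Notation vS := 24%N (only parsing).
Notation vK := 25%N (only parsing).
Notation vSe := 26%N (only parsing).
Notation vTot := 27%N (only parsing).
Notation vR := 28%N (only parsing).
Notation vLo := 29%N (only parsing).
Notation vHi := 30%N (only parsing).
Notation vL0 := 31%N (only parsing).
Notation vMid := 32%N (only parsing).
Notation vF := 33%N (only parsing).
Notation vFe := 34%N (only parsing).
Notation vS2 := 35%N (only parsing).
Notation vGo := 36%N (only parsing).
Notation vH0 := 37%N (only parsing).
Notation aOff := 1%N (only parsing).
Notation aLo := 2%N (only parsing).
Notation aHi := 3%N (only parsing).
Notation aStart := 4%N (only parsing).
Notation aCount := 5%N (only parsing).

Definition mov (u v : nat) : atom := AOp WAdd u v vZero.
Definition incr (u : nat) : atom := AOp WAdd u u vOne.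
Definition copy_point (dst src : nat) : seq atom :=
  [:: PLd 0 0 src; PSt 0 dst 0; PLd 0 1 src; PSt 1 dst 0].

Definition setup : cmd :=
  Seq (Block [:: AOp WAdd vBuf vN vN; AOp WAdd vRes vBuf vN; mov vU vN;
        PSt 0 vU 0; PSt 1 vU 1; incr vU; PSt 0 vU 2; PSt 1 vU 3; incr vU;
        PSt 0 vU 4; PSt 1 vU 5; incr vU; PSt 0 vU 6; PSt 1 vU 7; ASet vI 4])
 (Seq (While (CLt vI vN) (Block ([:: ASet vU 4; AOp WSub vU vI vU;
        AOp WAdd vV vN vI] ++ copy_point vV vU ++ [:: incr vI])))
 (Seq (Block [:: ASet vI 0; mov vV vN])
 (Seq (While (CLt vI vN) (Block [:: ASt aOff vI vV; incr vI; incr vV]))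
      (Block [:: ASt aOff vI vV; mov vM vN; ASet vSp 1])))).

Definition take_i : cmd := Block [:: mov vC vI; incr vI].
Definition take_j : cmd := Block [:: mov vC vJ; incr vJ].

(** Register 4 gets the height of the last point in the buffer or, if the buffer is empty, of the
    candidate itself; in the latter case the test [CRlt 3 4] fails and the candidate is kept. *)
Definition merge_step : cmd :=
  Seq (Block [:: PLd 0 0 vI; PLd 1 0 vJ])
 (Seq (If (CLt vJ vJ1) (If (CLt vI vI1) (If (CRlt 0 1) take_j take_i) take_j)
        take_i)
 (Seq (Block [:: AOp WSub vRem vRem vOne; PLd 2 0 vC; PLd 3 1 vC])
 (Seq (If (CLt vBuf vQ) (Block [:: AOp WSub vU vQ vOne; PLd 4 1 vU])
        (Block [:: PLd 4 1 vC]))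
      (If (CRlt 3 4) (Block [::])
        (Block [:: PSt 0 vQ 2; PSt 1 vQ 3; incr vQ]))))).

Definition merge_loop : cmd := While (CLt vZero vRem) merge_step.

Definition copy_back : cmd :=
  While (CLt vU vQ) (Block (copy_point vDst vU ++ [:: incr vU; incr vDst])).

(** An unpaired last block is merged with the empty interval that starts at its end. The result is
    copied down to [vDst], so the blocks are compacted towards slot [n] as points disappear. *)
Definition merge_pair : cmd :=
  Seq (Block [:: ALd vI aOff vBlk; incr vBlk; ALd vI1 aOff vBlk;
        mov vJ vI1; mov vJ1 vI1])
 (Seq (If (CLt vBlk vM) (Block [:: incr vBlk; ALd vJ1 aOff vBlk]) (Block [::]))
 (Seq (Block [:: AOp WSub vRem vI1 vI; AOp WSub vU vJ1 vJ; AOp WAdd vRem vRem vU;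
        mov vQ vBuf])
 (Seq merge_loop
 (Seq (Block [:: mov vU vBuf])
 (Seq copy_back
      (Block [:: incr vNew; ASt aOff vNew vDst])))))).

Definition merge_pass : cmd :=
  Seq (Block [:: ASet vBlk 0; ASet vNew 0; mov vDst vN])
 (Seq (While (CLt vBlk vM) merge_pair)
      (Block [:: mov vM vNew])).

Definition halve : seq atom :=
  [:: AOp WAdd vMid vLo vHi; AOp WDiv vMid vMid vTwo].

Definition search (c : nat) (narrow : cmd) : cmd :=
  While (CLt vLo vHi) (Seq (Block (halve ++ [:: PLd 2 c vMid])) narrow).

(* Moves vLo to the first slot between vLo and vHi whose x-coordinate is at
   most the register 0. *)
Definition search_x : cmd :=
  search 0 (If (CRlt 0 2) (Block [:: AOp WAdd vLo vMid vOne]) (Block [:: mov vHi vMid])).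

(* Moves vLo to the first slot between vLo and vHi whose y-coordinate exceeds
   the register 1. *)
Definition search_y : cmd :=
  search 1 (If (CRlt 1 2) (Block [:: mov vHi vMid]) (Block [:: AOp WAdd vLo vMid vOne])).

Definition load_entry : seq atom := [:: ALd vLo aLo vE; ALd vHi aHi vE].

Definition push_entry (lo hi : nat) : seq atom :=
  [:: ASt aLo vTop lo; ASt aHi vTop hi; incr vTop].

(* Pushes the node made of the entries from vS2 to vTop. *)
Definition push_node : seq atom :=
  [:: ASt aStart vSp vS2; AOp WSub vU vTop vS2; ASt aCount vSp vU; incr vSp].

(** Staircases are stored by decreasing x but the front is output by increasing x, so the slots are
    read backwards. *)
Definition emit_node : cmd :=
  Seq (Block [:: mov vE vS; ALd vLo aLo vE; ALd vHi aHi vE])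
      (While (CLt vLo vHi)
        (Block ([:: AOp WSub vHi vHi vOne] ++ copy_point vOut vHi ++ [:: incr vOut]))).

Definition node_size : cmd :=
  Seq (Block [:: AOp WAdd vT vT vK; AOp WAdd vSe vS vK; ASet vTot 0; mov vE vS])
      (While (CLt vE vSe)
        (Block (load_entry ++ [:: AOp WSub vU vHi vLo; AOp WAdd vTot vTot vU; incr vE]))).

Definition locate : cmd :=
  Seq (Block ([:: mov vE vS] ++ load_entry ++
        [:: AOp WSub vU vHi vLo; AOp WAdd vV vR vOne]))
 (Seq (While (CLt vU vV)
        (Block ([:: AOp WSub vR vR vU; incr vE] ++ load_entry ++
          [:: AOp WSub vU vHi vLo; AOp WAdd vV vR vOne])))
      (Block [:: AOp WAdd vF vLo vR; mov vFe vE; PLd 0 0 vF; PLd 1 1 vF])).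

Definition search_right : cmd := Seq (Block (load_entry ++ [:: mov vL0 vLo])) search_x.
Definition search_left : cmd := Seq (Block (load_entry ++ [:: mov vH0 vHi])) search_y.

(** In a staircase the highest point to the right of the pivot is the last one of the prefix found
    by [search_right]. The pivot itself, which is not strictly to its own right, is the initial
    value of [vF]. Register 0 keeps the x-coordinate of the pivot, register 1 follows the height of
    [vF]. *)
Definition query_step : cmd :=
  Seq search_right
 (Seq (If (CLt vL0 vLo)
        (Seq (Block [:: AOp WSub vU vLo vOne; PLd 2 1 vU])
          (If (CRlt 1 2) (Block [:: mov vF vU; mov vFe vE; PLd 1 1 vF])
            (Block [::])))
        (Block [::]))
      (Block [:: incr vE])).

Definition query : cmd :=
  Seq (Block [:: mov vE vS]) (While (CLt vE vSe) query_step).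

(* Runs part on the entries from vE to bound and pushes the interval that it
   leaves in u and v, unless that interval is empty. *)
Definition push_parts (part : cmd) (u v bound : nat) : cmd :=
  While (CLt vE bound)
    (Seq part
    (Seq (If (CLt u v) (Block (push_entry u v)) (Block [::]))
         (Block [:: incr vE]))).

Definition split_right : cmd :=
  Seq (Block [:: PLd 0 0 vF; mov vS2 vTop; mov vE vFe])
 (Seq (push_parts search_right vL0 vLo vSe)
      (Block push_node)).

Definition push_front : cmd :=
  Block ([:: mov vS2 vTop; AOp WAdd vU vF vOne] ++ push_entry vF vU ++ push_node).

Definition split_left : cmd :=
  Seq (Block [:: mov vS2 vTop; mov vE vS; incr vFe])
 (Seq (push_parts search_left vLo vH0 vFe)
      (Block push_node)).

(** The left part is pushed last and hence popped first, so that the output is produced from left to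
    right. *)
Definition after_pivot : cmd :=
  Seq locate (Seq query (Seq split_right (Seq push_front split_left))).

Definition split_node : cmd :=
  Seq node_size (Seq (Block [:: AOp WSub vU vTot vOne]) (Seq (Rand vR vU) after_pivot)).

Definition pop_node : cmd :=
  Seq (Block [:: AOp WSub vSp vSp vOne; ALd vS aStart vSp; ALd vK aCount vSp])
      (If (CLt vOne vK) split_node (If (CLt vZero vK) emit_node (Block [::]))).

(* The search is given up when more than n entries have been processed. *)
Definition search_loop : cmd :=
  While (CLt vZero vGo)
    (Seq pop_node
    (Seq (Block [:: mov vGo vSp])
         (If (CLt vN vT) (Block [:: ASet vGo 0]) (Block [::])))).

Definition init_search : cmd :=
  Seq (Block [:: ASet vE 0])
 (Seq (While (CLt vE vM)
        (Block [:: ALd vU aOff vE; ASt aLo vE vU; AOp WAdd vV vE vOne;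
                   ALd vU aOff vV; ASt aHi vE vU; mov vE vV]))
      (Block [:: mov vTop vM; ASt aStart vZero vZero; ASt aCount vZero vM;
                 ASet vSp 1; ASet vT 0; mov vOut vRes; ASet vGo 1])).

(** A stack that is not empty after a search tells that the search was given up; its partial output
    is discarded when [init_search] resets [vOut]. For the first phase [setup] sets [vSp] to 1. *)
Definition phases : cmd :=
  While (CLt vZero vSp) (Seq merge_pass (Seq init_search search_loop)).

(** Points from index 4 on are moved before the registers are filled, since copying a point uses
    register 0 as scratch. *)
Definition write_output : cmd :=
  Seq (Block [:: ASet vI 4; AOp WSub vU vOut vRes; mov vM vU])
 (Seq (While (CLt vI vM) (Block ([:: ASet vU 4; AOp WSub vU vI vU;
        AOp WAdd vV vRes vI] ++ copy_point vU vV ++ [:: incr vI])))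
      (Block [:: mov vU vRes; PLd 0 0 vU; PLd 1 1 vU; incr vU;
        PLd 2 0 vU; PLd 3 1 vU; incr vU; PLd 4 0 vU; PLd 5 1 vU; incr vU;
        PLd 6 0 vU; PLd 7 1 vU; mov vN vM])).

Definition main : cmd :=
  Seq (Block [:: ASet vOne 1; ASet vTwo 2; ASet vZero 0])
      (If (CLt vZero vN) (Seq setup (Seq phases write_output)) (Block [::])).

Definition pareto_algorithm : algorithm := Algorithm (compile 0 main) 31.

Lemma wf_main : wf_cmd main.
Proof. by []. Qed.

(** * Building the staircases *)

Definition slot (R : realType) (s : state R) (p : nat) : R * R :=
  (pt s 0%N p, pt s 1%N p).

Arguments upd T f i x j /.

Section Preparation.
Variables (R : realType) (lim n : nat) (S : nat -> R * R).
Hypothesis hlim : (64 * n + 64 <= lim)%N.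
Local Notation tri := (@tri R lim).

Definition consts (s : state R) : Prop :=
  [/\ sc s vN = n, sc s vOne = 1%N, sc s vTwo = 2%N & sc s vZero = 0%N] /\
  [/\ sc s vBuf = (2 * n)%N & sc s vRes = (3 * n)%N].

Lemma consts_frame L s s' : frame L s s' ->
  all (fun u => (0, u)%N \notin L) [:: vN; vOne; vTwo; vZero; vBuf; vRes] ->
  consts s -> consts s'.
Proof.
move=> [h _ _ _] /and5P[h0 h1 h2 h3 /and3P[h4 h5 _]] [[a b c d] [e f]].
by split; split; rewrite h.
Qed.

Lemma setup_spec s : (0 < n)%N ->
  [/\ sc s vN = n, sc s vOne = 1%N, sc s vTwo = 2%N & sc s vZero = 0%N] ->
  (forall i, (i < 4)%N -> S i = (rg s (2 * i)%N, rg s (2 * i).+1)) ->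
  (forall i, S (4 + i)%N = slot s i) ->
  tri setup s (100 * n + 100) (fun s' =>
    [/\ consts s', sc s' vM = n, sc s' vSp = 1%N,
      forall i, (i < n)%N -> slot s' (n + i) = S i &
      forall i, (i <= n)%N -> ar s' aOff i = (n + i)%N]).
Proof.
move=> n0 [e0 e1 e2 e3] hS4 hS.
pose I s' := [/\ consts s', (4 <= sc s' vI)%N,
  forall i, (i < n)%N -> slot s' i = slot s i &
  forall i, (i < 4)%N || (i < sc s' vI)%N -> slot s' (n + i) = S i].
apply: (@tri_seq _ _ _ _ _ 15 (60 * n + 50) _ I); last 1 first.
- by lia.
- apply: tri_block => //=; rewrite ?e0 ?e1 ?e2 ?e3 ?addn0 /=.
    by do !split; lia.
  split=> /=.
  - by split; split=> /=; rewrite ?e0 ?e1 ?e2 ?e3; lia.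
  - by [].
  - move=> i hi; rewrite /slot /=.
    by do 4 (case: eqP => [|_]; first lia).
  - move=> i; rewrite orbb => hi; rewrite hS4 // /slot /=.
    case: i hi => [|[|[|[|i]]]] //= _;
      by do 4? (case: eqP => [?|?]; first (by [] || lia)); lia.
move=> s1 hI1 _.
apply: (@tri_seq _ _ _ _ _ (10 * n + 10) (40 * n + 40) _
  (fun s' => consts s' /\ forall i, (i < n)%N -> slot s' (n + i) = S i)); last lia.
  apply: (@tri_for _ _ I (fun s' => (n - sc s' vI)%N) 8) => //; last lia.
  - move=> s2 [hc2 h42 hs2 hp2] hf2 /=; have [[c0 c1 c2 c3] [c4 c5]] := hc2.
    rewrite c0 => hin; apply: tri_block => //=; rewrite ?c0 ?c1 ?c3; first by do !split; lia.
    split; last by lia.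
    split=> /=; first by split; split.
    + lia.
    + move=> i hi; rewrite /slot /=.
      by case: eqP => [|_]; [lia|exact: hs2].
    + move=> i hi; rewrite /slot /= !eqn_add2l; case: eqP => [->|ne].
        have /hs2 : (sc s2 vI - 4 < n)%N by lia.
        by rewrite -hS; have -> : (4 + (sc s2 vI - 4) = sc s2 vI)%N by lia.
      by apply: hp2; lia.
  - move=> s2 [hc2 h42 hs2 hp2] _ /=; have [[c0 _ _ _] _] := hc2.
    by rewrite c0 => hin; split=> // i hi; apply: hp2; lia.
move=> s2 [hc2 hp2] _.
pose J s' := [/\ consts s', (sc s' vI <= n)%N, sc s' vV = (n + sc s' vI)%N,
  forall i, (i < n)%N -> slot s' (n + i) = S i &
  forall i, (i < sc s' vI)%N -> ar s' aOff i = (n + i)%N].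
apply: (@tri_seq _ _ _ _ _ 2 (40 * n + 38) _ J); last lia.
  have [[c0 c1 c2 c3] _] := hc2.
  apply: tri_block => //=; rewrite ?c0 ?c1 ?c3; first by do !split; lia.
  by split=> //=; split; split.
move=> s3 hJ3 _.
apply: (@tri_seq _ _ _ _ _ (10 * n + 10) 3 _ (fun s' => J s' /\ sc s' vI = n)); last lia.
  apply: (@tri_for _ _ J (fun s' => (n - sc s' vI)%N) 3) => //; last lia.
  - move=> s4 [hc4 hi4 hv4 hp4 ho4] hf4 /=; have [[c0 c1 c2 c3] _] := hc4.
    rewrite c0 => hin; apply: tri_block => //=; rewrite ?c0 ?c1 ?c3 ?hv4; first by do !split; lia.
    split; last by lia.
    split=> //=; try lia.
    by move=> i hi; case: eqP => [->//|ne]; apply: ho4; lia.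
  - move=> s4 [hc4 hi4 hv4 hp4 ho4] _ /=; have [[c0 c1 c2 c3] _] := hc4.
    by rewrite c0 => hin; split; [split|lia].
move=> s4 [[hc4 hi4 hv4 hp4 ho4] hin] _; have [[c0 c1 c2 c3] _] := hc4.
apply: tri_block => //=; rewrite ?c0 ?c1 ?c3 ?hv4 ?hin; first by do !split; lia.
split=> //=; first by rewrite addn0.
by move=> i hi; case: eqP => [->//|ne]; apply: ho4; lia.
Qed.

End Preparation.

(** * Merging two adjacent staircases *)

Section Merging.
Variables (R : realType) (lim n : nat) (S : nat -> R * R).
Hypothesis hlim : (64 * n + 64 <= lim)%N.
Hypothesis distinct : forall i k, (i < n)%N -> (k < n)%N -> i != k ->
  (S i).1 != (S k).1 /\ (S i).2 != (S k).2.
Local Notation tri := (@tri R lim).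
Local Notation consts := (@consts R n).

(** Inside a block the strict staircase order separates the points; across the blocks they come from
    disjoint index ranges. *)
Lemma stair_of_distinct X i0 i1 j0 j1 a0 a1 a2 r r' :
  stair_of S X i0 i1 a0 a1 -> stair_of S X j0 j1 a1 a2 ->
  (a0 <= a1 <= a2)%N -> (a2 <= n)%N ->
  (i0 <= r < i1)%N || (j0 <= r < j1)%N -> (i0 <= r' < i1)%N || (j0 <= r' < j1)%N ->
  r != r' -> (X r).1 != (X r').1 /\ (X r).2 != (X r').2.
Proof.
move=> [s1 t1 _] [s2 t2 _] ha han.
have same lo hi u v : stair X lo hi -> (lo <= u < hi)%N -> (lo <= v < hi)%N ->
    u != v -> (X u).1 != (X v).1 /\ (X u).2 != (X v).2.
  move=> st hu hv; rewrite neq_lt => /orP[]uv.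
    by have [||h1 h2] := st u v _ uv; [lia|lia|rewrite gt_eqF // lt_eqF].
  by have [||h1 h2] := st v u _ uv; [lia|lia|rewrite lt_eqF // gt_eqF].
case/orP=> hr; case/orP=> hr' ne.
- exact: same s1 hr hr' ne.
- have [i [hi ->]] := t1 r hr; have [k [hk ->]] := t2 r' hr'.
  by apply: distinct; lia.
- have [i [hi ->]] := t2 r hr; have [k [hk ->]] := t1 r' hr'.
  by apply: distinct; lia.
- exact: same s2 hr hr' ne.
Qed.

Lemma merge_loop_spec s i0 i1 j0 j1 a0 a1 a2 :
  consts s -> sc s vI = i0 -> sc s vI1 = i1 -> sc s vJ = j0 -> sc s vJ1 = j1 ->
  sc s vRem = (i1 - i0 + (j1 - j0))%N -> sc s vQ = (2 * n)%N ->
  (i0 <= i1)%N -> (i1 <= j0)%N -> (j0 <= j1)%N -> (j1 <= 2 * n)%N -> 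
  (i1 - i0 + (j1 - j0) <= n)%N ->
  stair_of S (slot s) i0 i1 a0 a1 -> stair_of S (slot s) j0 j1 a1 a2 ->
  (a0 <= a1 <= a2)%N -> (a2 <= n)%N ->
  tri merge_loop s (30 * (i1 - i0 + (j1 - j0)) + 2) (fun s' =>
    [/\ forall p, (p < 2 * n)%N -> slot s' p = slot s p,
        (2 * n <= sc s' vQ <= 2 * n + (i1 - i0 + (j1 - j0)))%N &
        stair_of S (slot s') (2 * n) (sc s' vQ) a0 a2]).
Proof.
move=> hc hi hi1 hj hj1 hrem hq i01 i1j j01 j1n hn st1 st2 ha an.
have dist := stair_of_distinct st1 st2 ha an.
(* [D] describes the slots consumed so far and [Rm] those that remain, as functions of the two
   reading positions. *)
pose D i j r := (i0 <= r < i)%N || (j0 <= r < j)%N.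
pose Rm i j r := (i <= r < i1)%N || (j <= r < j1)%N.
have DRm i j r c : (i <= i1)%N -> (j <= j1)%N -> (i0 <= i)%N -> (j0 <= j)%N ->
    D i j r -> Rm i j c ->
    [/\ (i0 <= r < i1)%N || (j0 <= r < j1)%N, (i0 <= c < i1)%N || (j0 <= c < j1)%N &
      r != c].
  by rewrite /D /Rm; clear -i1j => *; split; lia.
have next i j i' j' c : (i0 <= i <= i1)%N -> (j0 <= j <= j1)%N ->
    [/\ i' = i.+1, j' = j, c = i & (i < i1)%N] \/
    [/\ i' = i, j' = j.+1, c = j & (j < j1)%N] ->
    [/\ Rm i j c, D i' j' c, forall r, D i j r -> D i' j' r,
      forall r, D i' j' r -> D i j r \/ r = c & forall r, Rm i' j' r -> Rm i j r].
  rewrite /D /Rm => hi' hj'.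
  by case=> -[-> -> -> hh]; clear -hi' hj' i1j hh; split; lia.
have next_count rem i j i' j' c : (i0 <= i <= i1)%N -> (j0 <= j <= j1)%N ->
    rem = (i1 - i + (j1 - j))%N ->
    [/\ i' = i.+1, j' = j, c = i & (i < i1)%N] \/
    [/\ i' = i, j' = j.+1, c = j & (j < j1)%N] ->
    [/\ (i0 <= i' <= i1)%N, (j0 <= j' <= j1)%N,
      (rem - 1 = i1 - i' + (j1 - j'))%N &
      (i' - i0 + (j' - j0) = (i - i0 + (j - j0)).+1)%N].
  move=> hi' hj' ->.
  by case=> -[-> -> _ hh]; clear -hi' hj' i1j hh; split; lia.
pose I s' := [/\ (i0 <= sc s' vI <= i1)%N /\ (j0 <= sc s' vJ <= j1)%N,
  sc s' vRem = (i1 - sc s' vI + (j1 - sc s' vJ))%N,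
  (2 * n <= sc s' vQ <= 2 * n + (sc s' vI - i0 + (sc s' vJ - j0)))%N,
  forall p, (p < 2 * n)%N -> slot s' p = slot s p &
  merging (slot s) (slot s') (D (sc s' vI) (sc s' vJ)) (Rm (sc s' vI) (sc s' vJ))
    (2 * n) (sc s' vQ)].
apply: (@tri_for _ _ I (fun s' => sc s' vRem) 20).
- move=> s1 [[hi' hj'] hrem' hq' hs' hm] hf; rewrite [cond_val _ _]/=.
  have /= hc1 := consts_frame hf isT hc; have [[c0 c1 c2 c3] [c4 c5]] := hc1.
  have e1 : sc s1 vI1 = i1 by case: hf => -> //.
  have e2 : sc s1 vJ1 = j1 by case: hf => -> //.
  move: hi' hj' hrem' hq' hm; set i := sc s1 vI; set j := sc s1 vJ.
  set q := sc s1 vQ; set rem := sc s1 vRem => hi' hj' hrem' hq' hm.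
  rewrite c3 => rem0.
  apply: tri_block_seq => //=; first by do !split; lia.
  set s2 := set_rg _ _ _.
  (* Treats both blocks alike: whichever of them supplies [c], everything that remains lies to the
     left of [c]. *)
  pose Pick (s3 : state R) := exists c i' j',
    [/\ sc s3 vC = c, sc s3 vI = i', sc s3 vJ = j',
      [/\ i' = i.+1, j' = j, c = i & (i < i1)%N] \/
      [/\ i' = i, j' = j.+1, c = j & (j < j1)%N] &
      forall r, Rm i' j' r -> (slot s r).1 < (slot s c).1].
  apply: (@tri_seq _ _ _ _ _ 5 12 _ Pick); last by [].
    have xi r : (i < r < i1)%N -> (slot s r).1 < (slot s i).1.
      by move=> hr; have [st _ _] := st1; apply: (st i r _ _ _).1; lia.
    have xj r : (j < r < j1)%N -> (slot s r).1 < (slot s j).1.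
      by move=> hr; have [st _ _] := st2; apply: (st j r _ _ _).1; lia.
    have takei : (i < i1)%N -> ((j < j1)%N -> (slot s j).1 < (slot s i).1) ->
        forall r, Rm i.+1 j r -> (slot s r).1 < (slot s i).1.
      move=> ii1 hji r /orP[hr|hr]; first exact: xi.
      have [->|ne] := eqVneq r j; first by apply: hji; lia.
      by apply: (@lt_trans _ _ (slot s j).1); [apply: xj|apply: hji]; lia.
    have takej : (j < j1)%N -> ((i < i1)%N -> (slot s i).1 < (slot s j).1) ->
        forall r, Rm i j.+1 r -> (slot s r).1 < (slot s j).1.
      move=> jj1 hij r /orP[hr|hr]; last exact: xj.
      have [->|ne] := eqVneq r i; first by apply: hij; lia.
      by apply: (@lt_trans _ _ (slot s i).1); [apply: xi|apply: hij]; lia.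
    have run_i : (i < i1)%N -> ((j < j1)%N -> (slot s j).1 < (slot s i).1) ->
        forall t, (1 < t)%N -> tri take_i s2 t Pick.
      move=> h1 h2 t ht; apply: tri_block => //=; rewrite ?c1 ?c3.
        by do !split; lia.
      exists i, i.+1, j; split=> /=; rewrite ?addn0 ?addn1 //.
        by left.
      exact: takei.
    have run_j : (j < j1)%N -> ((i < i1)%N -> (slot s i).1 < (slot s j).1) ->
        forall t, (1 < t)%N -> tri take_j s2 t Pick.
      move=> h1 h2 t ht; apply: tri_block => //=; rewrite ?c1 ?c3.
        by do !split; lia.
      exists j, i, j.+1; split=> /=; rewrite ?addn0 ?addn1 //.
        by right.
      exact: takej.
    have slt r : (r < 2 * n)%N -> pt s1 0%N r = (slot s r).1 by move=> /hs' <-.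
    apply: tri_if => //=; rewrite ?e2 => jj1; last by apply: run_i => //; lia.
    apply: tri_if => //=; rewrite ?e1 => ii1; last by apply: run_j => //; lia.
    have [ne _] : (slot s i).1 != (slot s j).1 /\ (slot s i).2 != (slot s j).2.
      by apply: dist; lia.
    apply: tri_if => //=; rewrite !slt; try lia; move=> hx; first exact: run_j.
    by apply: run_i => // _; rewrite lt_neqAle eq_sym ne leNgt.
  move=> s3 [c [i' [j' [ec ei ej hcase hlt]]]] [f3s f3a f3r f3p].
  have [g1 g2 g3 g4 g5] : [/\ sc s3 vOne = 1, sc s3 vBuf = 2 * n, sc s3 vQ = q,
      sc s3 vRem = rem & sc s3 vZero = 0]%N by split; rewrite f3s.
  have hp3 : pt s3 = pt s1 by rewrite -[pt s1]/(pt s2); apply: functional_extensionality_dep => k; apply: f3p.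
  have slt r : (r < 2 * n)%N -> (pt s1 0%N r, pt s1 1%N r) = slot s r by move=> /hs' <-.
  have hcn : (c < 2 * n)%N by case: hcase => -[]; lia.
  have [sl1 sl2] : pt s1 0%N c = (slot s c).1 /\ pt s1 1%N c = (slot s c).2.
    by rewrite -slt.
  apply: tri_block_seq => //=; rewrite ?ec ?g1 ?g4 ?hp3; first by do !split; lia.
  apply: (@tri_seq _ _ _ _ _ 3 5 _ (fun s4 => rg s4 4%N =
      if (2 * n < q)%N then (slot s1 q.-1).2 else (slot s c).2)) => //.
    apply: tri_if => //=; rewrite ?g2 ?g3 => hq0; apply: tri_block => //=.
    + by rewrite ?ec ?g1 ?g3; do !split; lia.
    + by rewrite hq0 hp3 g1 g3 subn1.
    + by rewrite ec; split; lia.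
    + by rewrite (negbTE hq0) hp3 ec.
  move=> s4 hr4 [f4s f4a f4r f4p].
  have hp4 : pt s4 = pt s1.
    by rewrite -hp3; apply: functional_extensionality_dep => k; apply: f4p.
  have [k1 k2 k3 k4] : [/\ sc s4 vOne = 1, sc s4 vQ = q, sc s4 vI = i' & sc s4 vJ = j']%N.
    by split; rewrite f4s.
  have k5 : sc s4 vRem = (rem - 1)%N by rewrite f4s //= g4 g1.
  have [k6 k7] : rg s4 2 = (slot s c).1 /\ rg s4 3 = (slot s c).2.
    by rewrite !f4r //= hp3 ec.
  have [d1 d2 d3 d4 d5] := next _ _ _ _ _ hi' hj' hcase.
  have hij' := next_count _ _ _ _ _ _ hi' hj' hrem' hcase.
  have hqn : (q + 1 <= lim)%N by clear -hq' hi' hj' hlim hn; lia.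
  have [b1 b2 b3 b4] := hij'.
  have hsl4 : slot s4 = slot s1 by rewrite /slot hp4.
  apply: tri_if; rewrite /cond_val ?k6 ?k7 ?hr4 //= => hlast; apply: tri_block => //=.
  - split; last by rewrite k5; lia.
    split; rewrite ?k2 ?k3 ?k4 ?k5 //; first by lia.
      by move=> p hp; rewrite hsl4 hs'.
    move: hlast; case: ifPn => [hq0|_]; last by rewrite ltxx.
    by move=> /ltW hy; rewrite hsl4; apply: merging_skip hm d1 hq0 hy d3 d4 d5.
  - by rewrite k1 k2 hqn; split; [|split; [|split]] => //; apply: leq_trans hqn; rewrite leq_addr.
  rewrite k1 k2; split; last by rewrite /= k5; lia.
  split; rewrite /= ?k2 ?k3 ?k4 ?k5 ?k1 ?addn1 //; first by lia.
    move=> p hp; rewrite /slot /=; case: eqP => [|_]; first by lia.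
    by rewrite hp4; exact: hs'.
  apply: (merging_append (c := c) hm d1 _ _ d3 d2 d4) => //.
  - by case/andP: hq'.
  (* The last slot of the buffer copies a consumed slot, which differs from [c], so distinct heights
     make the comparison strict. *)
  - move=> hq0; move: hlast; rewrite hq0 -leNgt => hle; rewrite lt_neqAle hle andbT.
    have hq1 : (2 * n <= q.-1 < q)%N by clear -hq0; lia.
    have [r [hr ->]] := merging_src hm hq1.
    have [] := DRm i j r c _ _ _ _ hr d1; rewrite ?(andP hi').1 ?(andP hi').2 ?(andP hj').1 ?(andP hj').2 //.
    by move=> hr1 hr2 ne; have [] := dist r c hr1 hr2 ne.
  - move=> r hr; split; [exact: d5|exact: hlt].
  - move=> p hp; rewrite /slot /=; case: eqP => [|_]; first by lia.
    by rewrite hp4.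
  by rewrite /slot /= eqxx k6 k7 -surjective_pairing.
- move=> s1 [hij hrem' hq' hs' [m1 m2 m3 _]] hf; rewrite [cond_val _ _]/=.
  have /= hc1 := consts_frame hf isT hc; have [[c0 c1 c2 c3] [c4 c5]] := hc1.
  rewrite c3 => rem0; split=> //; first by lia.
  have [_ t1 v1] := st1; have [_ t2 v2] := st2; split=> //.
  + move=> a /m2[r [hr ->]]; move: hr; rewrite /D => /orP[]hr.
      have [|k [hk ->]] := t1 r; first by lia.
      by exists k; split=> //; lia.
    have [|k [hk ->]] := t2 r; first by lia.
    by exists k; split=> //; lia.
  + move=> k hk; have [r [hr hb]] : exists r, D (sc s1 vI) (sc s1 vJ) r /\
        below (S k) (slot s r).
      have [hka|hka] := ltnP k a1.
        have [|r [hr hb]] := v1 k; first by lia.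
        by exists r; split=> //; rewrite /D; lia.
      have [|r [hr hb]] := v2 k; first by lia.
      by exists r; split=> //; rewrite /D; lia.
    by have [a [haq hb']] := m3 r hr; exists a; split=> //; exact: below_trans hb'.
- split; rewrite ?hi ?hj ?hq //; try lia.
  split; try by move=> *; lia.
  by move=> r hr; exfalso; move: hr; rewrite /D; lia.
- by rewrite hrem; lia.
Qed.

End Merging.

(** * One merge pass over all blocks *)

Section MergePass.
Variables (R : realType) (lim n : nat) (S : nat -> R * R).
Hypothesis hlim : (64 * n + 64 <= lim)%N.
Hypothesis distinct : forall i k, (i < n)%N -> (k < n)%N -> i != k ->
  (S i).1 != (S k).1 /\ (S i).2 != (S k).2.
Local Notation tri := (@tri R lim).
Local Notation consts := (@consts R n).

Lemma copy_back_spec s a q : consts s -> sc s vU = (2 * n)%N -> sc s vDst = a ->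
  sc s vQ = q -> (2 * n <= q <= 3 * n)%N -> (a + (q - 2 * n) <= 2 * n)%N ->
  tri copy_back s (8 * (q - 2 * n) + 2) (fun s' =>
    [/\ sc s' vDst = (a + (q - 2 * n))%N,
      forall t, (2 * n + t < q)%N -> slot s' (a + t) = slot s (2 * n + t) &
      forall p, (p < a)%N || (a + (q - 2 * n) <= p)%N -> slot s' p = slot s p]).
Proof.
move=> hc hu ha hq hq' haq.
pose I s' := [/\ (2 * n <= sc s' vU <= q)%N, sc s' vDst = (a + (sc s' vU - 2 * n))%N,
  forall t, (2 * n + t < sc s' vU)%N -> slot s' (a + t) = slot s (2 * n + t) &
  forall p, (p < a)%N || (a + (sc s' vU - 2 * n) <= p)%N -> slot s' p = slot s p].
apply: (@tri_for _ _ I (fun s' => (q - sc s' vU)%N) 6).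
- move=> s1 [hu1 hd1 hcp hot] hf; have := hf => -[fs _ _ _].
  have := consts_frame hf isT hc => -[[c0 c1 c2 c3] [c4 c5]].
  have eq1 : sc s1 vQ = q by rewrite fs.
  rewrite /= eq1 => huq.
  apply: tri_block => //=; rewrite ?c1 ?hd1; first by clear -hlim hu1 hq' haq; do !split; lia.
  have nd : (sc s1 vU == a + (sc s1 vU - 2 * n))%N = false.
    by clear -huq haq hu1; lia.
  split; last by clear -huq; lia.
  split; rewrite /= ?c1 ?hd1.
  + by clear -huq hu1; lia.
  + by clear -huq hu1; lia.
  + move=> t ht; rewrite /slot /=; case: eqP => [e|ne].
      have -> : sc s1 vU = (2 * n + t)%N by clear -e ht hu1; lia.
      by apply: hot; clear -hu1 ht haq huq; lia.
    by apply: hcp; clear -ne ht hu1; lia.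
  + move=> p hp; rewrite /slot /=; case: eqP => [e|ne].
      by exfalso; clear -e hp hu1; lia.
    by apply: hot; clear -ne hp hu1; lia.
- move=> s1 [hu1 hd1 hcp hot] hf; have := hf => -[fs _ _ _].
  have eq1 : sc s1 vQ = q by rewrite fs.
  rewrite /= eq1 => huq.
  have e : sc s1 vU = q by clear -huq hu1; lia.
  by move: hd1 hcp hot; rewrite e.
- split; rewrite ?hu ?ha; [by clear -hq'; lia|by clear; lia| |by []].
  by move=> t ht; exfalso; clear -ht; lia.
- by rewrite hu; clear; lia.
Qed.

(** The result is no longer than the two blocks together and starts at [a <= o0]; hence copying it
    back leaves all slots from [o2] on intact for the following pairs. *)
Lemma merge_pair_spec s m b d a o0 o1 o2 a0 a1 a2 :
  consts s -> sc s vM = m -> sc s vBlk = b -> sc s vNew = d -> sc s vDst = a ->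
  ar s aOff b = o0 -> ar s aOff b.+1 = o1 ->
  o2 = (if b.+1 < m then ar s aOff b.+2 else o1)%N ->
  (d <= b)%N -> (b < m)%N -> (m <= n)%N -> (a <= o0)%N -> (n <= o0)%N ->
  (o0 <= o1)%N -> (o1 <= o2)%N -> (o2 <= 2 * n)%N ->
  stair_of S (slot s) o0 o1 a0 a1 -> stair_of S (slot s) o1 o2 a1 a2 ->
  (a0 <= a1 <= a2)%N -> (a2 <= n)%N ->
  tri merge_pair s (40 * (o2 - o0) + 30) (fun s' => exists a',
    [/\ (a <= a' <= a + (o2 - o0))%N, stair_of S (slot s') a a' a0 a2,
      (forall p, (p < 2 * n)%N -> (p < a)%N || (o2 <= p)%N -> slot s' p = slot s p) &
      [/\ sc s' vBlk = (if b.+1 < m then b.+2 else b.+1)%N, sc s' vNew = d.+1,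
        sc s' vDst = a' & ar s' aOff = upd (ar s aOff) d.+1 a']]).
Proof.
move=> hc hm hb hd ha ho0 ho1 ho2 db bm mn ao0 no0 o01 o12 o2n st1 st2 ha12 ha2.
have := hc => -[[c0 c1 c2 c3] [c4 c5]].
apply: tri_block_seq => //=; first last.
- apply: (@tri_seq _ _ _ _ _ 3 (40 * (o2 - o0) + 22) _ (fun s1 =>
    [/\ slot s1 = slot s, consts s1,
      [/\ sc s1 vI = o0, sc s1 vI1 = o1, sc s1 vJ = o1 & sc s1 vJ1 = o2],
      [/\ sc s1 vBlk = (if b.+1 < m then b.+2 else b.+1)%N, sc s1 vNew = d &
        sc s1 vDst = a] & ar s1 aOff = ar s aOff])); last by lia.
    apply: tri_if => //=; rewrite hb hm c1 addn1 => hbm; apply: tri_block => //=;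
      rewrite ?hb ?c1 ?c3 ?addn0 ?addn1.
    + by clear -hbm hlim mn; do !split; lia.
    + by rewrite ho2 hbm; split=> //=; split; rewrite /= ?hb ?c1 ?addn1.
    + by rewrite ho2 (negbTE hbm); split=> //=; split; rewrite ?hb ?c1 ?addn1 // ho1 ?c3 ?addn0.
  move=> s1 [hs1 hc1 [ei ei1 ej ej1] [eb ed ea] eo] hf1 {hf1}.
  have := hc1 => -[[d0 d1 d2 d3] [d4 d5]].
  apply: tri_block_seq => //=; first by
    rewrite ?ei ?ei1 ?ej ?ej1 ?d3 ?d4; clear -hlim o01 o12 o2n; do !split; lia.
    by clear; lia.
  set s2 := set_sc _ _ _.
  have hs2 : slot s2 = slot s by rewrite -hs1.
  apply: (@tri_seq _ _ _ _ _ (30 * (o2 - o0) + 2) (8 * (o2 - o0) + 8) _ (fun s3 =>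
    [/\ forall p, (p < 2 * n)%N -> slot s3 p = slot s p,
      (2 * n <= sc s3 vQ <= 2 * n + (o2 - o0))%N &
      stair_of S (slot s3) (2 * n) (sc s3 vQ) a0 a2])).
    have e : (o2 - o0 = o1 - o0 + (o2 - o1))%N by clear -o01 o12; lia.
    rewrite e -hs2; apply: (@merge_loop_spec _ _ _ _ hlim distinct _ _ _ _ _ a0 a1) => //=;
      rewrite ?ei ?ei1 ?ej ?ej1 ?d3 ?d4 ?addn0 //;
      rewrite -?e ?hs2 //; clear -o2n o01 o12 no0; lia.
  move=> s3 [hs3 hq3 st3] f3.
  have /= hc3 := consts_frame f3 isT (hc1 : consts s2).
  have := hc3 => -[[g0 g1 g2 g3] [g4 g5]].
  apply: tri_block_seq => //=; first by rewrite g3 g4; clear -hlim; do !split; lia.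
    by clear; lia.
  set q := sc s3 vQ in hq3 st3; set s4 := set_sc _ _ _.
  apply: (@tri_seq _ _ _ _ _ (8 * (q - 2 * n) + 2) 2 _ (fun s5 =>
    [/\ sc s5 vDst = (a + (q - 2 * n))%N,
      forall t, (2 * n + t < q)%N -> slot s5 (a + t) = slot s4 (2 * n + t) &
      forall p, (p < a)%N || (a + (q - 2 * n) <= p)%N -> slot s5 p = slot s4 p])).
  + apply: copy_back_spec => //=.
    * by rewrite g3 g4 addn0.
    * by case: f3 => -> //=; rewrite ea.
    * by clear -hq3 o2n no0; lia.
    * by clear -hq3 ao0 o01 o12 o2n; lia.
  + move=> s5 [ed5 hcp hot] f5.
    have /= hc5 := consts_frame f5 isT (hc3 : consts s4).
    have := hc5 => -[[h0 h1 h2 h3] [h4 h5]].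
    have en : sc s5 vNew = d.
      by case: f5 => -> //= _ _ _; case: f3 => -> //=; rewrite ed.
    apply: tri_block => //=; rewrite en h1 addn1; first by clear -hlim db bm mn; do !split; lia.
    exists (a + (q - 2 * n))%N; split=> /=.
    * by clear -hq3; lia.
    * by apply: (stair_of_shift st3) => t ht; exact: hcp.
    * move=> p hp hp'; rewrite -(hs3 p hp); apply: hot.
      by clear -hp' hq3 ao0 o01 o12; lia.
    * split=> //=; first by case: f5 => -> //= _ _ _; case: f3 => -> //=; rewrite eb.
      by rewrite ed5; case: f5 => _ -> //= _ _; case: f3 => _ -> //= _ _; rewrite eo.
  + by clear -hq3; lia.
  + by clear; lia.
- by clear; lia.
- rewrite ?hb ?c1 ?c3 ?addn1 ?ho1; clear -hlim bm mn o12 o2n; do !split; lia.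
Qed.


(** Block [b] stands for [2 ^ J] consecutive indices but keeps only the points of their staircase,
    hence the explicit boundaries [off]. [blocks_index] states that [m] is [n / 2 ^ J] rounded
    up. *)
Record blocks (J m : nat) (off : nat -> nat) (X : nat -> R * R) : Prop := Blocks {
  blocks_gt0 : (0 < m <= n)%N;
  blocks_index : (m.-1 * 2 ^ J < n <= m * 2 ^ J)%N;
  blocks_start : off 0%N = n;
  blocks_end : (off m <= 2 * n)%N;
  blocks_size : forall b, (b < m)%N -> (off b <= off b.+1 <= off b + 2 ^ J)%N;
  blocks_stair : forall b, (b < m)%N -> stair_of S X (off b) (off b.+1)
    (minn (b * 2 ^ J) n) (minn (b.+1 * 2 ^ J) n) }.

Lemma blocks_mono J m off X b b' : blocks J m off X ->
  (b <= b')%N -> (b' <= m)%N -> (off b <= off b')%N.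
Proof.
move=> h; elim: b' => [|b' IH]; first by rewrite leqn0 => /eqP->.
rewrite leq_eqVlt => /orP[/eqP->//|]; rewrite ltnS => bb' b'm.
by apply: leq_trans (IH bb' (ltnW b'm)) _; case/andP: (blocks_size h b'm).
Qed.

Lemma merge_pass_spec s J : consts s ->
  blocks J (sc s vM) (ar s aOff) (slot s) ->
  tri merge_pass s (72 * n + 10) (fun s' =>
    blocks J.+1 (sc s' vM) (ar s' aOff) (slot s') /\
    ((1 < sc s vM)%N -> (sc s' vM < sc s vM)%N)).
Proof.
move=> hc hbl; have := hc => -[[c0 c1 c2 c3] [c4 c5]].
set m := sc s vM in hbl *; set off := ar s aOff in hbl *.
have mono := blocks_mono hbl.
have [m0 hidx off0 offm hsz hst] := hbl.
(* Old and new boundaries share one array. While [b < m], [b = 2 * d] old blocks have become [d] new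
   ones, and the entry [d.+1] written next is smaller than [b.+2], where reading resumes. *)
pose I k s' := let b := sc s' vBlk in let d := sc s' vNew in
  [/\ (b <= 2 * d <= b.+1)%N /\ (b <= m)%N, (b < m)%N -> b = (2 * d)%N,
   [/\ sc s' vDst = ar s' aOff d, ar s' aOff 0%N = n, (ar s' aOff d <= 2 * n)%N &
    forall d', (d' <= d)%N -> (ar s' aOff d' <= ar s' aOff d)%N],
   forall d', (d' < d)%N ->
     (ar s' aOff d' <= ar s' aOff d'.+1 <= ar s' aOff d' + 2 ^ J.+1)%N /\
     stair_of S (slot s') (ar s' aOff d') (ar s' aOff d'.+1)
       (minn (d' * 2 ^ J.+1) n) (minn (d'.+1 * 2 ^ J.+1) n) &
   [/\ (b < m)%N -> (ar s' aOff d <= off b)%N /\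
        forall b', (b <= b')%N -> ar s' aOff b' = off b',
     forall p, (off b <= p < 2 * n)%N -> slot s' p = slot s p &
     (40 * (off m - off b) + 31 * (m - b) < k)%N]].
have hoffm : (off m - off 0 <= n)%N by rewrite off0; clear -offm; lia.
apply: tri_block_seq => //=; first by rewrite c0 c3; clear -hlim; do !split; lia.
  by clear; lia.
set s0 := set_sc _ _ _.
have e0 : slot s0 = slot s by [].
apply: (@tri_seq _ _ _ _ _ (71 * n + 1) 1 _ (fun s' => I 1%N s' /\ sc s' vBlk = m)).
- apply: (@tri_while _ _ I).
  + move=> k s1 [[hb hbm] hb2 [hdst hz hd2n hmon] hnew [hold hsl hk]] hf.
    have /= hc1 := consts_frame hf isT (hc : consts s0).
    have := hc1 => -[[d0 d1 d2 d3] [d4 d5]].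
    have hm1 : sc s1 vM = m by case: hf => ->.
    rewrite /= hm1 => bm.
    have {hb2}hb2 := hb2 bm; have [ao hold'] := hold bm.
    set b := sc s1 vBlk in hb hbm hb2 hold hsl hk bm ao hold' *.
    set d := sc s1 vNew in hb hb2 hdst hd2n hmon hnew ao *.
    pose o2 := (if b.+1 < m then off b.+2 else off b.+1)%N.
    have o12 : (off b.+1 <= o2)%N.
      by rewrite /o2; case: ifP => // h; case/andP: (hsz _ h).
    have o01 : (off b <= off b.+1)%N by case/andP: (hsz _ bm).
    have o2m : (o2 <= off m)%N.
      by rewrite /o2; case: ifP => // h; apply: mono.
    have osz : (o2 - off b <= 2 ^ J.+1)%N.
      have := hsz _ bm; rewrite /o2; case: ifP => [/hsz|_]; rewrite expnS; clear; lia.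
    have no : (n <= off b)%N by rewrite -off0; exact: mono.
    pose a0 := minn (b * 2 ^ J) n; pose a1 := minn (b.+1 * 2 ^ J) n.
    pose a2 := minn (d.+1 * 2 ^ J.+1) n.
    have ea0 : a0 = minn (d * 2 ^ J.+1) n by rewrite /a0 hb2 expnS; congr minn; clear; nia.
    have ext lo hi u v : (off b <= lo)%N -> (hi <= off m)%N ->
        stair_of S (slot s) lo hi u v -> stair_of S (slot s1) lo hi u v.
      move=> h1 h2 h; apply: stair_of_ext h _ => p hp; apply: hsl.
      by clear -h1 h2 hp offm; lia.
    have ha : (a0 <= a1 <= a2)%N.
      have := expn_gt0 2 J; rewrite /a0 /a1 /a2 hb2 expnS; clear; nia.
    have a2E : (b.+1 < m)%N = false -> a1 = n.
      move=> h; have e : b.+1 = m by clear -h bm; lia.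
      by rewrite /a1 e; apply/minn_idPr; case/andP: hidx.
    exists (40 * (o2 - off b) + 30)%N.
    have st2 : stair_of S (slot s1) (off b.+1) o2 a1 a2.
      rewrite /o2; case: ifP => hb1.
        have -> : a2 = minn (b.+2 * 2 ^ J) n.
          by rewrite /a2 hb2 expnS; congr minn; clear; nia.
        by apply: ext (hst _ hb1); [case/andP: (hsz _ bm)|exact: mono].
      have -> : a2 = n by rewrite /a2; have := a2E hb1; rewrite /a1; clear -ha hb1; rewrite /a2; lia.
      rewrite a2E //; split=> [u v h1 h2 h3|u h|i h]; exfalso; lia.
    pose b2 := (if b.+1 < m then b.+2 else b.+1)%N.
    have [eb2 eo2 bb2] : [/\ (b.+1 <= b2 <= m)%N, off b2 = o2 & (b2 < m)%N -> b2 = b.+2].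
      by rewrite /b2 /o2; case: ifP => h; split=> //; clear -bm h; lia.
    have eb3 : (b2 <= b.+2)%N by rewrite /b2; case: ifP.
    apply: tri_weak (@merge_pair_spec s1 m b d (ar s1 aOff d) (off b) (off b.+1) o2
      a0 a1 a2 hc1 hm1 erefl erefl hdst (hold' _ (leqnn _)) (hold' _ (leqnSn _))
      _ _ bm _ ao no o01 o12 (leq_trans o2m offm) _ st2 ha _) (leqnn _) _.
    * by rewrite !hold' //; clear; lia.
    * by clear -hb2; lia.
    * by case/andP: m0.
    * by apply: ext (hst _ bm) => //; exact: mono.
    * by rewrite /a2; exact: geq_minr.
    move=> s2 [a' [ha' hst' hsl2 [h1 h2 h3 h4]]].
    exists (40 * (off m - o2) + 31 * (m - b2) + 1)%N; split.
      by clear -hk eb2 o01 o12 o2m; lia.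
    have ud : upd (ar s1 aOff) d.+1 a' d.+1 = a' by rewrite /upd eqxx.
    rewrite /I h1 h2 h3 h4 -/b2 eo2 ud.
    have upd_ne i : i != d.+1 -> upd (ar s1 aOff) d.+1 a' i = ar s1 aOff i.
      by rewrite /upd => /negbTE->.
    have ha2 : (a' <= o2)%N by clear -ha' ao o01 o12; lia.
    split.
    * by clear -eb2 eb3 hb2; lia.
    * by move=> /bb2->; rewrite hb2; clear; lia.
    * split=> //.
        by clear -ha2 o2m offm; lia.
      move=> d'; rewrite leq_eqVlt => /orP[/eqP->|hd']; first by rewrite ud.
      rewrite upd_ne; last by clear -hd'; lia.
      by apply: leq_trans (hmon d' _) _; [clear -hd'; lia|case/andP: ha'].
    * move=> d'; rewrite ltnS leq_eqVlt => /orP[/eqP->|hd'].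
        rewrite upd_ne; last by clear; lia.
        rewrite ud -ea0; split=> //.
        by clear -ha' osz; lia.
      rewrite !upd_ne; [|clear -hd'; lia|clear -hd'; lia].
      have [hs1 hs2] := hnew _ hd'; split=> //.
      apply: stair_of_ext hs2 _ => p hp; have := hmon d'.+1 hd' => hm'.
      by apply: hsl2; clear -hp hm' hd2n; lia.
    * split.
      - move=> h; split=> // b' hb'; rewrite upd_ne; first by apply: hold'; clear -hb' eb2; lia.
        by have := bb2 h; clear -hb' hb2; lia.
      - move=> p hp; rewrite hsl2; [|clear -hp; lia|clear -hp; lia].
        by apply: hsl; clear -hp o01 o12; lia.
      - by clear; lia.
  + move=> k s1 [[hb hbm] hb2 hdst hnew [hold hsl hk]] hf.
    have hm1 : sc s1 vM = m by case: hf => ->.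
    rewrite /= hm1 -leqNgt => bm.
    have e : sc s1 vBlk = m by clear -bm hbm; lia.
    split; first by clear -hk; lia.
    by split=> //; split=> //; split=> //; rewrite e !subnn.
  + rewrite /I /=; split=> //; try by clear; lia.
    * split; rewrite -/off ?off0 ?c0 ?c3 ?addn0 //; first by clear; lia.
      by move=> d'; rewrite leqn0 => /eqP->; rewrite off0.
    * split=> //.
      by clear -hoffm m0; rewrite !subn0; lia.
- move=> s1 [[[hb hbm] hb2 [hdst hz hd2n hmon] hnew _] eb] hf.
  have c3' : sc s1 vZero = 0%N by case: hf => ->.
  apply: tri_block => //=; rewrite ?c3'; first by clear -hb hbm eb m0 hlim; do !split; lia.
  rewrite addn0 in hb *; move: hb hbm hb2 hdst hz hd2n hmon hnew; rewrite eb.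
  set d := sc s1 vNew => hb hbm hb2 hdst hz hd2n hmon hnew.
  split; last by clear -hb m0 => h; lia.
  split=> //.
  + by clear -hb m0; lia.
  + by move: hidx; rewrite expnS; clear -hb m0; nia.
  + by move=> b /hnew[].
  + by move=> b /hnew[].
- by clear -hlim; lia.
Qed.

End MergePass.

(** * Splitting a node *)

Section Nodes.
Variables (R : realType) (X : nat -> R * R) (front : pred nat).
Implicit Types (es : seq (nat * nat)) (e : nat * nat) (z : R).

Definition slots_of es : seq nat := flatten [seq iota e.1 (e.2 - e.1) | e <- es].

Definition cut (P : pred nat) (lo hi : nat) : nat := (lo + find P (iota lo (hi - lo)))%N.

Lemma cutP (P : pred nat) lo hi l : (lo <= l <= hi)%N ->
  (forall a, (lo <= a < l)%N -> ~~ P a) -> ((l < hi)%N -> P l) -> cut P lo hi = l.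
Proof.
move=> hl hP hPl; rewrite /cut.
have -> : iota lo (hi - lo) = iota lo (l - lo) ++ iota l (hi - l).
  have -> : (hi - lo = (l - lo) + (hi - l))%N by lia.
  by rewrite iotaD; congr (_ ++ iota _ _); lia.
rewrite find_cat; case: hasP => [[a]|_].
  by rewrite mem_iota => ha; rewrite (negbTE (hP a _)); lia.
rewrite size_iota; case: (ltnP l hi) => h.
  have -> : (hi - l = (hi - l).-1.+1)%N by lia.
  by rewrite /= hPl; lia.
by have -> : (hi - l = 0)%N by [lia]; rewrite /=; lia.
Qed.

Lemma cut_le P lo hi : (lo <= hi)%N -> (lo <= cut P lo hi <= hi)%N.
Proof.
move=> h; rewrite /cut leq_addr /=.
by have := find_size P (iota lo (hi - lo)); rewrite size_iota; lia.
Qed.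

(** A monotone predicate splits an interval into two intervals. Thus a part of a node is both a pair
    of addresses for the program and a filtered set of points for the proof. *)
Lemma filter_iota_lt (P : pred nat) lo hi : (lo <= hi)%N ->
  (forall a b, (lo <= a)%N -> (a < b)%N -> (b < hi)%N -> P a -> P b) ->
  [seq a <- iota lo (hi - lo) | ~~ P a] = iota lo (cut P lo hi - lo) /\
  [seq a <- iota lo (hi - lo) | P a] = iota (cut P lo hi) (hi - cut P lo hi).
Proof.
move=> lohi mono; have := cut_le P lohi; set l := cut _ _ _ => hl.
have h1 a : (lo <= a < l)%N -> ~~ P a.
  move=> ha; have := @before_find _ 0%N P (iota lo (hi - lo)) (a - lo).
  rewrite nth_iota; last by lia.
  have -> : (lo + (a - lo) = a)%N by lia.
  by move=> ->; [|rewrite /l /cut in ha *; lia].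
have h2 a : (l <= a < hi)%N -> P a.
  move=> ha; have hPl : P l.
    have := @nth_find _ 0%N P (iota lo (hi - lo)).
    rewrite has_find size_iota nth_iota; last by rewrite /l /cut in ha *; lia.
    by apply; rewrite /l /cut in ha; lia.
  have [->//|ne] := eqVneq a l.
  by apply: (mono l a) => //; lia.
have -> : iota lo (hi - lo) = iota lo (l - lo) ++ iota l (hi - l).
  have -> : (hi - lo = (l - lo) + (hi - l))%N by lia.
  by rewrite iotaD; congr (_ ++ iota _ _); lia.
have f1 : {in iota lo (l - lo), forall a, P a = false}.
  by move=> a; rewrite mem_iota => ha; apply/negbTE/h1; lia.
have f2 : {in iota l (hi - l), forall a, P a}.
  by move=> a; rewrite mem_iota => ha; apply: h2; lia.
rewrite !filter_cat; split.
  rewrite [X in _ ++ X](eq_in_filter (a2 := pred0)) ?filter_pred0 ?cats0; last first.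
    by move=> a /f2 ->.
  by apply/all_filterP/allP => a /f1 ->.
rewrite [X in X ++ _](eq_in_filter (a2 := pred0)) ?filter_pred0 //.
by apply/all_filterP/allP => a /f2.
Qed.

Lemma slots_of_cat es1 es2 : slots_of (es1 ++ es2) = slots_of es1 ++ slots_of es2.
Proof. by rewrite /slots_of map_cat flatten_cat. Qed.

Lemma slots_ofP es a : reflect
  (exists i, (i < size es)%N /\
     ((nth (0, 0) es i).1 <= a < (nth (0, 0) es i).2)%N) (a \in slots_of es).
Proof.
apply: (iffP flattenP) => [[_ /mapP[e he ->]]|[i [hi ha]]].
  rewrite mem_iota => ha; exists (index e es); rewrite index_mem nth_index //.
  by split=> //; lia.
exists (iota (nth (0, 0) es i).1 ((nth (0, 0) es i).2 - (nth (0, 0) es i).1))%N.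
  by apply/mapP; exists (nth (0, 0)%N es i) => //; exact: mem_nth.
by rewrite mem_iota; lia.
Qed.

(** Empty intervals are dropped so that a node has at least as many slots as entries, which keeps
    the logarithm in the potential nonnegative. *)
Definition nonempty e : bool := (e.1 < e.2)%N.

Definition right_part z (c : nat) es : seq (nat * nat) :=
  [seq e <- [seq (e.1, cut (fun a => (X a).1 <= z) e.1 e.2) | e <- drop c es] |
    nonempty e].

Definition left_part z (c : nat) es : seq (nat * nat) :=
  [seq e <- [seq (cut (fun a => z < (X a).2) e.1 e.2, e.2) | e <- take c.+1 es] |
    nonempty e].

Lemma slots_of_filter es : slots_of [seq e <- es | nonempty e] = slots_of es.
Proof.
rewrite /slots_of; elim: es => //= e es IH; case: ifP => /= [_|]; first by rewrite IH.
rewrite /nonempty => h; have -> : (e.2 - e.1 = 0)%N by lia.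
by rewrite IH.
Qed.

Lemma slots_of_right z c es :
  (forall e, e \in es -> nonempty e /\ stair X e.1 e.2) ->
  slots_of (right_part z c es) = [seq a <- slots_of (drop c es) | z < (X a).1].
Proof.
move=> h; rewrite /right_part slots_of_filter /slots_of.
have {h} : forall e, e \in drop c es -> nonempty e /\ stair X e.1 e.2.
  by move=> e /mem_drop; exact: h.
elim: (drop c es) => //= e l IH h; rewrite filter_cat IH; last first.
  by move=> e' he'; apply: h; rewrite inE he' orbT.
have [he st] := h e (mem_head _ _); congr (_ ++ _).
have [|a b ha hab hb hx|<- _] := @filter_iota_lt (fun a => (X a).1 <= z) e.1 e.2.
- exact: ltnW.
- by apply: le_trans hx; apply: ltW; apply: (st a b _ _ _).1.
- by apply: eq_filter => a; rewrite ltNge.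
Qed.

Lemma slots_of_left z c es :
  (forall e, e \in es -> nonempty e /\ stair X e.1 e.2) ->
  slots_of (left_part z c es) = [seq a <- slots_of (take c.+1 es) | z < (X a).2].
Proof.
move=> h; rewrite /left_part slots_of_filter /slots_of.
have {h} : forall e, e \in take c.+1 es -> nonempty e /\ stair X e.1 e.2.
  by move=> e /mem_take; exact: h.
elim: (take c.+1 es) => //= e l IH h; rewrite filter_cat IH; last first.
  by move=> e' he'; apply: h; rewrite inE he' orbT.
have [he st] := h e (mem_head _ _); congr (_ ++ _).
have [|a b ha hab hb hx|_ <-//] := @filter_iota_lt (fun a => z < (X a).2) e.1 e.2.
- exact: ltnW.
- by apply: lt_trans hx _; apply: (st a b _ _ _).2.
Qed.

(* Front slots of different intervals are ordered by the promise. *)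
Definition ordered es : bool := pairwise (fun e e' : nat * nat =>
  `[< forall a b, (e.1 <= a < e.2)%N -> (e'.1 <= b < e'.2)%N ->
      front a -> front b -> (X a).1 < (X b).1 >]) es.

Lemma ordered_map_filter (g : nat * nat -> nat * nat) es : ordered es ->
  (forall e a, e \in es -> ((g e).1 <= a < (g e).2)%N -> (e.1 <= a < e.2)%N) ->
  ordered [seq e <- map g es | nonempty e].
Proof.
move=> h hg; apply: (subseq_pairwise (filter_subseq _ _)).
rewrite pairwise_map; apply: (sub_in_pairwise (P := mem es)) h; last exact/allP.
move=> e e' he he' /asboolP h; apply/asboolP => a b ha hb.
by apply: h; apply: hg.
Qed.

(* A node is a list of slot intervals, one for each block that may still
   contribute to the part of the front the node is responsible for. *)
Record node es : Prop := Node {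
  node_stair : forall e, e \in es -> nonempty e /\ stair X e.1 e.2;
  node_distinct : forall a b, a \in slots_of es -> b \in slots_of es -> a != b ->
    (X a).1 != (X b).1 /\ (X a).2 != (X b).2;
  node_uniq : uniq (slots_of es);
  node_front : forall a b, a \in slots_of es -> b \in slots_of es -> front a ->
    ~ ((X a).1 < (X b).1 /\ (X a).2 < (X b).2);
  node_closed : forall a, a \in slots_of es -> ~~ front a ->
    exists b, [/\ b \in slots_of es, front b, (X a).1 < (X b).1 & (X a).2 < (X b).2];
  node_ordered : ordered es }.

(** By [node_closed] a point off the front would be dominated by another point of the same
    staircase, whose points are incomparable. Hence such a node can be output as it is. *)
Lemma node_single lo hi : node [:: (lo, hi)] -> forall a, (lo <= a < hi)%N -> front a.
Proof.
move=> h a ha; have eS : slots_of [:: (lo, hi)] = iota lo (hi - lo).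
  by rewrite /slots_of /= cats0.
have mem b : (b \in slots_of [:: (lo, hi)]) = (lo <= b < hi)%N.
  by rewrite eS mem_iota; lia.
apply/negP => /negP /(node_closed h)[|b [hb _ h1 h2]]; first by rewrite mem.
have [_ /= st] := node_stair h (mem_head _ _); rewrite mem in hb.
have [ab|ba|e] := ltngtP a b.
- by have [||h3 _] := st a b _ ab; [lia|lia|]; have := lt_trans h1 h3; rewrite ltxx.
- by have [||_ h3] := st b a _ ba; [lia|lia|]; have := lt_trans h2 h3; rewrite ltxx.
- by rewrite e ltxx in h1.
Qed.

(** * The three parts of a node *)

Section Split.
Variables (es : seq (nat * nat)) (f p c : nat).
Hypothesis es_node : node es.
Hypothesis c_lt : (c < size es)%N.
Hypothesis f_in : ((nth (0, 0) es c).1 <= f < (nth (0, 0) es c).2)%N.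
Hypothesis f_right : (X p).1 <= (X f).1.
Hypothesis f_max : forall a, a \in slots_of es -> (X p).1 <= (X a).1 ->
  (X a).2 <= (X f).2.

Let left := left_part (X f).2 c es.
Let right := right_part (X f).1 c es.

Lemma split_mem : f \in slots_of es.
Proof. by apply/slots_ofP; exists c. Qed.

(** Otherwise [node_closed] provides a point of the node that is higher than [f] and to its right,
    hence also to the right of the pivot, against the choice of [f]. *)
Lemma split_front : front f.
Proof.
apply/negP => /negP /(node_closed es_node split_mem)[b [hb _ h1 h2]].
have := f_max hb (le_trans f_right (ltW h1)).
by move=> /(lt_le_trans h2); rewrite ltxx.
Qed.

Let left_slots : slots_of left = [seq a <- slots_of (take c.+1 es) | (X f).2 < (X a).2].
Proof. by apply: slots_of_left; exact: node_stair. Qed.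

Let right_slots : slots_of right = [seq a <- slots_of (drop c es) | (X f).1 < (X a).1].
Proof. by apply: slots_of_right; exact: node_stair. Qed.

Lemma split_left_sub a : a \in slots_of left ->
  a \in slots_of es /\ (X f).2 < (X a).2.
Proof.
rewrite left_slots mem_filter => /andP[-> h]; split=> //.
by rewrite -(cat_take_drop c.+1 es) slots_of_cat mem_cat h.
Qed.

Lemma split_right_sub a : a \in slots_of right ->
  a \in slots_of es /\ (X f).1 < (X a).1.
Proof.
rewrite right_slots mem_filter => /andP[-> h]; split=> //.
by rewrite -(cat_take_drop c es) slots_of_cat mem_cat h orbT.
Qed.

(** The left part is cut by height alone, yet it lies to the left of the pivot: no point from the
    pivot on is higher than [f]. *)
Lemma split_lt a : a \in slots_of left -> (X a).1 < (X p).1.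
Proof.
move=> /split_left_sub[ha h]; rewrite ltNge; apply/negP => /(f_max ha).
by move=> /(lt_le_trans h); rewrite ltxx.
Qed.

Lemma split_entry a b i j : (i < j)%N -> (j < size es)%N ->
  ((nth (0, 0) es i).1 <= a < (nth (0, 0) es i).2)%N ->
  ((nth (0, 0) es j).1 <= b < (nth (0, 0) es j).2)%N ->
  front a -> front b -> (X a).1 < (X b).1.
Proof.
move=> ij js ha hb; have /pairwiseP := node_ordered es_node.
move=> /(_ (0, 0)%N i j); rewrite !inE => /(_ (ltn_trans ij js) js ij) /asboolP h.
exact: h.
Qed.

(** A front point higher than [f] cannot lie in a block after [c]: it would also be to the right of
    [f] and dominate it. *)
Lemma split_left_mem g : g \in slots_of es -> front g -> (X f).2 < (X g).2 ->
  g \in slots_of left.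
Proof.
move=> hg fg h; rewrite left_slots mem_filter h /=.
have /slots_ofP[i [hi hgi]] := hg.
apply/slots_ofP; exists i; have [ic|ci] := leqP i c.
  by rewrite size_take_min nth_take // leq_min ltnS ic.
have := split_entry ci hi f_in hgi split_front fg => hx.
by case: (node_front es_node split_mem hg split_front).
Qed.

(** Front points of the blocks before [c] lie to the left of [f], so [drop c] loses none of those to
    its right. *)
Lemma split_right_mem g : g \in slots_of es -> front g -> (X f).1 < (X g).1 ->
  g \in slots_of right.
Proof.
move=> hg fg h; rewrite right_slots mem_filter h /=.
have /slots_ofP[i [hi hgi]] := hg.
have [ci|ic] := leqP c i; last first.
  have := split_entry ic c_lt hgi f_in fg split_front => hx.
  by have := lt_trans h hx; rewrite ltxx.
apply/slots_ofP; exists (i - c)%N; rewrite size_drop nth_drop subnKC //.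
by split=> //; exact: ltn_sub2r.
Qed.

Lemma split_cover g : g \in slots_of es -> front g ->
  [\/ g = f, g \in slots_of left | g \in slots_of right].
Proof.
move=> hg fg; have [->|ne] := eqVneq g f; first by constructor 1.
have [ne1 ne2] := node_distinct es_node hg split_mem ne.
have [h|h] := ltP (X f).2 (X g).2.
  by constructor 2; exact: split_left_mem.
constructor 3; apply: split_right_mem => //; rewrite ltNge; apply/negP => h'.
by apply: (node_front es_node hg split_mem fg); rewrite !lt_neqAle ne1 ne2.
Qed.

Lemma left_entry e : e \in left -> exists2 e', e' \in es &
  [/\ (e'.1 <= e.1)%N, (e.1 < e.2)%N & e.2 = e'.2].
Proof.
rewrite mem_filter => /andP[hne /mapP[e' /mem_take he' he]].
exists e' => //; rewrite he in hne *; split=> //=.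
by have /andP[] := cut_le (fun a => (X f).2 < (X a).2) (ltnW (node_stair es_node he').1).
Qed.

Lemma right_entry e : e \in right -> exists2 e', e' \in es &
  [/\ e.1 = e'.1, (e.1 < e.2)%N & (e.2 <= e'.2)%N].
Proof.
rewrite mem_filter => /andP[hne /mapP[e' /mem_drop he' he]].
exists e' => //; rewrite he in hne *; split=> //=.
by have /andP[] := cut_le (fun a => (X a).1 <= (X f).1) (ltnW (node_stair es_node he').1).
Qed.

(** For [node_closed], the front point that dominates a remaining point is higher still, so it
    passes the same cut. The right part is symmetric, with x-coordinates in place of heights. *)
Lemma split_left_node : node left.
Proof.
split.
- move=> e he; have [e' he' [h1 h2 h3]] := left_entry he.
  split=> // a b ha hab hb; have [_ st] := node_stair es_node he'.
  by apply: st => //; [exact: leq_trans ha|rewrite -h3].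
- by move=> a b /split_left_sub[ha _] /split_left_sub[hb _]; exact: (node_distinct es_node ha hb).
- rewrite left_slots filter_uniq //; have := node_uniq es_node.
  by rewrite -{1}(cat_take_drop c.+1 es) slots_of_cat cat_uniq => /andP[].
- by move=> a b /split_left_sub[ha _] /split_left_sub[hb _]; exact: (node_front es_node ha hb).
- move=> a /split_left_sub[ha hay] /(node_closed es_node ha)[b [hb fb h1 h2]].
  by exists b; split=> //; apply: split_left_mem => //; exact: lt_trans h2.
- apply: ordered_map_filter => [|e a he /=].
    by apply: (subseq_pairwise (take_subseq _ _)); exact: node_ordered.
  have := cut_le (fun a => (X f).2 < (X a).2) (ltnW (node_stair es_node (mem_take he)).1).
  by lia.
Qed.

Lemma split_right_node : node right.
Proof.
split.
- move=> e he; have [e' he' [h1 h2 h3]] := right_entry he.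
  split=> // a b ha hab hb; have [_ st] := node_stair es_node he'.
  by apply: st => //; [rewrite -h1|exact: leq_trans h3].
- by move=> a b /split_right_sub[ha _] /split_right_sub[hb _]; exact: (node_distinct es_node ha hb).
- rewrite right_slots filter_uniq //; have := node_uniq es_node.
  by rewrite -{1}(cat_take_drop c es) slots_of_cat cat_uniq => /and3P[].
- by move=> a b /split_right_sub[ha _] /split_right_sub[hb _]; exact: (node_front es_node ha hb).
- move=> a /split_right_sub[ha hay] /(node_closed es_node ha)[b [hb fb h1 h2]].
  by exists b; split=> //; apply: split_right_mem => //; exact: lt_trans h1.
- apply: ordered_map_filter => [|e a he /=].
    by apply: (subseq_pairwise (drop_subseq _ _)); exact: node_ordered.
  have := cut_le (fun a => (X a).1 <= (X f).1) (ltnW (node_stair es_node (mem_drop he)).1).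
  by lia.
Qed.

Lemma split_mid_node : node [:: (f, f.+1)].
Proof.
have eS a : (a \in slots_of [:: (f, f.+1)]) = (a == f).
  by rewrite /slots_of /= subSnn inE.
split.
- move=> e; rewrite inE => /eqP->; split=> [|a b ha hab hb]; first exact: leqnn.
  by exfalso; move: ha hab hb => /=; clear; lia.
- by move=> a b; rewrite !eS => /eqP-> /eqP->; rewrite eqxx.
- by rewrite /slots_of /= subSnn.
- by move=> a b; rewrite !eS => /eqP-> /eqP-> _ []; rewrite ltxx.
- by move=> a; rewrite eS => /eqP->; rewrite split_front.
- by [].
Qed.

Lemma split_sizes : (size left <= c.+1)%N /\ (size right <= size es - c)%N.
Proof.
rewrite !size_filter; split; apply: leq_trans (count_size _ _) _; rewrite size_map.
  by rewrite size_take_min geq_minl.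
by rewrite size_drop.
Qed.

(** Only the entry [c] can occur on both sides; the bounds [c + 1] and [k - c], each lowered by one,
    sum to [k - 1]. *)
Lemma split_weight : ((size left).-1 + (size right).-1 <= (size es).-1)%N.
Proof. by have [] := split_sizes; clear -c_lt; lia. Qed.

Lemma split_left_count :
  (size (slots_of left) <= count (fun a => ((X a).1 < (X p).1)%R) (slots_of es))%N.
Proof.
rewrite left_slots size_filter -{2}(cat_take_drop c.+1 es) slots_of_cat count_cat.
apply: leq_trans (leq_addr _ _).
rewrite -!size_filter; apply: uniq_leq_size.
  by rewrite -left_slots; exact: node_uniq split_left_node.
move=> a ha; rewrite mem_filter split_lt ?left_slots //=.
by move: ha; rewrite mem_filter => /andP[].
Qed.

Lemma split_right_count :
  (size (slots_of right) <= count (fun a => ((X p).1 < (X a).1)%R) (slots_of es))%N.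
Proof.
rewrite right_slots size_filter -{2}(cat_take_drop c es) slots_of_cat count_cat.
apply: leq_trans (leq_addl _ _); apply: sub_count => a /=.
exact: le_lt_trans f_right.
Qed.

(** The two parts are separated by the pivot, and the strict inequality comes from [f], which
    belongs to neither of them. *)
Lemma split_front_count :
  (count front (slots_of left) + count front (slots_of right) <
   count front (slots_of es))%N.
Proof.
rewrite -!size_filter -size_cat.
apply: (@uniq_leq_size _ (f :: _ ++ _)).
  rewrite cons_uniq cat_uniq !filter_uniq ?(node_uniq split_left_node) //;
    last exact: node_uniq split_right_node.
  rewrite andbT; apply/and3P; split=> //.
    rewrite mem_cat !mem_filter split_front /=; apply/negP.
    by case/orP=> [/split_left_sub|/split_right_sub] []; rewrite ltxx.
  apply/hasPn => a; rewrite mem_filter => /andP[fa /split_right_sub[_ h]].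
  rewrite mem_filter fa /=; apply/negP => /split_lt h'.
  by have := lt_trans h' (le_lt_trans f_right h); rewrite ltxx.
move=> a; rewrite inE mem_cat !mem_filter => /or3P[/eqP->|/andP[-> h]|/andP[-> h]] /=.
- by rewrite split_front split_mem.
- by have [] := split_left_sub h.
- by have [] := split_right_sub h.
Qed.

End Split.

End Nodes.

(** * The potential of a node and the quality of pivots *)

Section Potential.
Variable R : realType.

(* Potential of a node with k + 1 entries, N slots and h front points; it is 0
   at k = 0. *)
Definition potential (k N h : nat) : R :=
  k%:R * (2 + ln (h%:R * N%:R / k%:R)).

Lemma ln_le_sub1 (z : R) : 0 < z -> ln z <= z - 1.
Proof.
move=> z0; have -> : z = 1 + (z - 1) by ring.
by rewrite [X in _ <= X](_ : _ = z - 1); [apply: le_ln1Dx; lra|ring].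
Qed.

Lemma potential_le0 (k N h : nat) : (k <= N)%N -> ((0 < k)%N -> (0 < h)%N) ->
  0 <= ln (h%:R * N%:R / k%:R : R).
Proof.
case: k => [|k] hk h0; first by rewrite invr0 mulr0 ln0.
apply: ln_ge0; rewrite ler_pdivlMr ?ltr0n // mul1r -natrM ler_nat.
by have := h0 isT; nia.
Qed.

Lemma potential_ge0 (k N h : nat) : (k <= N)%N -> ((0 < k)%N -> (0 < h)%N) ->
  0 <= potential k N h.
Proof.
by move=> hk h0; apply: mulr_ge0 => //; have := potential_le0 hk h0; lra.
Qed.

(* Since ln z <= z - 1, sum_j k_j ln (a_j / k_j) is largest when the a_j are
   proportional to the k_j; here a_j = h_j N_j, and a_1 + a_2 <= h max N_j. *)
Lemma potential_split (k k1 k2 N N1 N2 h h1 h2 : nat) (r : R) :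
  (0 < k <= N)%N -> (0 < h)%N -> (k1 + k2 <= k)%N -> (h1 + h2 <= h)%N ->
  (k1 <= N1)%N -> (k2 <= N2)%N ->
  ((0 < k1)%N -> (0 < h1)%N) -> ((0 < k2)%N -> (0 < h2)%N) ->
  1 <= r -> ln r <= 1 -> r * N1%:R <= N%:R -> r * N2%:R <= N%:R ->
  potential k1 N1 h1 + potential k2 N2 h2 <= potential k N h - k%:R * ln r.
Proof.
move=> /andP[k0 kN] h0 kk hh kN1 kN2 hp1 hp2 r1 lr rN1 rN2.
pose a := h%:R * N%:R : R; pose L := ln (a / k%:R) : R.
have k0' : 0 < k%:R :> R by rewrite ltr0n.
have a0 : 0 < a by rewrite mulr_gt0 ?ltr0n //; lia.
have L0 : 0 <= L by apply: potential_le0.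
have part (kj Nj hj : nat) : (kj <= Nj)%N -> ((0 < kj)%N -> (0 < hj)%N) ->
    kj%:R * ln (hj%:R * Nj%:R / kj%:R) <=
    kj%:R * (L - ln r) + r * k%:R * (hj%:R * Nj%:R) / a - kj%:R :> R.
  move=> hkN hkh; have [->|kj0] := posnP kj.
    by rewrite !mul0r subr0 add0r !mulr_ge0 // ?invr_ge0; lra.
  have {}hkh := hkh kj0.
  pose b := hj%:R * Nj%:R : R; rewrite -/b.
  have b0 : 0 < b by rewrite mulr_gt0 ?ltr0n //; lia.
  have kj0' : 0 < kj%:R :> R by rewrite ltr0n.
  have r0 : 0 < r by lra.
  (* [z] compares the ratio of the part with that of the whole node, scaled by [r]; [ln z <= z - 1]
     is the tangent at the proportional case [z = 1]. *)
  pose z := r * (b / kj%:R) / (a / k%:R).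
  have b0' : 0 < b / kj%:R by exact: divr_gt0.
  have a0' : 0 < a / k%:R by exact: divr_gt0.
  have rb : 0 < r * (b / kj%:R) by exact: mulr_gt0.
  have z0 : 0 < z by exact: divr_gt0.
  have lz : ln z = ln r + ln (b / kj%:R) - L.
    by rewrite /z ln_div ?posrE // lnM ?posrE.
  have := ln_le_sub1 z0; rewrite lz => hz.
  have : kj%:R * (ln r + ln (b / kj%:R) - L) <= kj%:R * (z - 1).
    by rewrite ler_pM2l.
  have -> : kj%:R * (z - 1) = r * k%:R * b / a - kj%:R.
    by rewrite /z; field; rewrite !gt_eqF.
  lra.
have p1 := part _ _ _ kN1 hp1; have p2 := part _ _ _ kN2 hp2.
(* The factors [r] are absorbed by replacing both [N1] and [N2] by [N]; what remains is
   [h1 + h2 <= h]. *)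
have hsum : r * k%:R * (h1%:R * N1%:R) / a + r * k%:R * (h2%:R * N2%:R) / a <= k%:R.
  rewrite -mulrDl ler_pdivrMr // -mulrDr -[X in X <= _]mulrA mulrCA ler_pM2l //.
  have e1 : r * (h1%:R * N1%:R) <= h1%:R * N%:R by rewrite mulrCA ler_wpM2l.
  have e2 : r * (h2%:R * N2%:R) <= h2%:R * N%:R by rewrite mulrCA ler_wpM2l.
  have e3 : h1%:R * N%:R + h2%:R * N%:R <= a.
    by rewrite /a -mulrDl -natrD ler_wpM2r // ler_nat.
  by rewrite mulrDr; lra.
have hk' : k1%:R + k2%:R <= k%:R :> R by rewrite -natrD ler_nat.
rewrite /potential -/a -/L.
(* This explains the constant 2 of the potential: one unit is used up by the term [- kj] in [part],
   the other outweighs [ln r], so that the coefficient [1 + L - ln r] is nonnegative. *)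
have q : (k1%:R + k2%:R) * (1 + L - ln r) <= k%:R * (1 + L - ln r).
  by rewrite ler_wpM2r //; lra.
lra.
Qed.

(** Let [b] minimise [g] among the elements counted. More than three quarters of the list have a
    smaller value than [b], and none of these is counted. Equal values of [g] do no harm. *)
Lemma count_large (g : nat -> R) (U : seq nat) :
  (4 * count (fun p => (3 * size U < 4 * count (fun a => (g a < g p)%R) U)%N) U
    <= size U)%N.
Proof.
set B := fun p => _; have [/hasP[b0 hb0 Bb0]|] := boolP (has B U); last first.
  by rewrite has_count lt0n negbK => /eqP->.
have [b [hb Bb hmin]] : exists b, [/\ b \in U, B b &
    forall a, a \in U -> B a -> g b <= g a].
  move: hb0 Bb0; generalize B; elim: (U) b0 => //= u V IH b0 B' + Bb0.
  have [hV|/hasPn hV] := boolP (has B' V).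
    have [b1 hb1 Bb1] := hasP hV.
    have [b [hb Bb hmin]] := IH b1 B' hb1 Bb1 => _.
    have [Bu|/negbTE nBu] := boolP (B' u); last first.
      exists b; split=> // [|a]; first by rewrite inE hb orbT.
      by rewrite inE => /orP[/eqP->|]; [rewrite nBu|exact: hmin].
    have [ub|bu] := leP (g u) (g b).
      exists u; split=> // [|a]; first exact: mem_head.
      rewrite inE => /orP[/eqP-> //|ha Ba]; exact: le_trans (hmin _ ha Ba).
    exists b; split=> // [|a]; first by rewrite inE hb orbT.
    by rewrite inE => /orP[/eqP-> _|]; [exact: ltW|exact: hmin].
  rewrite inE => /orP[/eqP e|/hV]; last by rewrite Bb0.
  exists u; split=> // [||a]; first exact: mem_head; first by rewrite -e.
  by rewrite inE => /orP[/eqP->//|/hV/negbTE->].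
have : (count B U + count (fun a => (g a < g b)%R) U <= size U)%N.
  rewrite -count_predUI [X in (_ + X)%N](_ : _ = 0%N) ?addn0 ?count_size //.
  apply/eqP; rewrite -leqn0 leqNgt -has_count; apply/hasPn => a ha /=.
  by apply/negP => /andP[Ba]; rewrite ltNge hmin.
by move: Bb; rewrite {1}/B; lia.
Qed.

Definition good_pivot (g : nat -> R) (U : seq nat) (p : nat) : bool :=
  (4 * count (fun a => (g a < g p)%R) U <= 3 * size U)%N &&
  (4 * count (fun a => (g p < g a)%R) U <= 3 * size U)%N.

(** A union bound: [count_large] for [g] and for [- g] excludes at most a quarter of the list
    each. *)
Lemma count_good_pivot (g : nat -> R) (U : seq nat) :
  (size U <= 2 * count (good_pivot g U) U)%N.
Proof.
have h1 := count_large g U; have h2 := count_large (fun a => - g a) U.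
have : (size U <= count (good_pivot g U) U +
    (count (fun p => (3 * size U < 4 * count (fun a => (g a < g p)%R) U)%N) U +
     count (fun p => (3 * size U < 4 * count (fun a => (- g a < - g p)%R) U)%N) U))%N.
  rewrite -[X in (X <= _)%N](count_predC (good_pivot g U)) leq_add2l -count_predUI.
  apply: leq_trans (leq_addr _ _); apply: sub_count => p /=.
  rewrite /good_pivot negb_and -!ltnNge => /orP[h|h]; apply/orP; [by left|right].
  by move: h; congr (_ < 4 * _)%N; apply: eq_count => a /=; rewrite ltrN2.
move: h1 h2 => /=; set a := count _ U; set b := count _ U; set d := count _ U.
by clearbody a b d; lia.
Qed.

End Potential.

(** * Running the search *)

Section Search.
Variables (R : realType) (lim n J : nat).
Hypothesis hlim : (64 * n + 64 <= lim)%N.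
Local Notation tri := (@tri R lim).
Local Notation consts := (@consts R n).

Lemma search_spec c narrow (P : pred nat) s lo hi :
  {subset cmd_mod narrow <= [:: (0, vLo); (0, vHi)]%N} ->
  (forall s1 mid, sc s1 vMid = mid -> (lo <= mid < hi)%N -> consts s1 ->
     rg s1 0%N = rg s 0%N -> rg s1 1%N = rg s 1%N -> rg s1 2%N = pt s c mid ->
     tri narrow s1 2 (fun s2 =>
       if P mid then sc s2 vHi = mid /\ sc s2 vLo = sc s1 vLo
       else sc s2 vLo = mid.+1 /\ sc s2 vHi = sc s1 vHi)) ->
  (forall a b, (lo <= a)%N -> (a < b)%N -> (b < hi)%N -> P a -> P b) ->
  consts s -> sc s vLo = lo -> sc s vHi = hi -> (lo <= hi <= 2 * n)%N ->
  (hi - lo <= 2 ^ J)%N ->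
  tri (search c narrow) s (6 * J + 8) (fun s' => sc s' vLo = cut P lo hi).
Proof.
move=> hmod hstep mono hc elo ehi hlh hJ.
pose I k (s' : state R) := exists j, [/\ (lo <= sc s' vLo <= sc s' vHi)%N /\ (sc s' vHi <= hi)%N,
  forall a, (lo <= a < sc s' vLo)%N -> ~~ P a,
  forall a, (sc s' vHi <= a < hi)%N -> P a,
  (sc s' vHi - sc s' vLo < 2 ^ j)%N & (6 * j < k)%N].
have mods : {subset cmd_mod (Seq (Block (halve ++ [:: PLd 2 c vMid])) narrow) <=
    [:: (0, vMid); (0, vLo); (0, vHi); (2, 2)]%N}.
  move=> x; rewrite /= !inE => /or4P[/eqP->|/eqP->|/eqP->|/hmod]; rewrite ?eqxx ?orbT //.
  by rewrite !inE => /orP[/eqP->|/eqP->].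
apply: (@tri_while _ _ I).
- move=> k s1 [j [[h1 h2] h3 h4 h5 h6]] [fs fa fr fp] /= hb.
  have unmod x : x \notin [:: (0, vMid); (0, vLo); (0, vHi); (2, 2)]%N ->
      x \notin cmd_mod (Seq (Block (halve ++ [:: PLd 2 c vMid])) narrow).
    by apply: contraNN => /mods.
  have hc1 : consts s1.
    have := hc => -[[c0 c1 c2 c3] [c4 c5]].
    by split; split; rewrite fs //; exact: unmod.
  have := hc1 => -[[c0 c1 c2 c3] [c4 c5]].
  exists 5%N.
  apply: tri_block_seq => //=; rewrite ?c2.
    by clear -h1 h2 hlh hlim; do !split; lia.
  set mid := (_ %/ _)%N; set s2 := set_rg _ _ _.
  have hmid : (sc s1 vLo <= mid < sc s1 vHi)%N by rewrite /mid; clear -hb; lia.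
  have hstep2 := hstep s2 mid erefl.
  apply: tri_weak (hstep2 _ _ _ _ _) (leqnn _) _ => //.
  + by clear -hmid h1 h2; lia.
  + by rewrite /s2 /= fr //; exact: unmod.
  + by rewrite /s2 /= fr //; exact: unmod.
  + by rewrite /s2 /= fp //; exact: unmod.
  have j0 : (0 < j)%N by clear -h5 hb; case: j h5 => //; rewrite expn0; lia.
  move=> s3; case: ifPn => hP [e1 e2]; exists (k - 6)%N; (split; first by clear -h6 j0; lia);
    exists j.-1; rewrite e1 e2 /= -/mid.
  + split=> //.
    * by clear -hmid h1 h2; lia.
    * move=> a ha; have [->|ne] := eqVneq a mid; first by [].
      by apply: (mono mid a) => //; clear -ha ne hmid h1; lia.
    * move: h5; rewrite -{1}(prednK j0) expnS /mid; clear; lia.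
    * by clear -j0 h6; lia.
  + split=> //.
    * by clear -hmid h1 h2; lia.
    * move=> a ha; have [->|ne] := eqVneq a mid; first by [].
      apply: contra hP => Pa; apply: (mono a mid) => //; clear -ha ne hmid h1 h2; lia.
    * move: h5; rewrite -{1}(prednK j0) expnS /mid; clear -hb; lia.
    * by clear -j0 h6; lia.
- move=> k s1 [j [[h1 h2] h3 h4 h5 h6]] _ /= hb; split; first by clear -h6; lia.
  have e : sc s1 vLo = sc s1 vHi by clear -hb h1; lia.
  symmetry; apply: cutP => //; first by clear -h1 h2 e; lia.
  by move=> h; apply: h4; rewrite -e h leqnn.
(* The invariant bounds the length strictly by [2 ^ j], whereas a block may have exactly [2 ^ J]
   slots. *)
- exists J.+1; rewrite elo ehi; split=> //.
  + by clear -hlh; lia.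
  + by move=> a; clear; lia.
  + by move=> a; clear; lia.
  + by rewrite expnS; have := expn_gt0 2 J; move: hJ; clear; lia.
  + by clear; lia.
Qed.

Definition entry (s : state R) (e : nat) : nat * nat := (ar s aLo e, ar s aHi e).

Lemma search_right_spec s e : consts s -> sc s vE = e -> (e <= lim)%N ->
  ((entry s e).1 <= (entry s e).2 <= 2 * n)%N ->
  ((entry s e).2 - (entry s e).1 <= 2 ^ J)%N ->
  stair (slot s) (entry s e).1 (entry s e).2 ->
  tri search_right s (6 * J + 11) (fun s' => sc s' vL0 = (entry s e).1 /\
    sc s' vLo = cut (fun a => (slot s a).1 <= rg s 0%N) (entry s e).1 (entry s e).2).
Proof.
rewrite /entry => hc ee elim hlh hJ st; have := hc => -[[c0 c1 c2 c3] [c4 c5]].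
apply: tri_block_seq => //=; rewrite ?ee ?c3; first by
  move: hlh => /=; clear -elim hlim; do !split; lia.
  by clear; lia.
rewrite addn0; set s1 := set_sc _ _ _.
have := @search_spec 0 (If (CRlt 0 2) (Block [:: AOp WAdd vLo vMid vOne])
  (Block [:: mov vHi vMid])) (fun a => (slot s a).1 <= rg s 0%N) s1
  (ar s aLo e) (ar s aHi e).
move=> /(_ _ _ _ hc) h.
have {h} := h _ _ _ erefl erefl hlh hJ.
move=> h; apply: (tri_weak (tri_frame (h _ _ _))).
- by move=> x; rewrite !inE.
- move=> s2 mid em hmid [[d0 d1 d2 d3] _] r0 r1 r2; apply: tri_if => //= hx; apply: tri_block => //=.
  + by rewrite em d1; move: hmid hlh => /=; clear -hlim; do !split; lia.
  + by rewrite em d1 addn1 ifF //; rewrite /slot /= leNgt -r2 r0 /= in hx *; rewrite hx.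
  + by rewrite em d3; move: hmid hlh => /=; clear -hlim; do !split; lia.
  + by rewrite em d3 addn0 ifT //; rewrite /slot /= leNgt -r2 r0 /= in hx *.
- move=> a b ha hab hb; apply: le_trans; apply: ltW; exact: (st a b _ _ _).1.
- by clear; lia.
- by move=> s2 [h1 [fs _ _ _]]; split=> //; rewrite fs.
Qed.

Lemma search_left_spec s e : consts s -> sc s vE = e -> (e <= lim)%N ->
  ((entry s e).1 <= (entry s e).2 <= 2 * n)%N ->
  ((entry s e).2 - (entry s e).1 <= 2 ^ J)%N ->
  stair (slot s) (entry s e).1 (entry s e).2 ->
  tri search_left s (6 * J + 11) (fun s' => sc s' vH0 = (entry s e).2 /\
    sc s' vLo = cut (fun a => rg s 1%N < (slot s a).2) (entry s e).1 (entry s e).2).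
Proof.
rewrite /entry => hc ee elim hlh hJ st; have := hc => -[[c0 c1 c2 c3] [c4 c5]].
apply: tri_block_seq => //=; rewrite ?ee ?c3; first by
  move: hlh => /=; clear -elim hlim; do !split; lia.
  by clear; lia.
rewrite addn0; set s1 := set_sc _ _ _.
have := @search_spec 1 (If (CRlt 1 2) (Block [:: mov vHi vMid])
  (Block [:: AOp WAdd vLo vMid vOne])) (fun a => rg s 1%N < (slot s a).2) s1
  (ar s aLo e) (ar s aHi e).
move=> /(_ _ _ _ hc) h.
have {h} := h _ _ _ erefl erefl hlh hJ.
move=> h; apply: (tri_weak (tri_frame (h _ _ _))).
- by move=> x; rewrite !inE => /orP[]->; rewrite ?orbT.
- move=> s2 mid em hmid [[d0 d1 d2 d3] _] r0 r1 r2; apply: tri_if => //= hx; apply: tri_block => //=.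
  + by rewrite em d3; move: hmid hlh => /=; clear -hlim; do !split; lia.
  + by rewrite em d3 addn0 ifT //; rewrite /slot /= -r2 r1 /= in hx *.
  + by rewrite em d1; move: hmid hlh => /=; clear -hlim; do !split; lia.
  + by rewrite em d1 addn1 ifF //; rewrite /slot /= -r2 r1 /= in hx *; exact/negbTE.
- move=> a b ha hab hb; move=> /lt_trans; apply; exact: (st a b _ _ _).2.
- by clear; lia.
- by move=> s2 [h1 [fs _ _ _]]; split=> //; rewrite fs.
Qed.

End Search.

Section NodeLoops.
Variables (R : realType) (lim n J : nat).
Hypothesis hlim : (64 * n + 64 <= lim)%N.
Local Notation tri := (@tri R lim).
Local Notation consts := (@consts R n).
Local Notation entry := (@entry R).

Definition ents (s : state R) (st k : nat) : seq (nat * nat) :=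
  [seq entry s t | t <- iota st k].

Lemma size_ents s st k : size (ents s st k) = k.
Proof. by rewrite size_map size_iota. Qed.

Lemma nth_ents s st k t : (t < k)%N -> nth (0, 0)%N (ents s st k) t = entry s (st + t).
Proof. by move=> h; rewrite (nth_map 0%N) ?size_iota // nth_iota. Qed.

Lemma mem_ents s st k t : (st <= t < st + k)%N -> entry s t \in ents s st k.
Proof. by move=> h; apply: map_f; rewrite mem_iota. Qed.

Lemma ents_rcons s st k : ents s st k.+1 = rcons (ents s st k) (entry s (st + k)).
Proof. by rewrite /ents -addn1 iotaD map_cat cats1. Qed.

Lemma ents_eq s s' st k : (forall t, (st <= t < st + k)%N -> entry s' t = entry s t) ->
  ents s' st k = ents s st k.
Proof. by move=> h; apply/eq_in_map => t; rewrite mem_iota => /h. Qed.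

Lemma drop_ents s st k c : drop c (ents s st k) = ents s (st + c) (k - c).
Proof. by rewrite /ents -map_drop drop_iota addnC. Qed.

Lemma take_ents s st k c : (c <= k)%N -> take c (ents s st k) = ents s st c.
Proof. by move=> h; rewrite /ents -map_take take_iota; move/minn_idPl: h ->. Qed.

(** Stated for an arbitrary [part] computing [g], so that it serves both sides. Entries are only
    appended above [vTop]; the node being split thus stays readable for the second side. *)
Lemma push_parts_spec part u v bound g s c k top tp :
  all (fun x => x \notin cmd_mod part)
    [:: (0, vN); (0, vOne); (0, vTwo); (0, vZero); (0, vBuf); (0, vRes);
        (0, vE); (0, vTop); (0, bound); (1, aLo); (1, aHi)]%N ->
  (bound != vE) && (bound != vTop) ->
  consts s -> sc s vE = c -> sc s bound = (c + k)%N -> sc s vTop = top ->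
  (c + k <= top)%N -> (top + k < lim)%N ->
  (forall s1 e, frame (cmd_mod (push_parts part u v bound)) s s1 -> consts s1 ->
     sc s1 vE = e -> (c <= e < c + k)%N -> entry s1 e = entry s e ->
     tri part s1 tp (fun s2 => sc s2 u = (g (entry s e)).1 /\
                               sc s2 v = (g (entry s e)).2)) ->
  tri (push_parts part u v bound) s (k * (tp + 8) + 2) (fun s' =>
    [/\ ents s' top (sc s' vTop - top) = [seq e <- map g (ents s c k) | nonempty e],
      (top <= sc s' vTop <= top + k)%N &
      forall i, (i < top)%N -> entry s' i = entry s i]).
Proof.
move=> hmod /andP[hb1 hb2] hc hE hB hT htop hlt hpart.
have unmod x : x \in [:: (0, vN); (0, vOne); (0, vTwo); (0, vZero); (0, vBuf);
    (0, vRes); (0, vE); (0, vTop); (0, bound); (1, aLo); (1, aHi)]%N ->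
    x \notin cmd_mod part by move/(allP hmod).
have unmod' x : x \notin [:: (1, aLo); (1, aHi); (0, vTop); (0, vE)]%N ->
    x \in [:: (0, vN); (0, vOne); (0, vTwo); (0, vZero); (0, vBuf);
      (0, vRes); (0, vE); (0, vTop); (0, bound); (1, aLo); (1, aHi)]%N ->
    x \notin cmd_mod (push_parts part u v bound).
  move=> h1 /unmod h2; rewrite /= mem_cat negb_or h2 /=.
  by apply: contra h1; rewrite !inE => /or4P[]->; rewrite ?orbT.
pose I (s' : state R) := let e := sc s' vE in let T := sc s' vTop in
  [/\ (c <= e <= c + k)%N, (top <= T <= top + (e - c))%N,
    ents s' top (T - top) = [seq e <- map g (ents s c (e - c)) | nonempty e] &
    forall i, (i < top)%N -> entry s' i = entry s i].
apply: (@tri_for _ _ I (fun s' => (c + k - sc s' vE)%N) (tp + 6)).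
- move=> s1 [he hT' hents hold] hf hb.
  have hc1 : consts s1.
    apply: (consts_frame hf) hc => /=.
    by rewrite !unmod' // !inE ?eqxx ?orbT // ?(negbTE hb1).
  have eB : sc s1 bound = (c + k)%N.
    rewrite -hB; case: hf => h _ _ _; apply: h; apply: unmod'; rewrite !inE ?eqxx ?orbT //.
    by rewrite !xpair_eqE /= (negbTE hb1) (negbTE hb2).
  rewrite /= eB in hb.
  set e := sc s1 vE in he hT' hents hb; set T := sc s1 vTop in hT' hents.
  have hen : entry s1 e = entry s e by apply: hold; clear -hb htop; lia.
  apply: (@tri_seq _ _ _ _ _ tp 6 _ (fun s2 => sc s2 u = (g (entry s e)).1 /\
    sc s2 v = (g (entry s e)).2)); last by [].
    by apply: hpart => //; clear -he hb; lia.
  move=> s2 [eu ev] hf2.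
  have hc2 : consts s2.
    by apply: (consts_frame hf2) hc1 => /=; rewrite !unmod // !inE ?eqxx ?orbT.
  have [eE eT] : sc s2 vE = e /\ sc s2 vTop = T.
    by case: hf2 => h _ _ _; split; apply: h; apply: unmod; rewrite !inE ?eqxx ?orbT.
  have hen2 i : entry s2 i = entry s1 i.
    case: hf2 => _ h _ _; rewrite /entry !h //; apply: unmod; by rewrite !inE ?eqxx ?orbT.
  have := hc2 => -[[d0 d1 d2 d3] _].
  have eS : ents s c (e.+1 - c) = rcons (ents s c (e - c)) (entry s e).
    have -> : (e.+1 - c = (e - c).+1)%N by clear -he; lia.
    by rewrite ents_rcons; congr (rcons _ (entry _ _)); clear -he; lia.
  have eS' : [seq e <- map g (ents s c (e.+1 - c)) | nonempty e] =
    if nonempty (g (entry s e)) then rcons (ents s1 top (T - top)) (g (entry s e))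
    else ents s1 top (T - top).
    by rewrite eS map_rcons filter_rcons hents.
  apply: (@tri_seq _ _ _ _ _ 4 2 _ (fun s3 => [/\ sc s3 vE = e, consts s3,
      (top <= sc s3 vTop <= top + (e.+1 - c))%N,
      ents s3 top (sc s3 vTop - top) =
        [seq e <- map g (ents s c (e.+1 - c)) | nonempty e] &
      forall i, (i < top)%N -> entry s3 i = entry s i])) => //.
    apply: tri_if => //; rewrite /cond_val eu ev => hne; apply: tri_block => //=.
    + by rewrite eT d1; clear -hlt hT' he hb; do !split; lia.
    + rewrite /= eT d1; split=> //=.
      * by clear -hT' he; lia.
      * rewrite eS' /nonempty hne.
        have -> : (T + 1 - top = (T - top).+1)%N by clear -hT'; lia.
        rewrite ents_rcons; congr rcons; last first.
          rewrite /entry /= subnKC ?eqxx; last by case/andP: hT'.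
          by rewrite eu ev -surjective_pairing.
        apply: ents_eq => i hi; rewrite -(hen2 i) /entry /=.
        by case: eqP => // ei; exfalso; clear -hi hT' ei; lia.
      * move=> i hi; rewrite -(hold i hi) -hen2 /entry /=.
        by case: eqP => // ei; exfalso; clear -hi hT' ei; lia.
    + rewrite eT; split=> //.
      * by clear -hT' he; lia.
      * by rewrite eS' /nonempty (negbTE hne); apply: ents_eq => i _.
      * by move=> i /hold <-.
  move=> s3 [h1 h2 h3 h4 h5] _; have := h2 => -[[e0 e1 e2 e3] _].
  apply: tri_block => //=; rewrite h1 e1 addn1.
    by clear -hb hlt htop; do !split; lia.
  split; last by rewrite /=; clear -hb; lia.
  by split => //=; clear -he hb; lia.
- move=> s1 [he hT' hents hold] hf hb.
  have eB : sc s1 bound = (c + k)%N.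
    rewrite -hB; case: hf => h _ _ _; apply: h; apply: unmod'; rewrite !inE ?eqxx ?orbT //.
    by rewrite !xpair_eqE /= (negbTE hb1) (negbTE hb2).
  rewrite /= eB in hb.
  have ee : sc s1 vE = (c + k)%N by clear -hb he; lia.
  move: hT' hents; rewrite ee addKn => hT' hents.
  by split.
- rewrite /I hE hT !subnn; split=> //; clear; lia.
- by rewrite hE; clear; nia.
Qed.

Record valid_entry (s : state R) (e : nat * nat) : Prop := ValidEntry {
  valid_lt : (e.1 < e.2)%N;
  valid_le : (e.2 <= 2 * n)%N;
  valid_size : (e.2 - e.1 <= 2 ^ J)%N;
  valid_stair : stair (slot s) e.1 e.2 }.

Lemma query_spec s st k p c :
  consts s -> sc s vS = st -> sc s vSe = (st + k)%N -> (st + k < lim)%N ->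
  (forall e, e \in ents s st k -> valid_entry s e) ->
  (c < k)%N -> ((entry s (st + c)).1 <= p < (entry s (st + c)).2)%N ->
  (forall a, a \in slots_of (ents s st k) -> a != p -> (slot s a).1 != (slot s p).1) ->
  sc s vF = p -> sc s vFe = (st + c)%N -> rg s 0%N = (slot s p).1 ->
  rg s 1%N = (slot s p).2 ->
  tri query s (k * (6 * J + 20) + 5) (fun s' => exists f c',
    [/\ sc s' vF = f, sc s' vFe = (st + c')%N, (c' < k)%N,
      ((entry s (st + c')).1 <= f < (entry s (st + c')).2)%N &
      [/\ (slot s p).1 <= (slot s f).1, rg s' 1%N = (slot s f).2 &
        forall a, a \in slots_of (ents s st k) -> (slot s p).1 <= (slot s a).1 ->
          (slot s a).2 <= (slot s f).2]]).
Proof.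
move=> hc eS eSe hst hval hck hp hne eF eFe r0 r1.
have := hc => -[[c0 c1 c2 c3] _].
apply: tri_block_seq => //=; first by rewrite eS c3; clear -hst; lia.
  by clear; lia.
rewrite eS c3 addn0; set s0 := set_sc _ _ _.
(* The maximum is over points strictly to the right of the pivot, with the pivot as starting value;
   distinct x-coordinates make this a maximum over all points not to its left. *)
pose I (s' : state R) := exists f c', [/\ (st <= sc s' vE <= st + k)%N /\
    sc s' vF = f, sc s' vFe = (st + c')%N, (c' < k)%N,
      ((entry s (st + c')).1 <= f < (entry s (st + c')).2)%N &
      [/\ (slot s p).1 <= (slot s f).1, rg s' 1%N = (slot s f).2,
        (slot s p).2 <= (slot s f).2 &
        forall e a, (st <= e < sc s' vE)%N -> ((entry s e).1 <= a < (entry s e).2)%N ->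
          (slot s p).1 < (slot s a).1 -> (slot s a).2 <= (slot s f).2]].
apply: (@tri_for _ _ I (fun s' => (st + k - sc s' vE)%N) (6 * J + 19)).
- move=> s1 [f [c' [[he ef] ec' hc' hf [hpf hr1 hpf2 hmax]]]] hfr hb.
  have hc1 := consts_frame hfr isT (hc : consts s0).
  have [fs fa fr fp] := hfr.
  have e0 : rg s1 0%N = (slot s p).1 by rewrite fr //.
  have eSe1 : sc s1 vSe = (st + k)%N by rewrite fs //.
  have hsl : slot s1 = slot s by rewrite /slot !fp.
  have hen i : entry s1 i = entry s i by rewrite /entry !fa.
  rewrite /= eSe1 in hb.
  set e := sc s1 vE in he hmax hb *.
  have [v1 v2 v3 v4] := hval _ (@mem_ents s st k e ltac:(clear -he hb; lia)).
  apply: (@tri_seq _ _ _ _ _ (6 * J + 11) 8 _ (fun s2 => sc s2 vL0 = (entry s e).1 /\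
    sc s2 vLo = cut (fun a => (slot s a).1 <= (slot s p).1) (entry s e).1 (entry s e).2)).
  + have := @search_right_spec R lim n J hlim s1 e hc1 erefl.
    rewrite !hen hsl e0; apply=> //; first by clear -hb hst; lia.
    by rewrite v2 (ltnW v1).
  + move=> s2 [eL0 eLo] hf2.
    have hc2 := consts_frame hf2 isT hc1.
    have := hc2 => -[[d0 d1 d2 d3] _].
    have [gs ga gr gp] := hf2.
    have [g1 g2 g3 g4] : [/\ sc s2 vF = f, sc s2 vFe = (st + c')%N, sc s2 vE = e &
      rg s2 1%N = (slot s f).2] by rewrite !gs // gr.
    have hsl2 : slot s2 = slot s by rewrite -hsl /slot !gp.
    have := cut_le (fun a => (slot s a).1 <= (slot s p).1) (ltnW v1).
    have [hless _] := @filter_iota_lt (fun a => (slot s a).1 <= (slot s p).1) _ _ (ltnW v1)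
      (fun a b ha hab hbb hx => le_trans (ltW (v4 a b ha hab hbb).1) hx).
    rewrite -eLo in hless *; set l := sc s2 vLo in eLo hless * => hl.
    have before a : ((entry s e).1 <= a < (entry s e).2)%N ->
        (slot s p).1 < (slot s a).1 = (a < l)%N.
      move=> ha; have : (a \in [seq a <- iota (entry s e).1 ((entry s e).2 - (entry s e).1)
          | ~~ ((slot s a).1 <= (slot s p).1)]) = ((slot s p).1 < (slot s a).1).
        rewrite mem_filter -ltNge mem_iota.
        have -> : ((entry s e).1 <= a < (entry s e).1 + ((entry s e).2 - (entry s e).1))%N.
          by clear -ha v1; lia.
        by rewrite andbT.
      by rewrite hless mem_iota => <-; clear -ha hl; lia.
    apply: (@tri_seq _ _ _ _ _ 7 1 _ (fun s3 => [/\ sc s3 vE = e, consts s3 &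
      exists f c', [/\ sc s3 vF = f, sc s3 vFe = (st + c')%N, (c' < k)%N,
      ((entry s (st + c')).1 <= f < (entry s (st + c')).2)%N &
      [/\ (slot s p).1 <= (slot s f).1, rg s3 1%N = (slot s f).2,
        (slot s p).2 <= (slot s f).2 &
        forall e' a, (st <= e' < e.+1)%N -> ((entry s e').1 <= a < (entry s e').2)%N ->
          (slot s p).1 < (slot s a).1 -> (slot s a).2 <= (slot s f).2]]])) => //.
    - have extend f' : (slot s f).2 <= (slot s f').2 ->
        (forall a, ((entry s e).1 <= a < (entry s e).2)%N ->
           (slot s p).1 < (slot s a).1 -> (slot s a).2 <= (slot s f').2) ->
        forall e' a, (st <= e' < e.+1)%N -> ((entry s e').1 <= a < (entry s e').2)%N ->
          (slot s p).1 < (slot s a).1 -> (slot s a).2 <= (slot s f').2.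
        move=> hff hnew e' a he' ha hpa; have [ee|ne] := eqVneq e' e.
          by rewrite ee in ha; exact: hnew.
        apply: le_trans hff; apply: (hmax e') => //; clear -he' ne; lia.
      apply: tri_if => //; rewrite /cond_val eL0 -/l => hlt; last first.
        apply: tri_block => //=; split=> //; exists f, c'; split=> //; split=> //.
        apply: extend => // a ha; rewrite before // => hal; exfalso.
        by clear -ha hal hlt; lia.
      have hl1 : ((entry s e).1 <= l.-1 < (entry s e).2)%N by clear -hlt hl; lia.
      have hlp : (slot s p).1 < (slot s l.-1).1 by rewrite before //; clear -hlt; lia.
      have hlast a : ((entry s e).1 <= a < (entry s e).2)%N ->
          (slot s p).1 < (slot s a).1 -> (slot s a).2 <= (slot s l.-1).2.
        move=> ha; rewrite before // => hal.
        have [->//|ne] := eqVneq a l.-1.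
        by apply/ltW; apply: (v4 a l.-1 _ _ _).2; clear -ha hal ne hlt hl1; lia.
      have ell : (l <= lim)%N by clear -hl v2 hlim; lia.
      apply: tri_block_seq => //=; rewrite ?d1 -/l.
        by clear -ell; do !split; lia.
      apply: tri_if => //=; rewrite /= g4 subn1 => hy.
        apply: tri_block => //=; rewrite ?d3 ?g3 ?addn0.
          by clear -ell hb hst; do !split; lia.
        split=> //; exists l.-1, (e - st)%N; rewrite subnKC; last by case/andP: he.
        have hy' : (slot s f).2 < (slot s l.-1).2.
          by move: hy; rewrite -[pt s2 1%N _]/((slot s2 l.-1).2) hsl2.
        split=> //.
          by clear -hb he; lia.
        split; [exact: ltW|by rewrite -[RHS]/((slot s l.-1).2) -hsl2|by apply: le_trans hpf2 (ltW hy')|].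
        by apply: extend => //; exact: ltW.
      have hy' : (slot s l.-1).2 <= (slot s f).2.
        by move: hy; rewrite -[pt s2 1%N _]/((slot s2 l.-1).2) hsl2 leNgt.
      apply: tri_block => //=; split=> //; exists f, c'; split=> //; split=> //.
      by apply: extend => // a ha hpa; apply: le_trans hy'; exact: hlast.
    - move=> s3 [h1 h2 [f2 [c2' [k1 k2 k3 k4 [k5 k6 k7 k8]]]]] hf3; have := h2 => -[[e0' e1 e2 e3] _].
      apply: tri_block => //=; rewrite h1 e1 addn1; first by clear -hb hst; do !split; lia.
      split; last by rewrite /=; clear -hb; lia.
      exists f2, c2'; split=> //; first by split=> //=; clear -he hb; lia.
  + by clear; lia.
- move=> s1 [f [c' [[he ef] ec' hc' hf [hpf hr1 hpf2 hmax]]]] hfr hb.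
  have eSe1 : sc s1 vSe = (st + k)%N by case: hfr => ->.
  rewrite /= eSe1 in hb.
  exists f, c'; split=> //; split=> // a ha hpa.
  have [->//|nap] := eqVneq a p.
  have := hne a ha nap => hx.
  have /slots_ofP[i [hi hai]] := ha; rewrite size_ents in hi; rewrite nth_ents // in hai.
  apply: (hmax (st + i)%N a) => //; first by clear -hi hb he; lia.
  by rewrite lt_neqAle eq_sym hx.
- exists p, c; rewrite /s0 /=; split=> //; first by split=> //; clear; lia.
  split=> // e a he; exfalso; clear -he; lia.
- by rewrite /s0 /=; clear; nia.
Qed.

End NodeLoops.

Section NodePieces.
Variables (R : realType) (lim n J : nat).
Hypothesis hlim : (64 * n + 64 <= lim)%N.
Local Notation tri := (@tri R lim).
Local Notation consts := (@consts R n).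
Local Notation entry := (@entry R).
Local Notation ents := (@ents R).
Local Notation valid_entry := (@valid_entry R n J).

Lemma slots_of_ents s st k i : (i < k)%N -> slots_of (ents s st k) =
  slots_of (ents s st i) ++
  (iota (entry s (st + i)).1 ((entry s (st + i)).2 - (entry s (st + i)).1) ++
   slots_of (ents s (st + i).+1 (k - i).-1)).
Proof.
move=> ik; rewrite -{1}(cat_take_drop i (ents s st k)) slots_of_cat.
rewrite take_ents ?(ltnW ik) // drop_ents; congr (_ ++ _).
by have -> : (k - i = (k - i).-1.+1)%N by clear -ik; lia.
Qed.

Lemma slots_of_ents_rcons s st i : slots_of (ents s st i.+1) =
  slots_of (ents s st i) ++
  iota (entry s (st + i)).1 ((entry s (st + i)).2 - (entry s (st + i)).1).
Proof.
by rewrite (slots_of_ents s st (ltnSn i)) subSnn /= cats0.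
Qed.

Lemma slots_of_ents_size s st k i : (i <= k)%N ->
  (size (slots_of (ents s st i)) <= size (slots_of (ents s st k)))%N.
Proof.
move=> ik; rewrite -[in X in (_ <= X)%N](cat_take_drop i (ents s st k)) slots_of_cat.
by rewrite take_ents // size_cat leq_addr.
Qed.

Lemma node_size_spec s st k :
  consts s -> sc s vS = st -> sc s vK = k -> (st + k < lim)%N ->
  (sc s vT + k <= lim)%N ->
  (size (slots_of (ents s st k)) <= 2 * n)%N ->
  tri node_size s (8 * k + 8) (fun s' => [/\ sc s' vT = (sc s vT + k)%N,
    sc s' vSe = (st + k)%N & sc s' vTot = size (slots_of (ents s st k))]).
Proof.
move=> hc eS eK hst hT hN; have := hc => -[[c0 c1 c2 c3] _].
apply: tri_block_seq => //=; rewrite ?eS ?eK ?c3 ?addn0.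
  by clear -hst hT; do !split; lia.
  by clear; lia.
set s0 := set_sc _ _ _.
pose I (s' : state R) := exists i, [/\ sc s' vE = (st + i)%N, (i <= k)%N &
  sc s' vTot = size (slots_of (ents s st i))].
apply: (@tri_for _ _ I (fun s' => (st + k - sc s' vE)%N) 5).
- move=> s1 [i [hE ik hTot]] hfr hb; have hc1 := consts_frame hfr isT (hc : consts s0).
  have := hc1 => -[[d0 d1 d2 d3] _]; have [fs fa fr fp] := hfr.
  have hen j : entry s1 j = entry s j by rewrite /entry !fa.
  have [eLo eHi] : ar s1 aLo (st + i) = (entry s (st + i)).1 /\
    ar s1 aHi (st + i) = (entry s (st + i)).2 by rewrite -hen.
  have eSe : sc s1 vSe = (st + k)%N by rewrite fs.
  rewrite /= eSe hE ltn_add2l in hb.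
  have hsz := slots_of_ents_size s st hb.
  rewrite slots_of_ents_rcons size_cat size_iota in hsz.
  apply: tri_block => //=; rewrite ?hE ?d1 ?hTot.
    by rewrite eLo eHi; clear -hst hb hsz hN hlim; do !split; lia.
  split; last by clear -hb; lia.
  exists i.+1; split=> //=; rewrite ?hE ?addn1 ?addnS //.
  by rewrite eLo eHi slots_of_ents_rcons size_cat size_iota.
- move=> s1 [i [hE ik hTot]] [fs fa fr fp] hb.
  have eSe : sc s1 vSe = (st + k)%N by rewrite fs.
  rewrite /= eSe hE ltn_add2l -leqNgt in hb.
  have e : i = k by clear -hb ik; lia.
  by rewrite fs // eSe hTot e.
- by exists 0%N; split=> //=; rewrite addn0.
- by clear; rewrite /s0 /=; lia.
Qed.

(** The pivot must be uniform over the slots of the node, not over its entries, so it is found by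
    scanning the interval lengths. The scan is linear in [k] and thus cheaper than the [k] binary
    searches that follow. *)
Lemma locate_spec s st k r :
  consts s -> sc s vS = st -> sc s vR = r -> (st + k < lim)%N ->
  (r < size (slots_of (ents s st k)))%N ->
  (size (slots_of (ents s st k)) <= 2 * n)%N ->
  (forall e, e \in ents s st k -> (e.2 <= 2 * n)%N) ->
  tri locate s (8 * k + 16) (fun s' => exists c,
    let p := nth 0%N (slots_of (ents s st k)) r in
    [/\ sc s' vF = p, sc s' vFe = (st + c)%N, (c < k)%N,
      ((entry s (st + c)).1 <= p < (entry s (st + c)).2)%N &
      rg s' 0%N = (slot s p).1 /\ rg s' 1%N = (slot s p).2]).
Proof.
move=> hc eS eR hst hr hN h2n; have := hc => -[[c0 c1 c2 c3] _].
have k0 : (0 < k)%N by case: k hr {hN h2n hst} => //; rewrite /ents /slots_of /=.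
apply: tri_block_seq => //=; rewrite ?eS ?eR ?c3 ?c1 ?addn0 ?addn1.
  by clear -hst hlim hr hN; do !split; lia.
  by clear; lia.
set s0 := set_sc _ _ _.
pose I (s' : state R) := exists i r', [/\ sc s' vE = (st + i)%N /\ (i < k)%N,
  sc s' vR = r' /\ sc s' vV = r'.+1, sc s' vLo = (entry s (st + i)).1,
  sc s' vU = ((entry s (st + i)).2 - (entry s (st + i)).1)%N &
  r = (size (slots_of (ents s st i)) + r')%N].
apply: (@tri_seq _ _ _ _ _ (8 * k + 1) 5 _ (fun s1 => I s1 /\ ~~ (sc s1 vU < sc s1 vV)%N)).
- apply: (@tri_for _ _ I (fun s' => (st + k - sc s' vE)%N) 7).
  + move=> s1 [i [r' [[hE ik] [hR hV] hLo hU hrr]]] hfr hb.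
    have hc1 := consts_frame hfr isT (hc : consts s0).
    have := hc1 => -[[d0 d1 d2 d3] _]; have [fs fa fr fp] := hfr.
    have hen j : entry s1 j = entry s j by rewrite /entry !fa.
    rewrite /= hU hV ltnS in hb.
    have ik1 : (i.+1 < k)%N.
      rewrite ltn_neqAle ik andbT; apply/eqP => e; move: hr.
      by rewrite -e slots_of_ents_rcons size_cat size_iota hrr; clear -hb; lia.
    have [eLo eHi] : ar s1 aLo (st + i.+1) = (entry s (st + i.+1)).1 /\
      ar s1 aHi (st + i.+1) = (entry s (st + i.+1)).2 by rewrite -hen.
    apply: tri_block => //=; rewrite ?hE ?d1 ?hR ?hU ?addn1.
      by clear -hst ik1 hrr hr hN hlim; do !split; lia.
    split; last by rewrite /=; clear -ik1; lia.
    exists i.+1, (r' - ((entry s (st + i)).2 - (entry s (st + i)).1))%N.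
    split=> //=; rewrite ?hE ?addn1 ?addnS -?addnS ?hR ?hU //.
    * by rewrite eLo eHi.
    * by rewrite slots_of_ents_rcons size_cat size_iota hrr; move: hb; rewrite /entry /=; clear; lia.
  + by move=> s1 hI _ hb; split.
  + exists 0%N, r; rewrite addn0; split=> //=.
  + by rewrite /s0 /=; clear -k0; lia.
- move=> s1 [[i [r' [[hE ik] [hR hV] hLo hU hrr]]] hb] hfr.
  have hc1 := consts_frame hfr isT (hc : consts s0).
  have := hc1 => -[[d0 d1 d2 d3] _]; have [fs fa fr fp] := hfr.
  rewrite hV hU ltnS -ltnNge in hb.
  have hp : ((entry s (st + i)).1 + r' = nth 0%N (slots_of (ents s st k)) r)%N.
    rewrite (slots_of_ents _ _ ik) hrr nth_cat ltnNge leq_addr /= addKn.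
    by rewrite nth_cat size_iota hb nth_iota.
  have h2 := h2n _ (@mem_ents _ s st k (st + i) ltac:(clear -ik; lia)).
  apply: tri_block => //=; rewrite ?hLo ?hR ?hE ?d3 ?addn0.
    by move: hb h2; rewrite /entry /=; clear -hlim ik hst; do !split; lia.
  exists i; rewrite -hp; split=> //=; first by move: hb; rewrite /entry /=; clear; lia.
  by rewrite !fp.
- by clear; lia.
Qed.

Lemma emit_spec s st lo hi o : consts s -> sc s vS = st -> (st <= lim)%N ->
  entry s st = (lo, hi) -> (lo <= hi <= 2 * n)%N -> sc s vOut = o ->
  (2 * n <= o)%N -> (o + (hi - lo) <= 4 * n)%N ->
  tri emit_node s (8 * (hi - lo) + 6) (fun s' =>
    [/\ sc s' vOut = (o + (hi - lo))%N,
      forall t, (t < hi - lo)%N -> slot s' (o + t) = slot s (hi - t.+1) &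
      forall p, (p < o)%N -> slot s' p = slot s p]).
Proof.
move=> hc eS hst hE hlh eO ho hol; have := hc => -[[c0 c1 c2 c3] _].
have [eLo eHi] : ar s aLo st = lo /\ ar s aHi st = hi by case: hE.
apply: tri_block_seq => //=; rewrite ?eS ?c3 ?addn0 ?eLo ?eHi.
  by clear -hst; do !split; lia.
  by clear; lia.
set s0 := set_sc _ _ _.
pose I (s' : state R) := [/\ sc s' vLo = lo, (lo <= sc s' vHi <= hi)%N,
  sc s' vOut = (o + (hi - sc s' vHi))%N,
  forall t, (t < hi - sc s' vHi)%N -> slot s' (o + t) = slot s (hi - t.+1) &
  forall p, (p < o)%N -> slot s' p = slot s p].
apply: (@tri_for _ _ I (fun s' => (sc s' vHi - lo)%N) 6).
- move=> s1 [hLo hHi hO hcp hold] hfr hb; have hc1 := consts_frame hfr isT (hc : consts s0).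
  have := hc1 => -[[d0 d1 d2 d3] _].
  rewrite /= hLo in hb.
  apply: tri_block => //=; rewrite ?d1 ?hO ?hLo ?subn1.
    by clear -hHi hlh hb hol hlim; do !split; lia.
  have nd : ((sc s1 vHi).-1 == o + (hi - sc s1 vHi))%N = false.
    by clear -hHi hlh ho hb; lia.
  split; last by rewrite /=; clear -hb; lia.
  split; rewrite /= ?hLo ?d1 ?hO //.
  + by clear -hb hHi; lia.
  + by clear -hb hHi; lia.
  + move=> t ht; rewrite /slot /= eqn_add2l; case: eqP => [e|ne].
      have -> : (hi - t.+1 = (sc s1 vHi).-1)%N by clear -e hb hHi; lia.
      by apply: hold; clear -hHi hlh ho hb; lia.
    by apply: hcp; clear -ht ne hb hHi; lia.
  + move=> p hp; rewrite /slot /=; case: eqP => [e|ne]; last exact: hold.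
    by exfalso; clear -e hp; lia.
- move=> s1 [hLo hHi hO hcp hold] _ hb; rewrite /= hLo in hb.
  have e : sc s1 vHi = lo by clear -hb hHi; lia.
  by rewrite e in hO hcp.
- by split; rewrite /s0 //= ?eO; clear -hlh; move=> *; lia.
- by rewrite /s0 /=; clear; lia.
Qed.

(** Popping a node does not release its entries: [vTop] never decreases during a search, and the
    bound on [vT] is what limits it. *)
Definition stack (s : state R) (ns : seq (seq (nat * nat))) : Prop :=
  sc s vSp = size ns /\ forall i, (i < size ns)%N ->
    (ar s aStart i + ar s aCount i <= sc s vTop)%N /\
    ents s (ar s aStart i) (ar s aCount i) = nth [::] ns i.

Lemma stack_le s s' ns : stack s ns -> sc s' vSp = sc s vSp ->
  (sc s vTop <= sc s' vTop)%N -> ar s' aStart = ar s aStart ->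
  ar s' aCount = ar s aCount ->
  (forall i, (i < sc s vTop)%N -> entry s' i = entry s i) -> stack s' ns.
Proof.
move=> [h1 h2] e1 e2 e3 e4 he; split; first by rewrite e1.
move=> i /h2[h3 h4]; rewrite e3 e4 -h4; split; first exact: leq_trans e2.
by apply: ents_eq => t ht; apply: he; clear -h3 ht; lia.
Qed.

Lemma push_node_spec s ns : consts s -> stack s ns -> (sc s vS2 <= sc s vTop)%N ->
  (size ns < lim)%N ->
  tri (Block push_node) s 4 (fun s' =>
    [/\ stack s' (rcons ns (ents s (sc s vS2) (sc s vTop - sc s vS2))),
      entry s' = entry s & sc s' vTop = sc s vTop]).
Proof.
move=> hc [h1 h2] hle hlt; have := hc => -[[c0 c1 c2 c3] _].
apply: tri_block => //=; rewrite ?h1 ?c1.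
  by clear -hlt; do !split; lia.
split=> //; split; first by rewrite size_rcons /= addn1.
move=> i; rewrite size_rcons ltnS leq_eqVlt => /orP[/eqP->|hi] /=.
  rewrite !eqxx nth_rcons ltnn eqxx subnKC //.
rewrite nth_rcons hi; have -> : (i == size ns) = false by rewrite ltn_eqF.
by have [h3 h4] := h2 i hi; split=> //; rewrite -h4.
Qed.

End NodePieces.

Section AfterPivot.
Variables (R : realType) (lim n J : nat).
Hypothesis hlim : (64 * n + 64 <= lim)%N.
Local Notation tri := (@tri R lim).
Local Notation consts := (@consts R n).
Local Notation entry := (@entry R).
Local Notation ents := (@ents R).
Local Notation valid_entry := (@valid_entry R n J).

Lemma valid_entry_slot s s' e : slot s' = slot s -> valid_entry s e -> valid_entry s' e.
Proof. by move=> h [h1 h2 h3 h4]; split=> //; rewrite h. Qed.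

Lemma split_right_spec s ns st k c f :
  consts s -> stack s ns -> (size ns < lim)%N ->
  sc s vFe = (st + c)%N -> (c < k)%N -> sc s vSe = (st + k)%N ->
  (st + k <= sc s vTop)%N -> (sc s vTop + k < lim)%N ->
  (forall e, e \in ents s st k -> valid_entry s e) ->
  sc s vF = f -> (f <= lim)%N ->
  tri split_right s (k * (6 * J + 19) + 10) (fun s' =>
    [/\ stack s' (rcons ns (right_part (slot s) (slot s f).1 c (ents s st k))),
      (sc s vTop <= sc s' vTop <= sc s vTop + k)%N &
      forall i, (i < sc s vTop)%N -> entry s' i = entry s i]).
Proof.
move=> hc hst hns eFe ck eSe hk hlt hval eF hf; have := hc => -[[c0 c1 c2 c3] _].
apply: tri_block_seq => //=; rewrite ?eF ?eFe ?c3 ?addn0.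
  by clear -hf ck hk hlt; do !split; lia.
  by clear; lia.
set s0 := set_sc _ _ _; set top := sc s vTop.
have hck : (st + c + (k - c) = st + k)%N by clear -ck; lia.
apply: (@tri_seq _ _ _ _ _ ((k - c) * (6 * J + 11 + 8) + 2) 4 _ (fun s1 =>
   [/\ ents s1 top (sc s1 vTop - top) = [seq e <- map (fun e => (e.1,
        cut (fun a => (slot s a).1 <= (slot s f).1) e.1 e.2))
        (ents s0 (st + c) (k - c)) | nonempty e],
      (top <= sc s1 vTop <= top + (k - c))%N &
      forall i, (i < top)%N -> entry s1 i = entry s0 i])).
- apply: (@push_parts_spec R lim n) => //.
  + by rewrite hck.
  + by rewrite hck.
  + by clear -hlt; lia.
  + move=> s1 e hfr hc1 hE he hen; have [fs fa fr fp] := hfr.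
    have hsl : slot s1 = slot s by rewrite /slot !fp.
    have hr0 : rg s1 0%N = (slot s f).1 by rewrite fr.
    have hme : entry s e \in ents s st k by apply: mem_ents; clear -he ck; lia.
    have [v1 v2 v3 v4] := hval _ hme.
    have := @search_right_spec R lim n J hlim s1 e hc1 hE.
    rewrite hsl hr0 hen; apply=> //; first by clear -he hk hlt ck; lia.
    by rewrite v2 (ltnW v1).
- move=> s1 [h1 h2 h3] hfr.
  have hc1 := consts_frame hfr isT (hc : consts s0).
  have [fs fa fr fp] := hfr.
  have hs1 : stack s1 ns.
    exact: (stack_le hst (fs vSp isT) (andP h2).1 (fa aStart isT) (fa aCount isT) h3).
  have eS2 : sc s1 vS2 = top by rewrite fs //= c3 addn0.
  have := @push_node_spec R lim n s1 ns hc1 hs1; rewrite eS2 => /(_ (andP h2).1 hns) h.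
  apply: (tri_weak h) => // s2 [k1 k2 k3]; rewrite k3 k2; split=> //.
  + by move: k1; rewrite h1 /right_part drop_ents.
  + by clear -h2; lia.
- have : ((k - c) * (6 * J + 11 + 8) <= k * (6 * J + 19))%N by rewrite -addnA leq_mul // leq_subr.
  by clear; lia.
Qed.

Lemma push_front_spec s ns f : consts s -> stack s ns -> (size ns < lim)%N ->
  (sc s vTop < lim)%N -> sc s vF = f -> (f < lim)%N ->
  tri push_front s 9 (fun s' =>
    [/\ stack s' (rcons ns [:: (f, f.+1)]), sc s' vTop = (sc s vTop).+1 &
      forall i, (i < sc s vTop)%N -> entry s' i = entry s i]).
Proof.
move=> hc hst hns hlt eF hf; have := hc => -[[c0 c1 c2 c3] _].
have -> : push_front = Block ([:: mov vS2 vTop; AOp WAdd vU vF vOne] ++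
  push_entry vF vU ++ push_node) by [].
(* One block is regarded as two consecutive ones, so that [push_node_spec] applies to the second;
   the times add up to the same. *)
suff : tri (Seq (Block ([:: mov vS2 vTop; AOp WAdd vU vF vOne] ++ push_entry vF vU))
    (Block push_node)) s 9 (fun s' =>
    [/\ stack s' (rcons ns [:: (f, f.+1)]), sc s' vTop = (sc s vTop).+1 &
      forall i, (i < sc s vTop)%N -> entry s' i = entry s i]).
  move=> h K v hK; have := h K v hK; rewrite /=.
  move=> [[p1 [p2 [p3 [p4 [p5 _]]]]] [[q1 [q2 [q3 [q4 _]]]] hk]].
  split; first by do !split.
  by move: hk; congr (K _ _); rewrite -!addrA; congr (_ + _); lra.
apply: tri_block_seq => //=; rewrite ?eF ?c1 ?c3 ?addn0 ?addn1.
  by clear -hlt hf; do !split; lia.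
set s1 := set_sc _ _ _.
have he i : (i < sc s vTop)%N -> entry s1 i = entry s i.
  by move=> hi; rewrite /entry /= !(ltn_eqF hi).
have hs1 : stack s1 ns by apply: (stack_le hst).
have := @push_node_spec R lim n s1 ns hc hs1.
rewrite /= => /(_ (leqnSn _) hns) h.
apply: (tri_weak h) => // s2 [k1 k2 k3]; split=> //; last by rewrite k2.
move: k1; rewrite subSnn; rewrite /ents /= /entry /= !eqxx.
by [].
Qed.

Lemma split_left_spec s ns st k c f :
  consts s -> stack s ns -> (size ns < lim)%N ->
  sc s vFe = (st + c)%N -> (c < k)%N -> sc s vS = st ->
  (st + k <= sc s vTop)%N -> (sc s vTop + k < lim)%N ->
  (forall e, e \in ents s st k -> valid_entry s e) ->
  rg s 1%N = (slot s f).2 ->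
  tri split_left s (k * (6 * J + 19) + 10) (fun s' =>
    [/\ stack s' (rcons ns (left_part (slot s) (slot s f).2 c (ents s st k))),
      (sc s vTop <= sc s' vTop <= sc s vTop + k)%N &
      forall i, (i < sc s vTop)%N -> entry s' i = entry s i]).
Proof.
move=> hc hst hns eFe ck eS hk hlt hval hr1; have := hc => -[[c0 c1 c2 c3] _].
apply: tri_block_seq => //=; rewrite ?eFe ?eS ?c1 ?c3 ?addn0.
  by clear -ck hk hlt; do !split; lia.
  by clear; lia.
set s0 := set_sc _ _ _; set top := sc s vTop.
apply: (@tri_seq _ _ _ _ _ (c.+1 * (6 * J + 11 + 8) + 2) 4 _ (fun s1 =>
   [/\ ents s1 top (sc s1 vTop - top) = [seq e <- map (fun e =>
        (cut (fun a => (slot s f).2 < (slot s a).2) e.1 e.2, e.2))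
        (ents s0 st c.+1) | nonempty e],
      (top <= sc s1 vTop <= top + c.+1)%N &
      forall i, (i < top)%N -> entry s1 i = entry s0 i])).
- apply: (@push_parts_spec R lim n) => //.
  + by rewrite /s0 /= addn1 addnS.
  + by rewrite -/top; clear -hk ck; lia.
  + by clear -hlt ck; lia.
  + move=> s1 e hfr hc1 hE he hen; have [fs fa fr fp] := hfr.
    have hsl : slot s1 = slot s by rewrite /slot !fp.
    have hr0 : rg s1 1%N = (slot s f).2 by rewrite fr.
    have hme : entry s e \in ents s st k by apply: mem_ents; clear -he ck; lia.
    have [v1 v2 v3 v4] := hval _ hme.
    have := @search_left_spec R lim n J hlim s1 e hc1 hE.
    rewrite hsl hr0 hen => h; apply: (tri_weak (h _ _ _ _)) => //.
    * by clear -he hk hlt ck; lia.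
    * by rewrite v2 (ltnW v1).
    * by move=> s2 [].
- move=> s1 [h1 h2 h3] hfr.
  have hc1 := consts_frame hfr isT (hc : consts s0).
  have [fs fa fr fp] := hfr.
  have hs1 : stack s1 ns.
    exact: (stack_le hst (fs vSp isT) (andP h2).1 (fa aStart isT) (fa aCount isT) h3).
  have eS2 : sc s1 vS2 = top by rewrite fs //= c3 addn0.
  have := @push_node_spec R lim n s1 ns hc1 hs1; rewrite eS2 => /(_ (andP h2).1 hns) h.
  apply: (tri_weak h) => // s2 [k1 k2 k3]; rewrite k3 k2; split=> //.
  + by move: k1; rewrite h1 /left_part take_ents.
  + by clear -h2 ck; lia.
- have : (c.+1 * (6 * J + 11 + 8) <= k * (6 * J + 19))%N by rewrite -addnA leq_mul.
  by clear; lia.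
Qed.

Lemma after_pivot_spec s ns st k r front :
  consts s -> stack s ns -> (size ns + 3 < lim)%N -> sc s vS = st ->
  sc s vSe = (st + k)%N -> (st + k <= sc s vTop)%N -> (sc s vTop + 2 * k + 2 < lim)%N ->
  (forall e, e \in ents s st k -> valid_entry s e) ->
  node (slot s) front (ents s st k) ->
  (size (slots_of (ents s st k)) <= 2 * n)%N ->
  sc s vR = r -> (r < size (slots_of (ents s st k)))%N ->
  tri after_pivot s (k * (18 * J + 66) + 60) (fun s' => exists f c,
    let p := nth 0%N (slots_of (ents s st k)) r in
    [/\ (c < k)%N, ((nth (0, 0)%N (ents s st k) c).1 <= f <
        (nth (0, 0)%N (ents s st k) c).2)%N, (slot s p).1 <= (slot s f).1,
      forall a, a \in slots_of (ents s st k) -> (slot s p).1 <= (slot s a).1 ->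
        (slot s a).2 <= (slot s f).2 &
      (sc s vTop <= sc s' vTop <= sc s vTop + 2 * k + 1)%N /\
      stack s' (ns ++ [:: right_part (slot s) (slot s f).1 c (ents s st k);
        [:: (f, f.+1)]; left_part (slot s) (slot s f).2 c (ents s st k)])]).
Proof.
move=> hc hst hns eS eSe hk hlt hval hnode hN eR hr.
apply: (@tri_seq _ _ _ _ _ (8 * k + 16) (k * (18 * J + 58) + 44) _ _ _
  (locate_spec hlim hc eS eR _ hr hN (fun e he => valid_le (hval e he)))); last first.
- by clear; lia.
- move=> s1 [c0 /= [hF hFe hc0 hp [hr0 hr1]]] hf1.
  have hc1 := consts_frame hf1 isT hc; have [fs fa fr fp] := hf1.
  set p := nth 0%N _ _ in hF hp hr0 hr1 *.
  have sl1 : slot s1 = slot s by rewrite /slot !fp.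
  have hen i : entry s1 i = entry s i by rewrite /entry !fa.
  have en1 : ents s1 st k = ents s st k by apply: ents_eq => t _.
  have tp1 : sc s1 vTop = sc s vTop by rewrite fs.
  have st1 : stack s1 ns.
    by apply: (stack_le hst (fs vSp isT) _ (fa aStart isT) (fa aCount isT)) => [|i _ //]; rewrite tp1.
  have pin : p \in slots_of (ents s st k) by exact: mem_nth.
  have eS1 : sc s1 vS = st by rewrite fs.
  have eSe1 : sc s1 vSe = (st + k)%N by rewrite fs.
  have := @query_spec R lim n J hlim s1 st k p c0 hc1 eS1 eSe1.
  rewrite sl1 en1 hen => hq.
  apply: (@tri_seq _ _ _ _ _ (k * (6 * J + 20) + 5) (k * (12 * J + 38) + 39) _ _ _ (hq _ _ _ _ _ hF hFe hr0 hr1)) => //.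
  + by clear -hk hlt; lia.
  + by move=> e /hval; exact: valid_entry_slot.
  + move=> a ha hap; exact: (node_distinct hnode ha pin hap).1.
  + move=> s2 [f [c [hF2 hFe2 ck hfc [hpf hr12 hmax]]]] hf2.
    have hc2 := consts_frame hf2 isT hc1; have [gs ga gr gp] := hf2.
    have sl2 : slot s2 = slot s by rewrite -sl1 /slot !gp.
    have hen2 i : entry s2 i = entry s i by rewrite -hen /entry !ga.
    have en2 : ents s2 st k = ents s st k by apply: ents_eq => t _.
    have tp2 : sc s2 vTop = sc s vTop by rewrite -tp1 gs.
    have st2 : stack s2 ns.
      apply: (stack_le st1 (gs vSp isT) _ (ga aStart isT) (ga aCount isT)) => [|i _]; first by rewrite tp2 tp1.
      by rewrite hen2 hen.
    rewrite hen in hfc.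
    have hf2n : (f < 2 * n)%N.
      have hme : entry s (st + c) \in ents s st k by apply: mem_ents; clear -ck; lia.
      have [_ v2 _ _] := hval _ hme; exact: leq_trans (andP hfc).2 v2.
    have := @split_right_spec s2 ns st k c f hc2 st2 _ hFe2 ck.
    have eSe2 : sc s2 vSe = (st + k)%N by rewrite gs.
    rewrite en2 sl2 tp2 => h.
    apply: (@tri_seq _ _ _ _ _ (k * (6 * J + 19) + 10) (k * (6 * J + 19) + 29) _ _ _ (h _ eSe2 hk _ _ hF2 _)) => //.
    * by clear -hns; lia.
    * by clear -hlt; lia.
    * by move=> e /hval; exact: valid_entry_slot.
    * by clear -hf2n hlim; lia.
    * move=> s3 [st3 tp3 hen3] hf3.
      have hc3 := consts_frame hf3 isT hc2; have [ks ka kr kp] := hf3.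
      have sl3 : slot s3 = slot s by rewrite -sl2 /slot !kp.
      have hF3 : sc s3 vF = f by rewrite ks.
      have h3 := push_front_spec hc3 st3 _ _ hF3.
      apply: (@tri_seq _ _ _ _ _ 9 (k * (6 * J + 19) + 10) _ _ _ (h3 _ _ _)).
      - by rewrite size_rcons; clear -hns; lia.
      - by clear -tp3 hlt; lia.
      - by clear -hf2n hlim; lia.
      - move=> s4 [st4 tp4 hen4] hf4.
        have hc4 := consts_frame hf4 isT hc3; have [ls la lr lp] := hf4.
        have sl4 : slot s4 = slot s by rewrite -sl3 /slot !lp.
        have en4 : ents s4 st k = ents s st k.
          rewrite -en2; apply: ents_eq => t ht; rewrite hen4; last by clear -ht hk tp3; lia.
          by rewrite hen3 //; clear -ht hk; lia.
        have r14 : rg s4 1%N = (slot s4 f).2 by rewrite sl4 lr // kr.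
        have hFe4 : sc s4 vFe = (st + c)%N by rewrite ls // ks.
        have eS4 : sc s4 vS = st by rewrite ls // ks // gs // fs.
        have h4 := split_left_spec hc4 st4 _ hFe4 ck eS4 _ _ _ r14.
        rewrite en4 sl4 in h4; apply: (tri_weak (h4 _ _ _ _)) => //.
        + by rewrite !size_rcons; clear -hns; lia.
        + by rewrite tp4; clear -tp3 hk; lia.
        + by rewrite tp4; clear -tp3 hlt; lia.
        + by move=> e /hval; exact: valid_entry_slot.
        move=> s5 [st5 tp5 hen5]; exists f, c; rewrite nth_ents //; split=> //.
        split; first by move: tp5; rewrite tp4; clear -tp3; lia.
        by move: st5; rewrite -!cats1 -!catA.
      - by clear; lia.
    * by clear; lia.
  + by clear; lia.
- by clear -hlt hk; lia.
Qed.

End AfterPivot.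

(** * The invariant of the search *)

Section SearchInvariant.
Variables (R : realType) (lim J : nat) (P : seq (R * R)).
Let n := size P.
Hypothesis hlim : (64 * n + 64 <= lim)%N.
Local Notation tri := (@tri R lim).
Local Notation consts := (@consts R n).
Local Notation entry := (@entry R).
Local Notation ents := (@ents R).
Local Notation valid_entry := (@valid_entry R n J).

Lemma node_ext (X X' : nat -> R * R) (front front' : pred nat) es :
  (forall a, a \in slots_of es -> X' a = X a /\ front' a = front a) ->
  node X front es -> node X' front' es.
Proof.
move=> h [h1 h2 h3 h4 h5 h6].
have memS e a : e \in es -> (e.1 <= a < e.2)%N -> a \in slots_of es.
  by move=> he ha; apply/slots_ofP; exists (index e es); rewrite index_mem nth_index.
split=> //.
- move=> e he; have [ne st] := h1 e he; split=> // a b ha hab hb.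
  have [|-> _] := h a; first by apply: (memS e) => //; rewrite ha (ltn_trans hab hb).
  have [|-> _] := h b; first by apply: (memS e) => //; rewrite hb (leq_trans ha (ltnW hab)).
  exact: st.
- by move=> a b ha hb; rewrite (h a ha).1 (h b hb).1; exact: h2.
- by move=> a b ha hb; rewrite (h a ha).1 (h b hb).1 (h a ha).2; exact: h4.
- move=> a ha; rewrite (h a ha).2 => /(h5 a ha)[b [hb fb k1 k2]].
  by exists b; rewrite (h a ha).1 (h b hb).1 (h b hb).2.
- rewrite /ordered in h6 *; apply: (sub_in_pairwise (P := mem es)) h6; last exact/allP.
  move=> e e' he he' /asboolP k; apply/asboolP => a b ha hb.
  have [ha' hb'] := (memS e a he ha, memS e' b he' hb).
  by rewrite (h a ha').1 (h b hb').1 (h a ha').2 (h b hb').2; exact: k.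
Qed.

Definition front (s : state R) : pred nat := fun a => ~~ dominated P (slot s a).

(** [m], [off] and [X] record the blocks at the start of the search, which the next phase needs if
    the search is given up. For [srch_bounds]: a split of [k >= 2] entries adds [k] to [vT], at most
    [2 * k + 1 <= 3 * k] to [vTop] and two nodes to the stack; it takes place only while [vT <= n],
    and [k <= 2 * n]. The top of the stack is the end of [ns], so by [srch_order] the leftmost
    points are on top. *)
Record searching (m : nat) (off : nat -> nat) (X : nat -> R * R)
    (s : state R) (ns : seq (seq (nat * nat))) (O : seq (R * R)) : Prop := Searching {
  srch_consts : consts s;
  srch_blocks : [/\ sc s vM = m, ar s aOff = off &
    forall p, (p < 2 * n)%N -> slot s p = X p];
  srch_stack : stack s ns;
  srch_node : forall es, es \in ns -> node (slot s) (front s) es;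
  srch_valid : forall es e, es \in ns -> e \in es -> valid_entry s e;
  srch_out : sc s vOut = (3 * n + size O)%N;
  srch_outE : forall t, (t < size O)%N -> slot s (3 * n + t) = nth (0, 0) O t;
  srch_bounds : [/\ (sc s vT <= 3 * n)%N, (sc s vTop <= n + 3 * sc s vT)%N &
    (size ns <= (sc s vT).+1)%N];
  srch_count :
    (size O + \sum_(es <- ns) count (front s) (slots_of es) <= n)%N;
  srch_cover : forall q, q \in P -> ~~ dominated P q -> q \in O \/
    exists es a, [/\ es \in ns, a \in slots_of es & slot s a = q];
  srch_sound : forall q, q \in O -> q \in P /\ ~~ dominated P q;
  srch_src : forall es a, es \in ns -> a \in slots_of es -> slot s a \in P;
  srch_sorted : sorted (fun p q : R * R => p.1 < q.1) O;
  srch_after : forall q es a, q \in O -> es \in ns -> a \in slots_of es ->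
    q.1 < (slot s a).1;
  srch_order : pairwise (fun es es' => `[< forall a b, a \in slots_of es ->
    b \in slots_of es' -> (slot s b).1 < (slot s a).1 >]) ns }.

Lemma valid_slots s es a : (forall e, e \in es -> valid_entry s e) ->
  a \in slots_of es -> (a < 2 * n)%N.
Proof.
move=> h /slots_ofP[i [hi /andP[_ ha]]].
by have [_ h2 _ _] := h _ (mem_nth (0, 0)%N hi); exact: leq_trans ha h2.
Qed.

Lemma node_slots_le s es : (forall e, e \in es -> valid_entry s e) ->
  node (slot s) (front s) es -> (size (slots_of es) <= 2 * n)%N.
Proof.
move=> hv hn; rewrite -(size_iota 0 (2 * n)); apply: uniq_leq_size.
  exact: node_uniq hn.
by move=> a /(valid_slots hv) ha; rewrite mem_iota.
Qed.

Lemma size_slots_ge (X : nat -> R * R) f es : node X f es ->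
  (size es <= size (slots_of es))%N.
Proof.
move=> /node_stair; rewrite /slots_of; elim: es => //= e es IH h.
rewrite size_cat size_iota.
have [h1 _] := h e (mem_head _ _); rewrite /nonempty in h1.
have {}h e' : e' \in es -> nonempty e' /\ stair X e'.1 e'.2.
  by move=> he'; apply: h; rewrite inE he' orbT.
by have := IH h; clear -h1; lia.
Qed.

Lemma node_front_gt0 (X : nat -> R * R) f es : node X f es -> (0 < size es)%N ->
  (0 < count f (slots_of es))%N.
Proof.
move=> hn h0; rewrite -has_count; apply/hasP.
have := leq_trans h0 (size_slots_ge hn).
case E : (slots_of es) => [//|a U] _.
have ha : a \in slots_of es by rewrite E mem_head.
have [fa|nfa] := boolP (f a); first by exists a; rewrite -?E.
by have [b [hb fb _ _]] := node_closed hn ha nfa; exists b; rewrite -?E.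
Qed.

Definition node_potential (s : state R) es : R :=
  potential R (size es).-1 (size (slots_of es)) (count (front s) (slots_of es)).

Lemma node_potentialE s es : node_potential s es =
  potential R (size es).-1 (size (slots_of es)) (count (front s) (slots_of es)).
Proof. by []. Qed.

Lemma node_potential_ge0 s es : node (slot s) (front s) es -> 0 <= node_potential s es.
Proof.
move=> hn; apply: potential_ge0.
  by apply: leq_trans (leq_pred _) (size_slots_ge hn).
by move=> h; apply: (node_front_gt0 hn); clear -h; lia.
Qed.

Lemma set_go_searching m off X s ns O x :
  searching m off X s ns O -> searching m off X (set_sc s vGo x) ns O.
Proof.
move=> h; have hv := srch_valid h; case: h => *; split=> // es e hes he.
exact: valid_entry_slot (hv es e hes he).
Qed.

Lemma emit_searching m off X s ns lo hi O s0 :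
  searching m off X s (rcons ns [:: (lo, hi)]) O ->
  frame [:: (0, vSp); (0, vS); (0, vK)]%N s s0 -> sc s0 vSp = size ns ->
  entry s (sc s0 vS) = (lo, hi) -> (sc s0 vS <= lim)%N ->
  tri emit_node s0 (8 * (hi - lo) + 6) (fun s' => exists O',
    [/\ searching m off X s' ns O', size O' = (size O + (hi - lo))%N,
      sc s' vT = sc s vT & forall es, es \in ns -> node_potential s' es = node_potential s es]).
Proof.
case=> hc [hM hoff hX] hst hnode hval hout houtE [b1 b2 b3] hcount hcover hsound hsrc hsorted hafter horder.
move=> hf0 eSp hE hlS.
have hc0 := consts_frame hf0 isT hc; have [f0s f0a f0r f0p] := hf0.
have sl0 : slot s0 = slot s by rewrite /slot !f0p.
have en0 i : entry s0 i = entry s i by rewrite /entry !f0a.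
have memlast : [:: (lo, hi)] \in rcons ns [:: (lo, hi)] by rewrite mem_rcons mem_head.
have memns es : es \in ns -> es \in rcons ns [:: (lo, hi)].
  by move=> h; rewrite mem_rcons inE h orbT.
have [v1 v2 v3 v4] := hval _ _ memlast (mem_head _ _).
rewrite /= in v1 v2 v3 v4.
have eS : slots_of [:: (lo, hi)] = iota lo (hi - lo) by rewrite /slots_of /= cats0.
have mS a : (a \in slots_of [:: (lo, hi)]) = (lo <= a < hi)%N.
  by rewrite eS mem_iota subnKC // ltnW.
have hfr := node_single (hnode _ memlast).
have hcnt : count (front s) (slots_of [:: (lo, hi)]) = (hi - lo)%N.
  rewrite -[RHS](size_iota lo) -eS; apply/eqP; rewrite -all_count; apply/allP => a.
  by rewrite mS; exact: hfr.
rewrite -cats1 big_cat big_seq1 hcnt /= in hcount.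
(* [srch_count] charges every output to a front slot of a pending node, which keeps the output
   region below slot [4 * n]. *)
have hO4 : (3 * n + size O + (hi - lo) <= 4 * n)%N by clear -hcount; lia.
have eO0 : sc s0 vOut = (3 * n + size O)%N by rewrite f0s.
have hE0 : entry s0 (sc s0 vS) = (lo, hi) by rewrite en0.
have e1 := @emit_spec R lim n hlim s0 _ lo hi _ hc0 erefl hlS hE0 _ eO0 _ hO4.
apply: (tri_weak (tri_frame (e1 _ _))) => //.
- by rewrite v2 ltnW.
- by clear; lia.
move=> s' [[k1 k2 k3] hf]; have hc' := consts_frame hf isT hc0.
have [fs fa fr fp] := hf.
have sls p : (p < 3 * n + size O)%N -> slot s' p = slot s p by move=> hp; rewrite k3 // sl0.
have sl2 p : (p < 2 * n)%N -> slot s' p = slot s p by move=> hp; apply: sls; clear -hp; lia.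
have slE es a : es \in ns -> a \in slots_of es -> slot s' a = slot s a.
  move=> hes ha; apply: sl2; apply: (valid_slots (s := s)) ha => e.
  by apply: hval; exact: memns.
have frE es a : es \in ns -> a \in slots_of es -> front s' a = front s a.
  by move=> hes ha; rewrite /front (slE es a hes ha).
pose L := [seq slot s (hi - t.+1) | t <- iota 0 (hi - lo)].
have LP q : reflect (exists2 a, (lo <= a < hi)%N & q = slot s a) (q \in L).
  apply: (iffP mapP) => [[t]|[a ha ->]].
    by rewrite mem_iota => ht ->; exists (hi - t.+1)%N => //; clear -ht; lia.
  exists (hi - a.+1)%N; first by rewrite mem_iota; clear -ha; lia.
  by congr (slot s _); clear -ha; lia.
have szL : size L = (hi - lo)%N by rewrite size_map size_iota.
exists (O ++ L); split.
- split.
  + exact: hc'.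
  + by split; rewrite ?fs ?fa ?f0s ?f0a // => p hp; rewrite sl2 // hX.
  + have [h1 h2] := hst; split; first by rewrite fs.
    move=> i hi'; have := h2 i; rewrite size_rcons => /(_ (ltnW hi')) [h3 h4].
    rewrite !fa // !fs // !f0a // !f0s //; split=> //.
    rewrite nth_rcons hi' in h4; rewrite -h4.
    by apply: ents_eq => t _; rewrite /entry !fa // !f0a.
  + move=> es hes; apply: node_ext (hnode _ (memns _ hes)) => a ha.
    by rewrite (slE es) // (frE es).
  + move=> es e hes he; have [w1 w2 w3 w4] := hval es e (memns _ hes) he; split=> //.
    move=> a b ha hab hb; rewrite !sl2; [exact: w4| |]; clear -hab hb w2; lia.
  + by rewrite k1 size_cat szL addnA.
  + move=> t; rewrite size_cat szL => ht2; rewrite nth_cat; case: ltnP => ht1.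
      by rewrite sls; [exact: houtE|rewrite ltn_add2l].
    have -> : (3 * n + t = 3 * n + size O + (t - size O))%N by rewrite -addnA subnKC.
    have ht : (t - size O < hi - lo)%N by rewrite ltn_subLR.
    rewrite k2 ?sl0 //.
    by rewrite (nth_map 0%N) ?size_iota // nth_iota.
  + rewrite fs // f0s // fs // f0s //; split=> //; apply: leq_trans b3.
    by rewrite size_rcons.
  + rewrite size_cat szL (eq_big_seq (fun es => count (front s) (slots_of es))).
      by move: hcount; rewrite -addnA [(hi - lo + _)%N]addnC.
    by move=> es hes; apply: eq_in_count => a ha; exact: frE ha.
  + move=> q hq nq; have [hO|[es [a [hes ha hqa]]]] := hcover q hq nq.
      by left; rewrite mem_cat hO.
    move: hes; rewrite mem_rcons inE => /orP[/eqP e|hes].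
      left; rewrite mem_cat; apply/orP; right; apply/LP; exists a => //.
      by rewrite -mS -e.
    by right; exists es, a; rewrite (slE es).
  + move=> q; rewrite mem_cat => /orP[/hsound//|/LP[a ha ->]].
    by split; [apply: (hsrc [:: (lo, hi)]) => //; rewrite mS|exact: hfr].
  + by move=> es a hes ha; rewrite (slE es) //; exact: hsrc (memns _ hes) ha.
  + have tr : transitive (fun p q : R * R => p.1 < q.1) by move=> x y z; exact: lt_trans.
    rewrite (sorted_pairwise tr) pairwise_cat -!(sorted_pairwise tr) hsorted /=.
    apply/andP; split.
      by apply/allrelP => p q hp /LP[a ha ->]; apply: (hafter _ [:: (lo, hi)]) => //; rewrite mS.
    rewrite (sorted_pairwise tr) pairwise_map; apply/(pairwiseP 0%N) => i j.
    rewrite !inE size_iota => hi1 hj1 hij; rewrite !nth_iota // !add0n /=.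
    by apply: (v4 (hi - j.+1)%N (hi - i.+1)%N _ _ _).1; clear -hi1 hj1 hij; lia.
  + move=> q es a; rewrite mem_cat => hq hes ha; rewrite (slE es) //.
    case/orP: hq => [hq|/LP[b hb ->]]; first exact: (hafter q es a hq (memns _ hes) ha).
    move: horder; rewrite pairwise_rcons => /andP[/allP/(_ es hes)/asboolP h _].
    by apply: h => //; rewrite mS.
  + move: horder; rewrite pairwise_rcons => /andP[_].
    move=> h; apply: (sub_in_pairwise (P := mem ns)) h; last exact/allP.
    move=> es es' hes hes' /asboolP h; apply/asboolP => a b ha hb.
    by rewrite (slE es a hes ha) (slE es' b hes' hb); exact: h.
- by rewrite size_cat szL.
- by rewrite fs // f0s.
- move=> es hes; rewrite /node_potential; congr potential.
  by apply: eq_in_count => a ha; exact: frE ha.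
Qed.

End SearchInvariant.

(** * Effect of a split on the invariant and on the potential *)

Section SplitInvariant.
Variables (R : realType) (lim J : nat) (P : seq (R * R)).
Let n := size P.
Hypothesis hlim : (64 * n + 64 <= lim)%N.
Local Notation tri := (@tri R lim).
Local Notation searching := (@searching R J P).
Local Notation front := (@front R P).
Local Notation node_potential := (@node_potential R P).
Local Notation ents := (@ents R).

(** A good pivot leaves at most three quarters of the slots on either side, so [potential_split]
    applies with [r = 4 / 3], and [ln (4 / 3) >= 1 / 4]. For any other pivot [r = 1] shows that the
    potential does not grow. *)
Lemma split_potential (s : state R) es f p c :
  node (slot s) (front s) es -> (1 < size es)%N -> (c < size es)%N ->
  ((nth (0, 0) es c).1 <= f < (nth (0, 0) es c).2)%N ->
  (slot s p).1 <= (slot s f).1 ->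
  (forall a, a \in slots_of es -> (slot s p).1 <= (slot s a).1 ->
     (slot s a).2 <= (slot s f).2) ->
  node_potential s (left_part (slot s) (slot s f).2 c es) +
  node_potential s (right_part (slot s) (slot s f).1 c es) <=
  node_potential s es -
    (size es).-1%:R / 4 * (good_pivot (fun a => (slot s a).1) (slots_of es) p)%:R.
Proof.
move=> hn h1 hc hf hpf hmax.
have hl := split_left_node hn hc hf hpf hmax.
have hr := split_right_node hn hc hf hpf hmax.
have wl := split_left_count hn hc hf hpf hmax.
have wr := split_right_count c hn hpf.
have hcnt := split_front_count hn hc hf hpf hmax.
have hw := @split_weight R (slot s) es f c hc.
set L := left_part (slot s) (slot s f).2 c es in hl wl hcnt hw *.
set U := right_part (slot s) (slot s f).1 c es in hr wr hcnt hw *.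
have main (r : R) : 1 <= r -> ln r <= 1 ->
    r * (size (slots_of L))%:R <= (size (slots_of es))%:R ->
    r * (size (slots_of U))%:R <= (size (slots_of es))%:R ->
    node_potential s L + node_potential s U <=
    node_potential s es - (size es).-1%:R * ln r.
  move=> r1 lr hL hU; apply: potential_split => //.
  - have := size_slots_ge hn; clear -h1; lia.
  - by apply: node_front_gt0 hn _; clear -h1; lia.
  - exact: ltnW.
  - exact: leq_trans (leq_pred _) (size_slots_ge hl).
  - exact: leq_trans (leq_pred _) (size_slots_ge hr).
  - by move=> h; apply: (node_front_gt0 hl); clear -h; lia.
  - by move=> h; apply: (node_front_gt0 hr); clear -h; lia.
have leN (V : seq (nat * nat)) (q : pred nat) : (size (slots_of V) <= count q (slots_of es))%N ->
    (size (slots_of V) <= size (slots_of es))%N.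
  by move=> h; apply: leq_trans h (count_size _ _).
case: (boolP (good_pivot _ _ _)) => [/andP[g1 g2]|_] /=; last first.
  rewrite mulr0 subr0; have := main 1 (lexx _).
  rewrite ln1 mulr0 subr0 !mul1r !ler_nat; apply=> //; first exact: leN wl.
  exact: leN wr.
(* Both bounds are instances of [ln z <= z - 1], at [z = 3 / 4] and at [z = 4 / 3]. *)
have l43 : 1 / 4 <= ln (4 / 3 : R) <= 1.
  have h : ln (4 / 3 : R) = - ln (3 / 4) by rewrite -lnV ?posrE ?invf_div //; lra.
  apply/andP; split.
    rewrite h; have := @ln_le_sub1 R (3 / 4); lra.
  by have := @ln_le_sub1 R (4 / 3); lra.
have big (V : seq (nat * nat)) (q : pred nat) : (size (slots_of V) <= count q (slots_of es))%N ->
    (4 * count q (slots_of es) <= 3 * size (slots_of es))%N ->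
    4 / 3 * (size (slots_of V))%:R <= (size (slots_of es))%:R :> R.
  move=> k1 k2; have : (4 * size (slots_of V) <= 3 * size (slots_of es))%N.
    by apply: leq_trans k2; rewrite leq_mul2l k1 orbT.
  by rewrite -(ler_nat R) !natrM; lra.
have r1 : 1 <= 4 / 3 :> R by lra.
have hm := main (4 / 3) r1 (andP l43).2 (big _ _ wl g1) (big _ _ wr g2).
have h0 : 0 <= (size es).-1%:R :> R by [].
case/andP: l43 => l43 _; rewrite mulr1; apply: le_trans hm _.
by rewrite lerD2l lerN2; apply: ler_wpM2l => //; lra.
Qed.

Lemma split_searching m off X s ns es O s0 st k r :
  searching m off X s (rcons ns es) O -> (1 < size es)%N ->
  frame [seq (0, u)%N | u <- [:: vSp; vS; vK; vT; vSe; vTot; vU; vR; vE; vLo; vHi]] s s0 ->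
  (sc s vT <= n)%N -> k = size es -> sc s0 vT = (sc s vT + k)%N ->
  sc s0 vSp = size ns -> sc s0 vS = st -> ents s st k = es ->
  (st + k <= sc s vTop)%N -> sc s0 vSe = (st + k)%N ->
  sc s0 vR = r -> (r < size (slots_of es))%N ->
  tri after_pivot s0 (k * (18 * J + 66) + 60) (fun s' => exists ns',
    [/\ searching m off X s' (ns ++ ns') O, size ns' = 3, sc s' vT = (sc s vT + k)%N,
      \sum_(es' <- ns') node_potential s' es' <= node_potential s es -
        (size es).-1%:R / 4 * (good_pivot (fun a => (slot s a).1) (slots_of es)
          (nth 0%N (slots_of es) r))%:R &
      forall es, es \in ns -> node_potential s' es = node_potential s es]).
Proof.
move=> hsr h1 hf0 hT hk eT eSp eS hes hst eSe eR hr.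
have [hc [hM hoff hX] hstk hnode hval hout houtE [b1 b2 b3] hcount hcover hsound hsrc
  hsorted hafter horder] := hsr.
have hc0 := consts_frame hf0 isT hc; have [f0s f0a f0r f0p] := hf0.
have sl0 : slot s0 = slot s by rewrite /slot !f0p.
have en0 : ents s0 st k = es by rewrite -hes; apply: ents_eq => t _; rewrite /entry !f0a.
have memlast : es \in rcons ns es by rewrite mem_rcons mem_head.
have memns es' : es' \in ns -> es' \in rcons ns es.
  by move=> h; rewrite mem_rcons inE h orbT.
have hn := hnode _ memlast.
have hN := node_slots_le (fun e => hval _ e memlast) hn.
have kN : (k <= 2 * n)%N by rewrite hk; exact: leq_trans (size_slots_ge hn) hN.
have stk0 : stack s0 ns.
  have [h2 h3] := hstk; split=> // i hi; have := h3 i; rewrite size_rcons => /(_ (ltnW hi))[].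
  rewrite nth_rcons hi !f0a // f0s // => h4 <-; split=> //.
  by apply: ents_eq => t _; rewrite /entry !f0a.
have b3' : (size ns <= sc s vT)%N by move: b3; rewrite size_rcons.
have tp0 : sc s0 vTop = sc s vTop by rewrite f0s.
have eSe0 : (st + k <= sc s0 vTop)%N by rewrite tp0.
have := @after_pivot_spec R lim n J hlim s0 ns st k r (front s) hc0 stk0 _ eS eSe eSe0.
rewrite en0 sl0 tp0 => h.
apply: (tri_weak (tri_frame (h _ _ _ hn hN eR hr))) => //.
- by clear -b3' hT hlim; lia.
- by clear -b2 hT hlim kN; lia.
- by move=> e he; apply: valid_entry_slot (hval es e memlast he).
move=> s' [[f [c [hck hfc hpf hmax [tp' stk']]]] hf].
set p := nth 0%N _ _ in hpf hmax *.
have hc' := consts_frame hf isT hc0; have [fs fa fr fp] := hf.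
have sl : slot s' = slot s by rewrite -sl0 /slot !fp.
have frE : front s' = front s by rewrite /front sl.
have hce : (c < size es)%N by rewrite -hk.
have hl := split_left_node hn hce hfc hpf hmax.
have hri := split_right_node hn hce hfc hpf hmax.
have hmi := split_mid_node hn hce hfc hpf hmax.
have hcnt := split_front_count hn hce hfc hpf hmax.
have lsub a := @split_left_sub R (slot s) (front s) es f c hn a.
have rsub a := @split_right_sub R (slot s) (front s) es f c hn a.
have llt a := @split_lt R (slot s) (front s) es f p c hn hmax a.
have hpot := split_potential hn h1 hce hfc hpf hmax.
have cov := split_cover hn hce hfc hpf hmax.
have lent e := @left_entry R (slot s) (front s) es f c hn e.
have rent e := @right_entry R (slot s) (front s) es f c hn e.
have fin : f \in slots_of es by apply/slots_ofP; exists c.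
have ffr := split_front hn hce hfc hpf hmax.
set L := left_part (slot s) (slot s f).2 c es in hl hcnt lsub llt hpot cov lent stk'.
set U := right_part (slot s) (slot s f).1 c es in hri hcnt rsub hpot cov rent stk'.
have mF a : (a \in slots_of [:: (f, f.+1)]) = (a == f) by rewrite /slots_of /= subSnn inE.
have sub es' a : es' \in [:: U; [:: (f, f.+1)]; L] -> a \in slots_of es' -> a \in slots_of es.
  rewrite !inE => /or3P[]/eqP-> ha; first by have [] := rsub a ha.
    by move: ha; rewrite mF => /eqP->.
  by have [] := lsub a ha.
exists [:: U; [:: (f, f.+1)]; L]; split=> //.
- split.
  + exact: hc'.
  + by split; rewrite ?fs ?fa ?f0s ?f0a ?sl.
  + exact: stk'.
  + move=> es'; rewrite mem_cat sl frE => /orP[/memns|]; first exact: hnode.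
    by rewrite !inE => /or3P[]/eqP->.
  + move=> es' e; rewrite mem_cat => /orP[he hee|hes' hee].
      by apply: valid_entry_slot (hval es' e (memns _ he) hee); rewrite sl.
    apply: (valid_entry_slot (s := s)); first by rewrite sl.
    have sube e' : e' \in es -> (e'.1 <= e.1)%N -> (e.1 < e.2)%N -> (e.2 <= e'.2)%N ->
        valid_entry n J s e.
      move=> he' k1 k2 k3; have [w1 w2 w3 w4] := hval es e' memlast he'; split=> //.
      * exact: leq_trans k3 w2.
      * by apply: leq_trans w3; exact: leq_sub.
      * by move=> a b ha hab hb; apply: w4 => //; [exact: leq_trans ha|exact: leq_trans k3].
    move: hes'; rewrite !inE => /or3P[]/eqP ees; rewrite ees in hee.
    * by have [e' he' [k1 k2 k3]] := rent e hee; apply: (sube e') => //; rewrite k1.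
    * move: hee; rewrite inE => /eqP ee; apply: (sube (nth (0, 0)%N es c)).
      - exact: mem_nth.
      - by rewrite ee; case/andP: hfc.
      - by rewrite ee /=.
      - by rewrite ee; case/andP: hfc.
    * by have [e' he' [k1 k2 k3]] := lent e hee; apply: (sube e') => //; rewrite k3.
  + by rewrite fs // f0s.
  + by move=> t ht; rewrite sl houtE.
  + rewrite fs // eT; split; first by clear -hT kN; lia.
      by clear -tp' b2 hk h1; lia.
    by rewrite size_cat /= addn3; clear -b3' hk h1; lia.
  + move: hcount; rewrite -cats1 !big_cat big_seq1 /= !big_cons big_nil frE.
    rewrite /(slots_of [:: (f, f.+1)]) /= subSnn /= ffr addn0.
    by move: hcnt; clear; lia.
  + move=> q hq nq; have [hO|[es' [a [hes' ha hqa]]]] := hcover q hq nq; first by left.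
    right; move: hes'; rewrite mem_rcons inE => /orP[/eqP e|hes']; last first.
      by exists es', a; rewrite mem_cat hes' sl.
    rewrite e in ha; have fa' : front s a by rewrite /front hqa.
    have [ea|ha'|ha'] := cov a ha fa'.
    * by exists [:: (f, f.+1)], f; rewrite mF eqxx sl -ea mem_cat !inE eqxx !orbT.
    * by exists L, a; rewrite sl mem_cat !inE eqxx !orbT.
    * by exists U, a; rewrite sl mem_cat !inE eqxx !orbT.
  + exact: hsound.
  + move=> es' a; rewrite mem_cat sl => /orP[/memns hes' ha|hes' ha]; first exact: hsrc hes' ha.
    by apply: (hsrc es) => //; exact: sub hes' ha.
  + exact: hsorted.
  + move=> q es' a hq; rewrite mem_cat sl => /orP[/memns hes' ha|hes' ha].
      exact: hafter hq hes' ha.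
    by apply: (hafter q es) => //; exact: sub hes' ha.
  + move: horder; rewrite pairwise_rcons pairwise_cat => /andP[/allP ho1 ho2].
    apply/and3P; split.
    * apply/allrelP => es1 es2 hes1 hes2; apply/asboolP => a b ha hb; rewrite sl.
      by have /asboolP := ho1 _ hes1; apply=> //; exact: sub hes2 hb.
    * by move: ho2; rewrite sl.
    * rewrite /= !andbT -andbA; apply/and3P; split; apply/asboolP => a b;
        rewrite (fp 0%N isT) (f0p 0%N isT).
      - by move=> /rsub[_ ha]; rewrite mF => /eqP->.
      - by move=> /rsub[_ ha] /llt hb; exact: lt_trans hb (le_lt_trans hpf ha).
      - by rewrite mF => /eqP-> /llt hb; exact: lt_le_trans hb hpf.
- by rewrite fs.
- rewrite !big_cons big_nil addr0; have npE e : node_potential s' e = node_potential s e.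
    by rewrite !node_potentialE frE.
  rewrite !npE.
  have -> : node_potential s [:: (f, f.+1)] = 0.
    by rewrite !node_potentialE /potential mul0r.
  by rewrite add0r addrC.
- by move=> es' _; rewrite !node_potentialE frE.
Qed.

End SplitInvariant.

(** * Expected cost of a search *)

Section SearchLoop.
Variables (R : realType) (lim J : nat) (P : seq (R * R)).
Let n := size P.
Hypothesis hlim : (64 * n + 64 <= lim)%N.
Hypothesis n_gt0 : (0 < n)%N.
Local Notation tri := (@tri R lim).
Local Notation ert := (@ert R lim).
Local Notation searching := (@searching R J P).
Local Notation front := (@front R P).
Local Notation node_potential := (@node_potential R P).
Local Notation ents := (@ents R).

Lemma drop_searching m off X s ns O s0 :
  searching m off X s (rcons ns [::]) O ->
  frame [:: (0, vSp); (0, vS); (0, vK)]%N s s0 -> sc s0 vSp = size ns ->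
  searching m off X s0 ns O /\ forall es, node_potential s0 es = node_potential s es.
Proof.
case=> hc [hM hoff hX] hst hnode hval hout houtE [b1 b2 b3] hcount hcover hsound hsrc hsorted hafter horder.
move=> hf eSp; have [fs fa fr fp] := hf.
have sl : slot s0 = slot s by rewrite /slot !fp.
have frE : front s0 = front s by rewrite /front sl.
have memns es : es \in ns -> es \in rcons ns [::].
  by move=> h; rewrite mem_rcons inE h orbT.
split; last by move=> es; rewrite !node_potentialE frE.
split.
- exact: consts_frame hf isT hc.
- by rewrite fs // fa // sl.
- have [h1 h2] := hst; split=> // i hi.
  have := h2 i; rewrite size_rcons nth_rcons hi => /(_ (ltnW hi)).
  rewrite !fa // fs // => -[h3 <-]; split=> //.
  by apply: ents_eq => t _; rewrite /entry !fa.
- by move=> es /memns; rewrite sl frE; exact: hnode.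
- by move=> es e /memns hes he; apply: valid_entry_slot (hval es e hes he).
- by rewrite fs.
- by rewrite sl.
- by rewrite !fs //; split=> //; apply: leq_trans b3; rewrite size_rcons.
- by move: hcount; rewrite -cats1 big_cat big_seq1 /= addn0 frE.
- move=> q hq nq; have [|[es [a [hes ha e]]]] := hcover q hq nq; first by left.
  move: hes ha; rewrite mem_rcons inE => /orP[/eqP->//|hes ha].
  by right; exists es, a; rewrite sl.
- exact: hsound.
- by move=> es a /memns; rewrite sl; exact: hsrc.
- exact: hsorted.
- by move=> q es a hq /memns; rewrite sl; exact: hafter.
- by move: horder; rewrite pairwise_rcons sl => /andP[].
Qed.

Lemma sum_good (g : nat -> R) (U : seq nat) :
  (size U)%:R / 2 <= \sum_(r < size U) (good_pivot g U (nth 0%N U r))%:R :> R.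
Proof.
rewrite -(big_mkord xpredT (fun r => (good_pivot g U (nth 0%N U r))%:R)).
rewrite -(big_nth 0%N xpredT (fun p => (good_pivot g U p)%:R)).
have := count_good_pivot g U; rewrite -(ler_nat R) natrM -sum1_count natr_sum.
by rewrite big_mkcond /= (eq_bigr (fun p => (good_pivot g U p)%:R)) => [|p _]; [lra|case: ifP].
Qed.

Variables (m : nat) (off : nat -> nat) (X : nat -> R * R).
Variables (K : state R -> R -> Prop) (a b : R).
Hypothesis a_ge0 : 0 <= a.
Hypothesis b_ge0 : 0 <= b.
Hypothesis K_done : forall s v O, searching m off X s [::] O -> a <= v -> K s v.
Hypothesis K_fail : forall s v ns O, searching m off X s ns O -> (0 < size ns)%N ->
  (1 < m)%N -> a + b <= v -> K s v.

(* A search that starts from a single block splits no node and cannot fail. *)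
Definition splits_only_if_many (s : state R) (ns : seq (seq (nat * nat))) : Prop :=
  (1 < m)%N \/ sc s vT = 0%N /\ forall es, es \in ns -> (size es <= 1)%N.

(** The worst-case part of the cost. An entry of a split node pays for at most three binary searches
    of about [6 * J] steps, an output point for its copy, and a stacked node for being popped. The
    bound [3 * n] is that of [srch_bounds] on [vT]. *)
Definition search_cost (t o sp : nat) : nat :=
  ((18 * J + 200) * (3 * n - t) + 8 * (n - o) + 20 * sp + 2)%N.

(* Splitting a node with k entries adds k to vT and lowers its potential by at
   least k / 16 in expectation, and the search is given up when vT exceeds n.
   Hence the factor of b bounds the probability of that, as in Markov's
   inequality. *)
Definition search_value (s : state R) ns (O : seq (R * R)) : R :=
  (search_cost (sc s vT) (size O) (size ns))%:R + a +
  ((sc s vT)%:R + 16 * \sum_(es <- ns) node_potential s es) / n%:R * b.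

Definition tail : cmd :=
  Seq (Block [:: mov vGo vSp]) (If (CLt vN vT) (Block [:: ASet vGo 0]) (Block [::])).

Lemma tail_spec s ns O : searching m off X s ns O ->
  tri tail s 3 (fun s' => [/\ searching m off X s' ns O,
    sc s' vGo = (if n < sc s vT then 0 else size ns)%N, sc s' vT = sc s vT &
    forall es, node_potential s' es = node_potential s es]).
Proof.
move=> h; have := srch_consts h => -[[c0 c1 c2 c3] _].
have [hsp _] := srch_stack h; have [b1 b2 b3] := srch_bounds h.
apply: tri_block_seq => //=; rewrite ?c3 ?addn0.
  by rewrite hsp; clear -b1 b3 hlim; lia.
apply: tri_if => //=; rewrite c0 => ht; apply: tri_block => //=.
  by rewrite ht; split=> //; do 2 apply: set_go_searching.
by rewrite (negbTE ht) hsp; split=> //; apply: set_go_searching.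
Qed.

Lemma potential_sum_ge0 s ns O : searching m off X s ns O ->
  0 <= \sum_(es <- ns) node_potential s es.
Proof.
move=> h; rewrite big_seq; apply: sumr_ge0 => es hes.
by apply: node_potential_ge0; exact: (srch_node h).
Qed.

Lemma search_exit s ns O v : searching m off X s ns O -> splits_only_if_many s ns ->
  search_value s ns O <= v ->
  ~~ (0 < (if n < sc s vT then 0 else size ns))%N -> K s (v - 1).
Proof.
move=> hsr hm hv hb; have hphi := potential_sum_ge0 hsr.
have n0 : 0 < n%:R :> R by rewrite ltr0n.
have base : 1 <= (search_cost (sc s vT) (size O) (size ns))%:R :> R.
  by rewrite ler1n /search_cost addn2.
have phi16 : 0 <= 16 * \sum_(es <- ns) node_potential s es by exact: mulr_ge0.
have pot0 : 0 <= ((sc s vT)%:R + 16 * \sum_(es <- ns) node_potential s es) / n%:R.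
  by apply: divr_ge0 => //; exact: addr_ge0.
rewrite /search_value in hv; set q := _ / n%:R in pot0 hv.
have qb : 0 <= q * b by exact: mulr_ge0.
have [ns0|ns_gt0] := posnP (size ns).
  by move/size0nil: ns0 hsr => -> hsr; apply: (K_done hsr); have a0 := a_ge0; lra.
have {hb} ht : (n < sc s vT)%N by move: hb; case: (ltnP n (sc s vT)); rewrite ?ns_gt0.
apply: (K_fail hsr) => //; first by case: hm => // -[vT0 _]; rewrite vT0 in ht.
have : 1 <= q.
  rewrite /q ler_pdivlMr // mul1r; apply: (@le_trans _ _ (sc s vT)%:R).
    by rewrite ler_nat ltnW.
  by rewrite lerDl.
move=> q1; have hqb : b <= q * b by rewrite -[X in X <= _]mul1r; apply: ler_wpM2r.
by have a0 := a_ge0; lra.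
Qed.

(** [mu] shows that the loop ends for every choice of pivots: a split adds at least 2 to [vT], which
    lowers [3 * (3 * n - vT)] by at least 6, and only 2 nodes to the stack; any other step removes a
    node. *)
Lemma search_loop_value mu s ns O v :
  (3 * (3 * n - sc s vT) + size ns <= mu)%N -> searching m off X s ns O ->
  splits_only_if_many s ns -> sc s vGo = (if n < sc s vT then 0 else size ns)%N ->
  search_value s ns O <= v -> ert search_loop K s v.
Proof.
elim: mu s ns O v => [|mu IH] s ns O v hmu hsr hm hgo hv; apply: ert_while_unfold;
    have := srch_consts hsr => -[[c0 c1 c2 c3] _];
    rewrite [cond_val _ _]/= c3 hgo; case: ifPn => hb; try exact: (search_exit hsr hm hv).
  by exfalso; move: hb hmu; case: (ltnP n (sc s vT)) => // ht; clear; lia.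
have a0 := a_ge0; have [b1 b2 b3] := srch_bounds hsr; have hphi := potential_sum_ge0 hsr.
have hT : (sc s vT <= n)%N by move: hb; case: (ltnP n (sc s vT)).
have hns : (0 < size ns)%N by move: hb; case: (ltnP n (sc s vT)).
have n0 : 0 < n%:R :> R by rewrite ltr0n.
have finish s' ns' O' v' : searching m off X s' ns' O' -> splits_only_if_many s' ns' ->
    (3 * (3 * n - sc s' vT) + size ns' <= mu)%N -> search_value s' ns' O' + 3 <= v' ->
    ert tail (ert search_loop K) s' v'.
  move=> hsr' hm' hmu' hv'; apply: (tail_spec hsr') => s2 v2 [h1 h2 h3 h4] hv2.
  apply: (IH s2 ns' O') => //; first by rewrite h3.
    by rewrite /splits_only_if_many h3.
    by rewrite h2 h3.
  rewrite /search_value h3 (eq_bigr (node_potential s')) //.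
  by rewrite /search_value in hv'; lra.
change (ert pop_node (ert tail (ert search_loop K)) s (v - 1)).
case/lastP: ns => [//|ns es] in hmu hsr hm hgo hv b3 hphi hb hns *.
rewrite size_rcons in hmu b3.
have hst := srch_stack hsr; have [hsp hst2] := hst.
rewrite size_rcons in hsp hst2; have := hst2 _ (leqnn _).
rewrite nth_rcons ltnn eqxx; set st := ar s aStart _; set k := ar s aCount _.
move=> [htop hes].
have hk : k = size es by rewrite -hes size_ents.
have memlast : es \in rcons ns es by rewrite mem_rcons mem_head.
have memns es' : es' \in ns -> es' \in rcons ns es by move=> h; rewrite mem_rcons inE h orbT.
have hn := srch_node hsr memlast.
have hvalid := srch_valid hsr memlast.
have hN := node_slots_le hvalid hn.
have kN : (k <= 2 * n)%N by rewrite hk; exact: leq_trans (size_slots_ge hn) hN.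
split.
  by rewrite /= hsp c1 subn1 /=; clear -b3 b1 hlim; do !split; lia.
set s0 := block_run _ s.
have hf0 : frame [:: (0, vSp); (0, vS); (0, vK)]%N s s0.
  by apply: frame_block => x; rewrite /= !inE.
have [e1 e2 e3] : [/\ sc s0 vSp = size ns, sc s0 vS = st & sc s0 vK = k].
  by rewrite /s0 /= hsp c1 subn1.
have hc0 := consts_frame hf0 isT (srch_consts hsr).
have := hc0 => -[[d0 d1 d2 d3] _]; have [fs fa fr fp] := hf0.
have hT0 : sc s0 vT = sc s vT by rewrite fs.
have en0 : ents s0 st k = es by rewrite -hes; apply: ents_eq => t _; rewrite /entry !fa.
rewrite /search_value size_rcons -cats1 big_cat big_seq1 /= in hv.
set Phi := \sum_(es' <- ns) node_potential s es' in hv.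
apply: ert_if; rewrite (_ : cond_val _ _ = (1 < k)%N); last by rewrite /cond_val d1 e3.
case: ltnP => k2.
- have hst' : (st + k < lim)%N by clear -htop b2 hT hlim; lia.
  have hTk : (sc s0 vT + k <= lim)%N by rewrite hT0; clear -hT kN hlim; lia.
  have hN0 : (size (slots_of (ents s0 st k)) <= 2 * n)%N by rewrite en0.
  change (ert node_size (ert (Seq (Block [:: AOp WSub vU vTot vOne])
    (Seq (Rand vR vU) after_pivot)) (ert tail (ert search_loop K))) s0
    (v - 1 - 3%:R - 1)).
  apply: (tri_frame (@node_size_spec R lim n hlim s0 st k hc0 e2 e3 hst' hTk hN0)).
  move=> s1 v1 [[t1 t2 t3] hf1] hv1.
  split; first by [].
  set s2 := block_run _ s1; set N := size (slots_of es).
  have hc1 := consts_frame hf1 isT hc0; have := hc1 => -[[g0 g1 g2 g3] _].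
  have kN' : (k <= N)%N by rewrite hk; exact: size_slots_ge hn.
  have eU : sc s2 vU = N.-1 by rewrite /s2 /= t3 en0 g1 subn1.
  have N0 : (N.-1.+1 = N)%N by clear -kN' k2; lia.
  pose g := fun a => (slot s a).1.
  pose G r := good_pivot g (slots_of es) (nth 0%N (slots_of es) r).
  pose q := b / n%:R.
  have q0 : 0 <= q by apply: divr_ge0.
  pose kap := (size es).-1%:R : R.
  (* [A] is the cost if the pivot achieves nothing; a good pivot saves [16 * (kap / 4) * q], hence
     the factor 4 below. *)
  pose A := (search_cost (sc s vT + k) (size O) (size ns + 3))%:R + a + 3 +
    (k * (18 * J + 66) + 60)%:R +
    ((sc s vT + k)%:R + 16 * (Phi + node_potential s es)) * q.
  exists (fun r => A - 4 * kap * q * (G r)%:R); split.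
  + move=> r; rewrite eU => hr; set s3 := set_sc s2 vR r.
    have hf3 : frame [seq (0, u)%N | u <- [:: vSp; vS; vK; vT; vSe; vTot; vU; vR; vE;
        vLo; vHi]] s s3.
      apply: (@frame_trans _ _ _ s0); first by apply: frame_sub hf0 => x; rewrite !inE =>
        /or3P[]/eqP->.
      apply: (@frame_trans _ _ _ s1).
        apply: frame_sub hf1 => x; rewrite !inE.
        by do ! (case/orP; first by move/eqP->); move/eqP->.
      apply: (@frame_trans _ _ _ s2).
        by apply: frame_block => x; rewrite /= inE => /eqP->.
      by apply: (@frame_atom _ _ (ASet vR r)).
    have spec := @split_searching R lim J P hlim m off X s ns es O s3 st k r hsr.
    have k2' : (1 < size es)%N by rewrite -hk.
    have eT3 : sc s3 vT = (sc s vT + k)%N by rewrite /s3 /s2 /= t1 hT0.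
    have [fs1 _ _ _] := hf1.
    have eSp3 : sc s3 vSp = size ns by rewrite /s3 /s2 /= fs1.
    have eS3 : sc s3 vS = st by rewrite /s3 /s2 /= fs1.
    have eSe3 : sc s3 vSe = (st + k)%N by rewrite /s3 /s2 /= t2.
    have hrN : (r < N)%N by clear -hr N0; lia.
    apply: (spec k2' hf3 hT hk eT3 eSp3 eS3 hes htop eSe3 erefl hrN).
    move=> s' v' [ns' [q1 q2 q3 q4 q5]] hv'.
    apply: (finish s' (ns ++ ns') O) => //.
      by left; case: hm => // -[_ /(_ es memlast)]; rewrite leqNgt k2'.
      by rewrite q3 size_cat q2; clear -hmu k2 hT kN; lia.
    apply: le_trans hv'; rewrite /search_value q3 size_cat q2 big_cat /=.
    rewrite (eq_big_seq (node_potential s)) // -/Phi.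
    have : ((sc s vT + k)%:R + 16 * (Phi + \sum_(es' <- ns') node_potential s' es')) * q <=
        ((sc s vT + k)%:R + 16 * (Phi + (node_potential s es - kap / 4 * (G r)%:R))) * q.
      by apply: ler_wpM2r => //; rewrite lerD2l; apply: ler_wpM2l => //; rewrite lerD2l.
    have -> : ((sc s vT + k)%:R + 16 * (Phi + \sum_(es' <- ns') node_potential s' es')) / n%:R * b =
      ((sc s vT + k)%:R + 16 * (Phi + \sum_(es' <- ns') node_potential s' es')) * q.
      by rewrite /q mulrAC mulrA.
    by rewrite /A; clear; lra.
  + rewrite eU N0 sumrB sumr_const card_ord -mulr_sumr.
    have NN : 0 < N%:R :> R by rewrite ltr0n -N0.
    rewrite mulrBl -[A *+ N]mulr_natr mulfK ?gt_eqF //.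
    have hsum := sum_good g (slots_of es); rewrite -/N in hsum.
    have hB : 0 <= 4 * kap * q by apply: mulr_ge0 => //; exact: mulr_ge0.
    have h2 : 2 * kap * q <= 4 * kap * q * (\sum_(i < N) (G i)%:R) / N%:R.
      have hh : 1 / 2 <= (\sum_(i < N) (G i)%:R) / N%:R :> R.
        by rewrite ler_pdivlMr // div1r mulrC.
      have h3 : 4 * kap * q * (1 / 2) <= 4 * kap * q * ((\sum_(i < N) (G i)%:R) / N%:R).
        exact: ler_wpM2l.
      rewrite -[X in _ <= X]mulrA; apply: le_trans h3.
      by rewrite (_ : 2 * kap * q = 4 * kap * q * (1 / 2)) //; field.
    (* As at least half of the pivots are good, the expected saving is at least [2 * (k - 1) * q].
       This pays for the growth of [vT] by [k] because [k >= 2]. *)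
    have hkq : k%:R * q <= 2 * kap * q.
      apply: ler_wpM2r => //; rewrite /kap -hk -natrM ler_nat; clear -k2; lia.
    have hcost : (search_cost (sc s vT + k) (size O) (size ns + 3) + 3 +
        (k * (18 * J + 66) + 60) + 7 + (8 * k + 8) <=
        search_cost (sc s vT) (size O) (size ns).+1)%N.
      have h3 : (3 * n - sc s vT = 3 * n - (sc s vT + k) + k)%N by clear -hT kN; lia.
      rewrite /search_cost h3; clear -k2; nia.
    have hv2 : (search_cost (sc s vT) (size O) (size ns).+1)%:R + a +
      ((sc s vT)%:R + 16 * (Phi + node_potential s es)) * q <= v.
      by apply: le_trans hv; rewrite lerD2l /q mulrA [X in _ <= X]mulrAC.
    move: hv1 hcost hv2; rewrite /A; set C1 := search_cost _ _ (_ + 3); set C2 := search_cost _ _ _.+1.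
    clearbody C1 C2; move=> hv1; rewrite -(ler_nat R) !natrD => hcost hv2; move: hv1 h2 hkq.
    rewrite !natrD; set y := _ * _ / N%:R; clearbody y; rewrite /=; clear -hcost hv2; lra.
- apply: ert_if; rewrite (_ : cond_val _ _ = (0 < k)%N); last by rewrite /cond_val d3 e3.
  have hpot0 : node_potential s es = 0.
    rewrite !node_potentialE /potential -hk.
    by have -> : (k.-1 = 0)%N by [clear -k2; lia]; rewrite mul0r.
  rewrite hpot0 addr0 in hv.
  case: ltnP => k0.
    have k1 : k = 1%N by clear -k2 k0; lia.
    have : size es = 1%N by rewrite -hk.
    case ees : es => [|[lo hi] [|//]] // _.
    have hE : entry s st = (lo, hi).
      by move: hes; rewrite k1 ees /ents /= => -[h1 h2]; rewrite /entry h1 h2.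
    rewrite ees in hsr.
    have hlS : (sc s0 vS <= lim)%N by rewrite e2; clear -htop b2 hT hlim; lia.
    rewrite -e2 in hE.
    apply: (@emit_searching R lim J P hlim m off X s ns lo hi O s0 hsr hf0 e1 hE hlS).
    move=> s' v' [L1 [q1 q2 q3 q4]] hv'.
    apply: (finish s' ns L1) => //.
      by case: hm => [|[h1 h2]]; [left|right; rewrite q3; split=> // es' /memns /h2].
      by rewrite q3; clear -hmu; lia.
    rewrite /search_value q3 (eq_big_seq (node_potential s)) // -/Phi.
    have hL1 : (size L1 <= n)%N.
      by have := srch_count q1; apply: leq_trans; exact: leq_addr.
    have hcost : (search_cost (sc s vT) (size L1) (size ns) + 3 + (8 * (hi - lo) + 6) + 6 <=
      search_cost (sc s vT) (size O) (size ns).+1)%N.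
      by rewrite /search_cost; clear -hL1 q2; nia.
    move: hv hcost; set C1 := search_cost _ _ (size ns); set C2 := search_cost _ _ _.+1.
    clearbody C1 C2; move=> hv; rewrite -(ler_nat R) !natrD => hcost.
    by move: hv' hv; rewrite !natrD /=; lra.
  have es0 : es = [::] by apply: size0nil; rewrite -hk; clear -k0; lia.
  rewrite es0 in hsr.
  have [h1 h2] := drop_searching hsr hf0 e1.
  split; first by [].
  apply: (finish s0 ns O) => //.
    by case: hm => [|[h3 h4]]; [left|right; rewrite hT0; split=> // es' /memns /h4].
    by rewrite hT0; clear -hmu; lia.
  rewrite /search_value hT0 (eq_bigr (node_potential s)) // -/Phi.
  have hcost : (search_cost (sc s vT) (size O) (size ns) + 3 + 6 <=
      search_cost (sc s vT) (size O) (size ns).+1)%N by rewrite /search_cost; clear; lia.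
  move: hv hcost; set C1 := search_cost _ _ (size ns); set C2 := search_cost _ _ _.+1.
  clearbody C1 C2; move=> hv; rewrite -(ler_nat R) !natrD => hcost.
  by move: hv; rewrite /=; lra.
Qed.

End SearchLoop.

(** * Phases *)

Section Root.
Variables (R : realType) (lim : nat) (P : seq (R * R)).
Let n := size P.
Hypothesis hlim : (64 * n + 64 <= lim)%N.
Local Notation tri := (@tri R lim).
Local Notation consts := (@consts R n).
Local Notation ents := (@ents R).
Local Notation S := (nth (0, 0) P).
Local Notation blocks := (@blocks R n S).

Lemma init_search_spec s : consts s -> (sc s vM <= n)%N ->
  (forall b, (b <= sc s vM)%N -> (ar s aOff b <= lim)%N) ->
  tri init_search s (10 * n + 20) (fun s' =>
    [/\ consts s', slot s' = slot s, sc s' vM = sc s vM /\ ar s' aOff = ar s aOff,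
      [/\ sc s' vSp = 1%N, sc s' vT = 0%N, sc s' vTop = sc s vM, sc s' vOut = (3 * n)%N &
        sc s' vGo = 1%N] &
      [/\ ar s' aStart 0 = 0%N, ar s' aCount 0 = sc s vM &
        ents s' 0 (sc s vM) = [seq (ar s aOff b, ar s aOff b.+1) | b <- iota 0 (sc s vM)]]]).
Proof.
set m := sc s vM; set off := ar s aOff => hc mn hoff.
have := hc => -[[c0 c1 c2 c3] [c4 c5]].
apply: tri_block_seq => //=; first by rewrite addn_gt0 orbT.
pose I s' := [/\ slot s' = slot s, ar s' aOff = off, (sc s' vE <= m)%N &
  forall b, (b < sc s' vE)%N -> entry s' b = (off b, off b.+1)].
apply: (@tri_seq _ _ _ _ _ (7 * m + 1) 10 _
  (fun s' => I s' /\ sc s' vE = m)); last by clear -mn; lia.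
  apply: (@tri_for _ _ I (fun s' => (m - sc s' vE)%N) 6).
  - move=> s1 [k1 k2 k3 k4] hf; have [fs _ _ _] := hf.
    have [e0 e1 e3] : [/\ sc s1 vM = m, sc s1 vOne = 1%N & sc s1 vZero = 0%N].
      by rewrite !fs /= ?c1 ?c3.
    rewrite /= e0 => hlt; apply: tri_block => //=; rewrite ?e1 ?e3 ?addn0 ?addn1.
      by clear -hlt mn hlim; do !split; lia.
    split; last by clear -hlt; lia.
    split=> //= b; rewrite ltnS leq_eqVlt /entry /= => /orP[/eqP->|hb].
      by rewrite eqxx k2.
    by rewrite [(b == _)%N]ltn_eqF //; exact: k4.
  - move=> s1 [k1 k2 k3 k4] hf; have [fs _ _ _] := hf.
    have e0 : sc s1 vM = m by rewrite fs.
    rewrite /= e0 => hge; have e : sc s1 vE = m by clear -hge k3; lia.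
    by split; first split.
  - by split.
  - by rewrite /=; clear; lia.
move=> s1 [[k1 k2 k3 k4] kE] hf; have [fs fa fr fp] := hf.
have hc1 : consts s1 by exact: (consts_frame hf isT (s := set_sc s vE 0)).
have eM : sc s1 vM = m by rewrite fs.
have := hc1 => -[[d0 d1 d2 d3] [d4 d5]].
apply: tri_block => //=; rewrite ?eM d3 ?addn0.
  by clear -hlim mn d5; do !split; lia.
split=> //=.
split=> //=; apply/eq_in_map => b; rewrite mem_iota add0n => /andP[_ hb].
by rewrite -(k4 b) // kE.
Qed.

Hypothesis gp : general_position P.

Lemma distinct_points i k : (i < n)%N -> (k < n)%N -> i != k ->
  (S i).1 != (S k).1 /\ (S i).2 != (S k).2.
Proof.
move=> hi hk ik; have /andP[u1 u2] := gp; split.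
  by rewrite -!(nth_map (0, 0) 0 fst) // nth_uniq ?size_map.
by rewrite -!(nth_map (0, 0) 0 snd) // nth_uniq ?size_map.
Qed.

(** Descent on the number of points that dominate [p]: those dominating [q] also dominate [p], and
    [q] itself is lost. *)
Lemma dominated_by_front p : dominated P p ->
  exists q, [/\ q \in P, ~~ dominated P q, p.1 < q.1 & p.2 < q.2].
Proof.
pose D (q : R * R) := fun q' : R * R => (q.1 < q'.1) && (q.2 < q'.2).
elim: {p}(count (D p) P).+1 {-2}p (ltnSn (count (D p) P)) => // k IH p hk.
move=> /hasP[q qP /andP[x y]].
have [dq|nq] := boolP (dominated P q); last by exists q.
have [|q' [h1 h2 h3 h4]] := IH q _ dq; last first.
  by exists q'; split=> //; [exact: lt_trans h3|exact: lt_trans h4].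
rewrite ltnS in hk; apply: leq_trans hk.
have h0 : count (predI (D q) (pred1 q)) P = 0%N.
  by apply/eqP; rewrite -leqn0 leqNgt -has_count; apply/hasP => -[q' _ /andP[/andP[h _] /eqP e]];
    rewrite e ltxx in h.
have hq : (0 < count (pred1 q) P)%N by rewrite -has_count has_pred1.
have hs : (count (predU (D q) (pred1 q)) P <= count (D p) P)%N.
  apply: sub_count => q' /orP[/andP[a b]|/eqP->]; last by rewrite /D x.
  by rewrite /D (lt_trans x a) (lt_trans y b).
have := count_predUI (D q) (pred1 q) P; rewrite h0 addn0 => e.
by apply: leq_trans hs; rewrite e -addn1 leq_add2l.
Qed.

Hypothesis promise : pareto_promise P.
Variables (J m : nat) (off : nat -> nat) (s : state R).
Hypothesis hbl : blocks J m off (slot s).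
Let n_gt0 : (0 < n)%N.
Proof. by case/andP: (blocks_gt0 hbl) => h; exact: leq_trans. Qed.
Let root := [seq (off b, off b.+1) | b <- iota 0 m].

Local Notation front := (@front R P).

Lemma slots_of_root : slots_of root = iota n (off m - n).
Proof.
rewrite /root; have : (m <= m)%N by [].
elim: {-2}m => [|b IH] hb; first by rewrite (blocks_start hbl) subnn.
have h1 : (n <= off b)%N by rewrite -(blocks_start hbl); apply: (blocks_mono hbl) => //; exact: ltnW.
have h2 : (off b <= off b.+1)%N by apply: (blocks_mono hbl).
rewrite -addn1 iotaD map_cat slots_of_cat IH; last exact: ltnW.
rewrite /slots_of /= cats0 add0n addn1.
have -> : (off b.+1 - n = (off b - n) + (off b.+1 - off b))%N by clear -h1 h2; lia.
by rewrite iotaD subnKC.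
Qed.

Lemma root_block a : a \in slots_of root ->
  exists2 b, (b < m)%N & (off b <= a < off b.+1)%N.
Proof.
case/slots_ofP=> b; rewrite size_map size_iota => -[hb].
by rewrite (nth_map 0%N) ?size_iota // nth_iota //; exists b.
Qed.

Lemma block_sub b a : (b < m)%N -> (off b <= a < off b.+1)%N -> a \in slots_of root.
Proof.
move=> hb ha; apply/slots_ofP; exists b; rewrite size_map size_iota; split=> //.
by rewrite (nth_map 0%N) ?size_iota // nth_iota.
Qed.

Lemma block_lt b : (b < m)%N -> (b * 2 ^ J < n)%N.
Proof.
move=> hb; have /andP[+ _] := blocks_index hbl; apply: leq_ltn_trans.
by rewrite leq_pmul2r ?expn_gt0 //; clear -hb; lia.
Qed.

Lemma root_point b a : (b < m)%N -> (off b <= a < off b.+1)%N ->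
  exists i, [/\ (b * 2 ^ J <= i < b.+1 * 2 ^ J)%N, (i < n)%N & slot s a = S i].
Proof.
move=> hb ha; have [_ h _] := blocks_stair hbl hb.
rewrite (minn_idPl (ltnW (block_lt hb))) in h.
have [i [/andP[h1 h2] ->]] := h a ha; rewrite leq_min in h2; have /andP[h3 h4] := h2.
by exists i; rewrite h1 h3.
Qed.

Lemma root_src a : a \in slots_of root -> slot s a \in P.
Proof.
by move=> /root_block[b hb /(root_point hb)[i [_ hi ->]]]; exact: mem_nth.
Qed.

Lemma root_distinct a a' : a \in slots_of root -> a' \in slots_of root -> a != a' ->
  (slot s a).1 != (slot s a').1 /\ (slot s a).2 != (slot s a').2.
Proof.
move=> /root_block[b hb ha] /root_block[b' hb' ha'] aa'.
have [e|ne] := eqVneq b b'.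
  rewrite -{b'}e in hb' ha'; have [st _ _] := blocks_stair hbl hb.
  have /andP[l1 u1] := ha; have /andP[l2 u2] := ha'.
  case: (ltngtP a a') aa' => // lt _.
    by have [k1 k2] := st a a' l1 lt u2; rewrite gt_eqF // lt_eqF.
  by have [k1 k2] := st a' a l2 lt u1; rewrite lt_eqF // gt_eqF.
have [i [/andP[i1 i2] hi ->]] := root_point hb ha.
have [i' [/andP[i1' i2'] hi' ->]] := root_point hb' ha'.
apply: distinct_points => //; apply/negP => /eqP e; rewrite -{i'}e in i1' i2' hi'.
have disj c c' k : (c < c')%N -> (k < c.+1 * 2 ^ J)%N -> (c' * 2 ^ J <= k)%N -> False.
  move=> cc' h1 h2; have h3 : (c.+1 * 2 ^ J <= c' * 2 ^ J)%N by rewrite leq_pmul2r ?expn_gt0.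
  by have := leq_trans h1 (leq_trans h3 h2); rewrite ltnn.
by case: (ltngtP b b') ne => // lt _; [apply: (disj b b' i)|apply: (disj b' b i)].
Qed.

(** The block of a front point contains a point at least as large in both coordinates; by general
    position, any point other than itself would dominate it. *)
Lemma root_cover q : q \in P -> ~~ dominated P q ->
  exists2 a, a \in slots_of root & slot s a = q.
Proof.
move=> /(nthP (0, 0))[i hi <-] nd; rewrite -/n in hi.
have /andP[_ hm] := blocks_index hbl.
have hb : (i %/ 2 ^ J < m)%N by rewrite ltn_divLR ?expn_gt0 //; exact: leq_trans hm.
have [_ _ h] := blocks_stair hbl hb.
rewrite (minn_idPl (ltnW (block_lt hb))) in h.
have [|a [ha [b1 b2]]] := h i.
  by rewrite leq_divM leq_min hi andbT ltn_ceil ?expn_gt0.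
exists a; first exact: block_sub ha.
have [j [_ hj e]] := root_point hb ha; rewrite e in b1 b2 *.
have [->//|ij] := eqVneq i j; case/negP: nd.
apply/hasP; exists (S j); first exact: mem_nth.
have [n1 n2] := distinct_points hi hj ij.
by rewrite !lt_neqAle b1 b2 n1 n2.
Qed.

Lemma root_valid e : e \in root -> valid_entry n J s e.
Proof.
case/mapP=> b; rewrite mem_iota add0n => /andP[_ hb] ->.
have [st _ h] := blocks_stair hbl hb; have /andP[h1 h2] := blocks_size hbl hb.
rewrite (minn_idPl (ltnW (block_lt hb))) in h.
have [|a [/andP[ha1 ha2] _]] := h (b * 2 ^ J)%N.
  by rewrite leqnn leq_min ltn_pmul2r ?expn_gt0 // ltnS leqnn block_lt.
split=> //=; first exact: leq_ltn_trans ha2.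
  by apply: leq_trans (blocks_end hbl); apply: (blocks_mono hbl).
by rewrite leq_subLR.
Qed.

(** The promise enters here, through [node_ordered]: front points of different blocks are ordered
    like their indices. [node_closed] holds since the blocks still contain the whole front. *)
Lemma root_node : node (slot s) (front s) root.
Proof.
split.
- by move=> e /root_valid[].
- exact: root_distinct.
- by rewrite slots_of_root iota_uniq.
- move=> a b ha hb fa [h1 h2]; case/negP: fa; apply/hasP; exists (slot s b).
    exact: root_src.
  by rewrite h1 h2.
- move=> a ha; rewrite negbK => /dominated_by_front[q [qP nq h1 h2]].
  by have [b hb e] := root_cover qP nq; exists b; rewrite /front e.
- rewrite /ordered pairwise_map; apply/(pairwiseP 0%N) => b b'.
  rewrite !inE size_iota => hb hb' bb'; rewrite !nth_iota //=; apply/asboolP => a a' ha ha' fa fa'.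
  have [i [/andP[i1 i2] hi e]] := root_point hb ha.
  have [i' [/andP[i1' i2'] hi' e']] := root_point hb' ha'.
  rewrite /front e in fa; rewrite /front e' in fa'.
  suff: (S i).1 < (S i').1 by rewrite -e -e'.
  have mf k : (k < n)%N -> ~~ dominated P (S k) -> S k \in pareto_front P.
    by move=> hk fk; rewrite mem_sort mem_filter fk mem_nth.
  apply/(promise hi hi' (mf i hi fa) (mf i' hi' fa')).
  apply: leq_trans i2 (leq_trans _ i1'); by rewrite leq_pmul2r ?expn_gt0.
Qed.

Lemma root_count : (count (front s) (slots_of root) <= size (pareto_front P))%N.
Proof.
rewrite -size_filter -(size_map (slot s)); apply: uniq_leq_size.
  rewrite map_inj_in_uniq ?filter_uniq ?slots_of_root ?iota_uniq // => a a'.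
  rewrite !mem_filter -slots_of_root => /andP[_ ha] /andP[_ ha'] e.
  by apply/eqP; apply/negP => /negP/(root_distinct ha ha')[]; rewrite e eqxx.
move=> q /mapP[a]; rewrite mem_filter => /andP[fa ha] ->.
by rewrite mem_sort mem_filter (root_src ha) andbT.
Qed.

(** Put [x = n / 2 ^ J], so that [k <= x] for the excess [k], and write [h * n / k] as
    [h * 2 ^ J * (x / k)]. The last factor contributes [k * ln (x / k) <= x - k], and [ln 2 <= 1]
    bounds the logarithm of [2 ^ J] by [J]. *)
Lemma root_potential : node_potential P s root <=
  n%:R / 2 ^+ J * (2 + ln (size (pareto_front P))%:R + J%:R).
Proof.
rewrite node_potentialE size_map size_iota slots_of_root size_iota.
set h := size _; set k := m.-1; set N := (off m - n)%N; set c := count _ _.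
have ch : (c <= h)%N by rewrite /c -slots_of_root; exact: root_count.
have Nn : (N <= n)%N by rewrite leq_subLR addnn -mul2n; exact: (blocks_end hbl).
have lnh : 0 <= ln h%:R :> R.
  by case: (h) => [|h']; [rewrite ln0|apply: ln_ge0; rewrite ler1n].
have p2 : 0 < 2 ^+ J :> R by exact: exprn_gt0.
pose x : R := n%:R / 2 ^+ J; rewrite -/x.
have x0 : 0 <= x by apply: divr_ge0 => //; exact: ltW.
have J0 : 0 <= J%:R :> R by [].
have [k0|k_gt0] := posnP k.
  by rewrite /potential k0 mul0r; apply: mulr_ge0 => //; lra.
have c0 : (0 < c)%N.
  rewrite /c -slots_of_root; apply: (node_front_gt0 root_node).
  by rewrite size_map size_iota; clear -k_gt0; lia.
have N0 : (0 < N)%N.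
  by rewrite -(size_iota n N) -slots_of_root -/N; apply: leq_trans c0 _; rewrite /c -slots_of_root count_size.
have kx : k%:R <= x.
  rewrite /x ler_pdivlMr // -natrX -natrM ler_nat; apply: ltnW.
  by have /andP[] := blocks_index hbl.
have kR : 0 < k%:R :> R by rewrite ltr0n.
have cR : 0 < c%:R :> R by rewrite ltr0n.
have hR : 0 < h%:R :> R by rewrite ltr0n (leq_trans c0).
have NR : 0 < N%:R :> R by rewrite ltr0n.
have xR : 0 < x by exact: lt_le_trans kx.
have l1 : ln (c%:R * N%:R / k%:R) <= ln (h%:R * 2 ^+ J * (x / k%:R)) :> R.
  rewrite ler_ln ?posrE; last 2 first.
  - by apply: divr_gt0 => //; exact: mulr_gt0.
  - by apply: mulr_gt0; [exact: mulr_gt0|exact: divr_gt0].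
  have -> : h%:R * 2 ^+ J * (x / k%:R) = h%:R * n%:R / k%:R :> R.
    by rewrite /x; field; rewrite !gt_eqF.
  by rewrite ler_pM2r ?invr_gt0 // -!natrM ler_nat leq_mul.
have l2 : ln (x / k%:R) <= x / k%:R - 1 by apply: ln_le_sub1; exact: divr_gt0.
have l3 : ln (2 : R) <= 2 - 1 by apply: ln_le_sub1.
have e1 : ln (h%:R * 2 ^+ J * (x / k%:R)) = ln h%:R + ln 2 * J%:R + ln (x / k%:R) :> R.
  rewrite lnM ?posrE; [|exact: mulr_gt0|exact: divr_gt0].
  by rewrite lnM ?posrE // lnXn // mulr_natr.
have l4 : ln (2 : R) * J%:R <= J%:R by rewrite -[X in _ <= X]mul1r; apply: ler_wpM2r => //; lra.
have l5 : ln (c%:R * N%:R / k%:R) <= ln h%:R + J%:R + (x / k%:R - 1) :> R.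
  apply: (le_trans l1); rewrite e1; apply: lerD => //; exact: lerD.
rewrite /potential; apply: (@le_trans _ _ (k%:R * (1 + ln h%:R + J%:R) + x)).
  have : k%:R * (2 + ln (c%:R * N%:R / k%:R)) <= k%:R * (2 + (ln h%:R + J%:R + (x / k%:R - 1))).
    by apply: ler_wpM2l; [exact: ltW|rewrite lerD2l].
  have -> : k%:R * (2 + (ln h%:R + J%:R + (x / k%:R - 1))) = k%:R * (1 + ln h%:R + J%:R) + x.
    by field; rewrite gt_eqF.
  by [].
have : k%:R * (1 + ln h%:R + J%:R) <= x * (1 + ln h%:R + J%:R) by apply: ler_wpM2r => //; lra.
by lra.
Qed.

Lemma root_searching : consts s -> sc s vM = m -> ar s aOff = off ->
  sc s vSp = 1%N -> sc s vT = 0%N -> sc s vTop = m -> sc s vOut = (3 * n)%N ->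
  ar s aStart 0 = 0%N -> ar s aCount 0 = m -> ents s 0 m = root ->
  searching J P m off (slot s) s [:: root] [::].
Proof.
move=> hc hM hO hSp hT hTop hOut hS hC hE.
have sub a : [:: root] = [:: a] -> a = root by case.
split=> //.
- by split=> //= -[|//] _; rewrite hS hC hTop hE.
- by move=> es; rewrite inE => /eqP->; exact: root_node.
- by move=> es e; rewrite inE => /eqP->; exact: root_valid.
- by rewrite addn0.
- by rewrite hT hTop; split=> //; rewrite addn0; case/andP: (blocks_gt0 hbl).
- rewrite big_seq1 add0n; apply: leq_trans (count_size _ _) _.
  by rewrite slots_of_root size_iota leq_subLR addnn -mul2n; exact: (blocks_end hbl).
- move=> q qP nq; right; have [a ha e] := root_cover qP nq.
  by exists root, a; rewrite mem_head.
- by move=> es a; rewrite inE => /eqP->; exact: root_src.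
Qed.
End Root.

Lemma blocks_ext (R : realType) n (S : nat -> R * R) J m off X X' :
  (forall p, (p < 2 * n)%N -> X' p = X p) -> blocks n S J m off X -> blocks n S J m off X'.
Proof.
move=> e h; have [h1 h2 h3 h4 h5 h6] := h; split=> // b hb.
apply: stair_of_ext (h6 b hb) _ => a /andP[_ ha]; apply: e.
by apply: leq_trans ha (leq_trans (blocks_mono h hb (leqnn m)) h4).
Qed.

(** * Expected cost of all phases together *)

Section Phases.
Variables (R : realType) (lim : nat) (P : seq (R * R)).
Let n := size P.
Hypothesis hlim : (64 * n + 64 <= lim)%N.
Hypothesis n_gt0 : (0 < n)%N.
Hypothesis gp : general_position P.
Hypothesis promise : pareto_promise P.
Local Notation ert := (@ert R lim).
Local Notation consts := (@consts R n).
Local Notation blocks := (@blocks R n (nth (0, 0) P)).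
Variables (K : state R -> R -> Prop) (a : R) (c j0 : nat).
Hypothesis a_ge0 : 0 <= a.
Hypothesis K_end : forall J m off X s v O, searching J P m off X s [::] O -> a <= v -> K s v.
(* From phase j0 on, a search fails with probability at most 1/4. *)
Hypothesis j0_large : forall J, (j0 <= J)%N ->
  32 * (3 + J%:R + ln (size (pareto_front P))%:R) <= 2 ^+ J :> R.

Hypothesis phase_cost : forall J, (82 * n + 33 + search_cost J.+1 P 0 0 1 <= c * J.+1)%N.

(* The phases before j0 are allowed to fail with certainty; after that, the
   costs are dominated by a geometric series. *)
Definition phase_weight (J : nat) : nat := (2 * (maxn J j0).+1 + (j0 - J) * j0.+1)%N.

Definition phase_bound (J : nat) : R := 2 * (a + 1) + c%:R * (phase_weight J)%:R.

Lemma phase_bound_ge J : a + 1 <= phase_bound J.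
Proof.
have h : 0 <= c%:R * (phase_weight J)%:R :> R by exact: mulr_ge0.
by rewrite /phase_bound; have a0 := a_ge0; lra.
Qed.

(** [a'] is the cost after a successful search, [b] the surcharge for a failure and [p] the bound on
    its probability. The unit in [a + 1] pays for the last test of the outer loop. *)
Lemma phase_bound_step J p : 0 <= p ->
  p <= 16 * (2 + ln (size (pareto_front P))%:R + J.+1%:R) / 2 ^+ J.+1 ->
  exists a' b : R, [/\ a + 1 <= a', 0 <= b, phase_bound J.+1 <= a' + b &
    (c * J.+1)%:R + a' + p * b <= phase_bound J].
Proof.
move=> p0 hp; have hb := phase_bound_ge J.+1; have a0 := a_ge0.
(* Before phase [j0], success is charged as much as failure, so [b = 0] and [p] may be arbitrary. *)
have [jJ|Jj] := leqP j0 J; last first.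
  exists (phase_bound J.+1), 0; split=> //; first by rewrite addr0.
  rewrite mulr0 addr0 /phase_bound.
  have -> : (phase_weight J = phase_weight J.+1 + j0.+1)%N.
    by rewrite /phase_weight; clear -Jj; nia.
  have : (c * J.+1)%:R <= c%:R * j0.+1%:R :> R by rewrite -natrM ler_nat leq_mul // ltnS ltnW.
  by rewrite natrD mulrDr; lra.
exists (a + 1), (phase_bound J.+1); split=> //; first lra.
  by lra.
(* The constant 32 of [j0_large] is 16 * 4 / 2: the factor 16 of the bound on [p], the desired 1/4,
   and [2 ^+ J.+1] being twice [2 ^+ J]. *)
have hp4 : p <= 1 / 4.
  apply: (le_trans hp); rewrite ler_pdivrMr ?exprn_gt0 //.
  by have := j0_large jJ; rewrite exprS -natr1; lra.
have : p * phase_bound J.+1 <= 1 / 4 * phase_bound J.+1.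
  by apply: ler_wpM2r => //; lra.
rewrite /phase_bound.
have -> : (phase_weight J = 2 * J.+1)%N by rewrite /phase_weight; clear -jJ; nia.
have -> : (phase_weight J.+1 = 2 * J.+2)%N by rewrite /phase_weight; clear -jJ; nia.
have e1 : c%:R * (2 * J.+1)%:R = 2 * (c * J.+1)%:R :> R.
  by rewrite !natrM; ring.
have e2 : c%:R * (2 * J.+2)%:R = 2 * (c * J.+2)%:R :> R.
  by rewrite !natrM; ring.
rewrite e1 e2; have : (c * J.+2)%:R <= 2 * (c * J.+1)%:R :> R.
  by rewrite -natrM ler_nat; clear; nia.
by lra.
Qed.

(** Termination is certain, not only almost sure: a search can fail only with more than one block,
    and then the number of blocks, bounded by [M], has decreased in the merge pass. *)
Lemma phases_value M J s v : consts s -> blocks J (sc s vM) (ar s aOff) (slot s) ->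
  (0 < sc s vSp)%N -> (sc s vM <= M)%N -> phase_bound J <= v -> ert phases K s v.
Proof.
elim: M J s v => [|M IH] J s v hc hbl hsp hM hv.
  by have /andP[] := blocks_gt0 hbl; rewrite lt0n -leqn0 hM.
apply: ert_while_unfold; have := hc => -[[c0 c1 c2 c3] _].
rewrite [cond_val _ _]/= c3 hsp.
change (ert merge_pass (ert init_search (ert search_loop (ert phases K))) s (v - 1)).
have dist := distinct_points gp.
apply: (tri_frame (@merge_pass_spec R lim n (nth (0, 0) P) hlim dist s J hc hbl)).
move=> s1 v1 [[hbl1 hlt] hf1] hv1; have hc1 := consts_frame hf1 isT hc.
have /andP[m0 mn] := blocks_gt0 hbl1.
have hoff b : (b <= sc s1 vM)%N -> (ar s1 aOff b <= lim)%N.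
  move=> hb; have h1 := blocks_mono hbl1 hb (leqnn _); have h2 := blocks_end hbl1.
  by apply: leq_trans h1 (leq_trans h2 _); clear -hlim; lia.
apply: (@init_search_spec R lim P hlim s1 hc1 mn hoff).
move=> s2 v2 [hc2 sl2 [hM2 ho2] [k1 k2 k3 k4 k5] [k6 k7 k8]] hv2.
rewrite -hM2 in k3 k7 k8 hbl1 hlt m0 mn; rewrite -ho2 in k8 hbl1.
have hbl2 : blocks J.+1 (sc s2 vM) (ar s2 aOff) (slot s2) by rewrite sl2.
set root := map _ _ in k8.
have hsr : searching J.+1 P (sc s2 vM) (ar s2 aOff) (slot s2) s2 [:: root] [::].
  by apply: root_searching.
have hphi : node_potential P s2 root <= _ := root_potential gp promise hbl2.
have hphi0 : 0 <= node_potential P s2 root.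
  by apply: node_potential_ge0; apply: (srch_node hsr); rewrite mem_head.
have nR : 0 < n%:R :> R by rewrite ltr0n.
pose p := 16 * node_potential P s2 root / n%:R.
have p0 : 0 <= p by apply: divr_ge0 => //; exact: mulr_ge0.
have hp : p <= 16 * (2 + ln (size (pareto_front P))%:R + J.+1%:R) / 2 ^+ J.+1.
  rewrite /p ler_pdivrMr //.
  rewrite [X in _ <= X](_ : _ = 16 * (n%:R / 2 ^+ J.+1 * (2 + ln (size (pareto_front P))%:R + J.+1%:R))).
    exact: ler_wpM2l.
  by set x := _^-1; set y := ln _; set z := J.+1%:R; ring.
have [a' [b [ha hb hab hstep]]] := phase_bound_step p0 hp.
have a0 := a_ge0.
apply: (@search_loop_value R lim J.+1 P hlim n_gt0 (sc s2 vM) (ar s2 aOff) (slot s2)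
  (ert phases K) a' b _ hb _ _ (3 * (3 * n) + 1) s2 [:: root] [::]) => //.
- by lra.
- move=> s' v' O h hv'; apply: ert_while_unfold.
  have := srch_consts h => -[[_ _ _ d3] _]; have [hS _] := srch_stack h.
  rewrite [cond_val _ _]/= d3 hS /=; apply: (K_end h); lra.
- move=> s' v' ns O h hns hm hv'; have [e1 e2 e3] := srch_blocks h.
  have [hS _] := srch_stack h.
  apply: (IH J.+1) => //.
  + exact: srch_consts h.
  + by rewrite e1 e2; apply: blocks_ext hbl2.
  + by rewrite hS.
  + rewrite e1 -ltnS; apply: leq_trans hM; apply: hlt.
    have /andP[h1 _] := blocks_index hbl2; have /andP[_ h2] := blocks_index hbl.
    rewrite ltnNge; apply/negP => h3; have := leq_trans h1 h2; apply/negP; rewrite -leqNgt.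
    apply: (@leq_trans (1 * 2 ^ J)); first by rewrite leq_pmul2r ?expn_gt0.
    by rewrite leq_mul ?leq_pexp2l // -ltnS prednK.
  + exact: le_trans hv'.
- by rewrite k2 subn0.
- have [hm|hm] := ltnP 1 (sc s2 vM); first by left.
  by right; split=> // es; rewrite inE => /eqP->; rewrite size_map size_iota.
- by rewrite k2.
- rewrite /search_value k2 big_seq1 add0r -/n -/p.
  have : (72 * n + 10 + (10 * n + 20) + 3 + search_cost J.+1 P 0 0 1 <= c * J.+1)%N.
    by apply: leq_trans (phase_cost J); rewrite leq_add2r; clear; lia.
  move: hv1 hv2 hv hstep; set T := search_cost _ _ _ _ _; set t1 := (72 * n + 10)%N.
  set t2 := (10 * n + 20)%N; set C := (c * J.+1)%N; clearbody T t1 t2 C p.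
  move=> hv1 hv2 hv hstep; rewrite -(ler_nat R) !natrD; lra.
Qed.

End Phases.

(** * The whole algorithm *)

Section Main.
Variables (R : realType) (lim : nat) (P : seq (R * R)).
Let n := size P.
Hypothesis hlim : (64 * n + 64 <= lim)%N.
Local Notation tri := (@tri R lim).
Local Notation ert := (@ert R lim).
Local Notation consts := (@consts R n).

Definition written (O : seq (R * R)) (s : state R) : Prop :=
  [/\ sc s vN = size O,
    forall i, (i < 4)%N -> (i < size O)%N ->
      (rg s (2 * i)%N, rg s (2 * i).+1) = nth (0, 0) O i &
    forall i, (4 <= i < size O)%N -> slot s (i - 4) = nth (0, 0) O i].

Lemma write_output_spec s (O : seq (R * R)) : consts s -> (size O <= n)%N ->
  sc s vOut = (3 * n + size O)%N ->
  (forall t, (t < size O)%N -> slot s (3 * n + t) = nth (0, 0) O t) ->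
  tri write_output s (10 * n + 30) (written O).
Proof.
move=> hc hOn hOut hO; have := hc => -[[c0 c1 c2 c3] [c4 c5]].
apply: tri_block_seq => //=; first by rewrite c3 addn0 hOut c5; clear -hlim hOn; do !split; lia.
  by clear; lia.
rewrite hOut c5 c3 addn0 addKn.
set s0 := set_sc _ _ _.
pose I s' := [/\ consts s', sc s' vM = size O, (4 <= sc s' vI)%N,
  forall t, (t < size O)%N -> slot s' (3 * n + t) = nth (0, 0) O t &
  forall i, (4 <= i < sc s' vI)%N -> (i < size O)%N -> slot s' (i - 4) = nth (0, 0) O i].
apply: (@tri_seq _ _ _ _ _ (9 * n + 2) 13 _ (fun s' => I s' /\ (size O <= sc s' vI)%N));
  last by clear; lia.
  apply: (@tri_for _ _ I (fun s' => (size O - sc s' vI)%N) 8).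
  - move=> s1 [hc1 h2 h3 h4 h5] _; have := hc1 => -[[d0 d1 d2 d3] [d4 d5]].
    rewrite /= h2 => hlt; apply: tri_block => //=; rewrite ?d1 ?d5.
      by clear -hlt hlim hOn; do !split; lia.
    split; last by clear -hlt; lia.
    split=> //=.
    + by rewrite addn1 ltnW.
    + move=> t ht; rewrite /slot /=; case: eqP => [e|_]; last exact: h4.
      by exfalso; clear -e hlt hOn; lia.
    + move=> i hi1 hi2; rewrite /slot /=; case: eqP => [e|ne].
        have -> : i = sc s1 vI by clear -e hi1 h3; lia.
        by rewrite -[RHS]h4 // ?d5.
      by apply: h5 => //; clear -hi1 ne; lia.
  - move=> s1 h _; have [_ h2 _ _ _] := h; rewrite /= h2 -leqNgt => hge; by split.
  - by split=> // i; rewrite /=; clear; lia.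
  - by rewrite /=; clear -hOn; lia.
move=> s1 [[hc1 h2 h3 h4 h5] hge] _; have := hc1 => -[[d0 d1 d2 d3] [d4 d5]].
apply: tri_block => //=; rewrite ?d1 ?d3 ?d5 ?addn0.
  by rewrite h2; clear -hlim hOn; do !split; lia.
split=> //=.
- move=> i hi hiO; rewrite -h4 //.
  by case: i hi hiO => [|[|[|[|//]]]] _ _; rewrite /slot ?addn0 ?addn2 ?addn3 ?addn1 /= ?addn1 ?addn1.
- by move=> i hi; apply: h5; clear -hi hge; lia.
Qed.

(** General position makes the front strictly sorted, and strictly sorted lists with the same
    elements coincide. *)
Lemma pareto_frontP (O : seq (R * R)) : general_position P ->
  sorted (fun p q : R * R => p.1 < q.1) O ->
  (forall q, q \in P -> ~~ dominated P q -> q \in O) ->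
  (forall q, q \in O -> q \in P /\ ~~ dominated P q) -> O = pareto_front P.
Proof.
move=> gp hs h1 h2; apply: (@irr_sorted_eq _ (fun p q : R * R => p.1 < q.1)) => //.
- by move=> p q r; exact: lt_trans.
- suff: sorted <%R (map fst (pareto_front P)) by rewrite sorted_map.
  rewrite lt_sorted_uniq_le; apply/andP; split.
    rewrite (perm_uniq (perm_map fst (permEl (perm_sort _ _)))).
    have /andP[+ _] := gp; apply: subseq_uniq; apply: map_subseq; exact: filter_subseq.
  by rewrite sorted_map; apply: sort_sorted => p q; exact: le_total.
- move=> q; rewrite mem_sort mem_filter; apply/idP/andP => [/h2[]//|[]].
  by move=> nq hq; exact: h1.
Qed.
End Main.

Lemma compile_runs (R : realType) lim c f w (Q : pred (config R)) K s v :
  (16 * lim + 32 <= 2 ^ w)%N -> wf_cmd c ->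
  (forall s' v', K s' v' -> 0 <= v' /\ forall l W X, represents s' W X -> Q (Config l W X)) ->
  ert lim c K s v -> runs_from (Algorithm (compile 0 c) f) w Q 0 s (8 * v).
Proof.
move=> hw hwf hK h; rewrite -[8 * v]addr0.
apply: (ert_sound hw hwf _ _ h) => [i hi|s' v' /hK[v0 hQ] W X hr]; first by rewrite add0n.
apply: runs_halt; first by rewrite /step nth_default // add0n.
  exact: hQ.
by rewrite addr0; exact: mulr_ge0.
Qed.

(** * The program on the machine: initial state, word size and output *)

Section Machine.
Variables (R : realType) (P : seq (R * R)).
Let n := size P.
Let lim := (64 * n + 64)%N.
Local Notation ert := (@ert R lim).

Definition start : state R :=
  State (fun u => if u == vN then n else 0%N) (fun _ _ => 0%N)
    (fun r => rmem (initial P) r) (fun c p => rmem (initial P) (2 * p + (c + 8))%N).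

Lemma represents_start : represents start (wmem (initial P)) (rmem (initial P)).
Proof. by split=> //= [i _|a i ha]; [case: i|case: eqP => //; clear -ha; lia]. Qed.

Lemma initial_slot i : (rmem (initial P) (2 * i)%N, rmem (initial P) (2 * i).+1) = nth (0, 0) P i.
Proof.
by rewrite /= !mul2n odd_double /= doubleK uphalf_double; case: nth.
Qed.

Lemma main_value (j0 : nat) : (0 < n)%N -> general_position P -> pareto_promise P ->
  (forall J, (j0 <= J)%N ->
    32 * (3 + J%:R + ln (size (pareto_front P))%:R) <= 2 ^+ J :> R) ->
  ert main (fun s v => written (pareto_front P) s /\ 0 <= v) start
    (1500 * n * (j0 + 2) ^ 2)%N%:R.
Proof.
move=> n_gt0 gp promise hj0.
set K := fun s v => _; set v0 : R := _%:R.
split; first by rewrite /=; clear; do !split; lia.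
rewrite [block_run _ _]/=; set s0 := set_sc _ _ _.
apply: ert_if; rewrite [cond_val _ _]/= n_gt0.
change (ert setup (ert phases (ert write_output K)) s0 (v0 - 3%:R - 1)).
apply: (@setup_spec R lim n (nth (0, 0) P) _ s0 n_gt0) => //.
- by move=> i _; rewrite -initial_slot.
- move=> i; rewrite -initial_slot.
  have -> : (2 * (4 + i) = 2 * i + (0 + 8))%N by clear; lia.
  by rewrite -addnS.
move=> s1 v1 [hc1 hM hSp hsl hof] hv1.
pose a : R := (10 * n + 30)%N%:R.
have a0 : 0 <= a by [].
have kend J m off X s v O : searching J P m off X s [::] O -> a <= v ->
    ert write_output K s v.
  move=> h hv; have hO : O = pareto_front P.
    apply: pareto_frontP => //; first exact: srch_sorted h.
      by move=> q hq nq; case: (srch_cover h hq nq) => // -[es [x []]].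
    exact: srch_sound h.
  have hsz : (size O <= n)%N by apply: leq_trans (srch_count h); exact: leq_addr.
  apply: (@write_output_spec R lim P (leqnn _) s O (srch_consts h) hsz (srch_out h) (srch_outE h)).
  by move=> s' v' hw hv'; split; [rewrite -hO|rewrite /a in hv; lra].
(* A phase takes at most [1000 * n * J.+1]: its dominant terms are [54 * n * J.+1] for the binary
   searches and about [690 * n] for the rest. *)
apply: (@phases_value R lim P _ n_gt0 gp promise (ert write_output K) a (1000 * n)%N j0
  a0 kend hj0 _ n 0 s1) => //.
- move=> J; rewrite /search_cost /= -/n; clear -n_gt0; nia.
- rewrite hM; split.
  + by rewrite n_gt0 leqnn.
  + by rewrite expn0 !muln1 prednK // leqnn.
  + by rewrite hof ?addn0.
  + by rewrite hof // addnn mul2n.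
  + by move=> b hb; rewrite (hof _ (ltnW hb)) (hof _ hb) expn0 addnS addn1 leqnn leqnSn.
  + move=> b hb; rewrite (hof _ (ltnW hb)) (hof _ hb) expn0 !muln1 (minn_idPl (ltnW hb)) (minn_idPl hb).
    split.
    * by move=> x y hx xy hy; exfalso; clear -hx xy hy; lia.
    * move=> x hx; exists b; rewrite leqnn ltnSn; split=> //.
      by have -> : x = (n + b)%N; [clear -hx; lia|exact: hsl].
    * move=> i hi; have -> : i = b by clear -hi; lia.
      by exists (n + b)%N; rewrite hsl //; split; [clear; lia|split].
- by rewrite hSp.
- by rewrite hM.
(* The weight of phase 0 is [(j0 + 1) * (j0 + 2)], whence the square in the bound. *)
- have hnat : (3 + 1 + (100 * n + 100) + (2 * (10 * n + 30) + 2) +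
      1000 * n * phase_weight j0 0 <= 1500 * n * (j0 + 2) ^ 2)%N.
    by rewrite /phase_weight max0n subn0; clear -n_gt0; nia.
  move: hnat hv1; rewrite /phase_bound /v0 /a; set t1 := (100 * n + 100)%N.
  set t2 := (10 * n + 30)%N; set c := (1000 * n)%N; set w := phase_weight _ _.
  set T := (1500 * _ * _)%N; clearbody t1 t2 c w T.
  by rewrite -(ler_nat R) !natrD !natrM; lra.
Qed.

Lemma main_empty : n = 0%N ->
  ert main (fun s v => written (pareto_front P) s /\ 0 <= v) start 4.
Proof.
move=> n0; split; first by rewrite /=; clear; do !split; lia.
apply: ert_if; rewrite [cond_val _ _]/= n0; split=> //; rewrite (size0nil n0).
split; last by rewrite /=; lra.
by split=> // i /andP[].
Qed.

(** Let [y] be the power of 2 with exponent [(trunc_log 2 n).+1]; then [y > n], [y >= 2], and the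
    words hold numbers below [y ^ 32]. Since [16 * lim + 32 = 1024 * n + 1056], already [y * 2 ^ 11]
    is large enough. *)
Lemma word_size_large : (16 * lim + 32 <= 2 ^ word_size pareto_algorithm n)%N.
Proof.
rewrite /word_size [Defs.factor _]/= [X in (_ <= 2 ^ X)%N]mulnC expnM.
have : (n < 2 ^ (trunc_log 2 n).+1)%N by exact: trunc_log_ltn.
have : (2 <= 2 ^ (trunc_log 2 n).+1)%N by rewrite -{1}(expn1 2) leq_pexp2l.
set y := (2 ^ _)%N => y2 ny; apply: (@leq_trans (y ^ 12)); last by rewrite leq_pexp2l // ltnW.
rewrite expnS; apply: (@leq_trans (y * 2 ^ 11)); last by rewrite leq_pmul2l ?leq_exp2r // ltnW.
by rewrite /lim; clear -y2 ny; lia.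
Qed.

Lemma written_output O (s : state R) l W X : written O s -> represents s W X ->
  output (Config l W X : config R) = O.
Proof.
move=> [h1 h2 h3] [r1 r2 r3 r4].
rewrite /output -[wmem _]/W -[rmem _]/X (r1 0%N) // h1.
apply: (@eq_from_nth _ (0, 0)); first by rewrite size_map size_iota.
rewrite size_map size_iota => i hi; rewrite (nth_map 0%N) ?size_iota // nth_iota // add0n.
have [i4|i4] := ltnP i 4.
  by rewrite -h2 // -mul2n !r3 //; clear -i4; lia.
rewrite -h3 ?i4 // /slot -!r4 //.
have -> : (i.*2 = 2 * (i - 4) + (0 + 8))%N by clear -i4; lia.
by rewrite -addnS.
Qed.

Lemma pareto_algorithm_runs v :
  ert main (fun s v => written (pareto_front P) s /\ 0 <= v) start v ->
  runs_within pareto_algorithm (word_size pareto_algorithm n)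
    (fun c => output c == pareto_front P) (initial P) (8 * v).
Proof.
move=> h; apply: (@compile_runs R lim main 31 _ _ _ _ _ word_size_large wf_main _ h).
  move=> s' v' [hw hv']; split=> // l W X hr.
  by apply/eqP; exact: written_output hw hr.
exact: represents_start.
Qed.
End Machine.

(** * From the square of the number of phases to the final bounds *)

Lemma ln2_bounds (R : realType) : (1 / 2 : R) <= ln 2 <= (1 : R).
Proof.
have h1 : ln 2 <= 2 - 1 :> R by exact: ln_le_sub1.
have h2 : ln 2^-1 <= 2^-1 - 1 :> R by apply: ln_le_sub1; rewrite invr_gt0.
by rewrite lnV ?posrE // in h2; apply/andP; split; lra.
Qed.

(** Raising 2 to the iterated logarithm gives back [ln H / ln 2], which is at least [ln H] because
    [ln 2 <= 1]. *)
Lemma ln_le_loglog (R : realType) (h H : nat) : (0 < h)%N -> (h <= H)%N ->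
  ln h%:R <= 2 `^ loglog H%:R :> R.
Proof.
move=> h0 hH; have /andP[l1 l2] := ln2_bounds R.
have H0 : (0 < H)%N by exact: leq_trans hH.
apply: (@le_trans _ _ (ln H%:R)); first by rewrite ler_ln ?posrE ?ltr0n // ler_nat.
(* This separates [H = 1], where [log2 H] is 0 and its logarithm only a default value. *)
have [neg|pos] := leP (ln H%:R : R) 0; first by apply: le_trans neg _; exact: powR_ge0.
have ln2_gt0 : 0 < ln 2 :> R by lra.
have y0 : 0 < log2 H%:R :> R by exact: divr_gt0.
apply: (@le_trans _ _ (2 `^ log2 (log2 H%:R))); last first.
  by apply: ler_powR; rewrite ?ler1n // /loglog le_max lexx orbT.
rewrite /powR pnatr_eq0 /= {1}/log2 divfK ?gt_eqF // lnK ?posrE //.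
by rewrite /log2 ler_pdivlMr // ler_piMr // ltW.
Qed.

Lemma first_long_phase (R : realType) (h : nat) (L : R) : 1 <= L -> ln h%:R <= 2 `^ L ->
  exists2 j0 : nat, j0%:R <= L + 17 & forall J, (j0 <= J)%N ->
    32 * (3 + J%:R + ln h%:R) <= 2 ^+ J :> R.
Proof.
move=> L1 hL; have L0 : 0 <= L by lra.
have /andP[t1 t2] := truncn_itv L0.
(* Since [64 = 2 ^ 6], six phases beyond an integer above [L] give [64 * ln h <= 2 ^ J], and
   [64 * (3 + J) <= 2 ^ J] holds from [J = 10] on. The average of the two is the claim. *)
exists (Num.truncn L + 17)%N; first by rewrite natrD; lra.
move=> J hJ.
have p1 : 64 * ln h%:R <= 2 ^+ J :> R.
  have -> : J = (6 + (J - 6))%N by clear -hJ; lia.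
  rewrite exprD (_ : 2 ^+ 6 = 64); last by rewrite !exprS expr0; ring.
  rewrite ler_pM2l //; apply: (le_trans hL); rewrite -powR_mulrn //.
  apply: ler_powR; first by rewrite ler1n.
  apply: (le_trans (ltW t2)); rewrite ler_nat; clear -hJ; lia.
have p2 : (64 * (3 + J) <= 2 ^ J)%N.
  have -> : J = (10 + (J - 10))%N by clear -hJ; lia.
  elim: (J - 10)%N => [//|k IH]; rewrite addnS expnS; move: IH; clear; lia.
have : 64 * (3 + J%:R) <= 2 ^+ J :> R by rewrite -natrX -natrD -natrM ler_nat.
by lra.
Qed.

(** The exponent 31 is 23 + 8: [2 ^ 23 <= 2 ^ (23 x)] as [x >= 1], and [x <= 2 ^ (2 x)] gives
    [x ^ 4 <= 2 ^ (8 x)]. *)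
Lemma polylog_bound (R : realType) (x : R) : 1 <= x ->
  2 ^+ 23 * x ^+ 4 <= 2 `^ (31 * x).
Proof.
move=> x1; have /andP[l1 _] := ln2_bounds R.
have h2 : x <= 2 `^ (2 * x).
  rewrite /powR pnatr_eq0 /=; apply: le_trans (expR_ge1Dx _).
  have : x * 1 <= x * (2 * ln 2) by apply: ler_wpM2l; lra.
  by lra.
have -> : 31 * x = 23 * x + 2 * x * 4%:R by ring.
rewrite powRD; last by rewrite pnatr_eq0 implybT.
apply: ler_pM => //; first by apply: exprn_ge0; lra.
  by rewrite -powR_mulrn //; apply: ler_powR; [rewrite ler1n|lra].
rewrite powRrM powR_mulrn ?powR_ge0 //.
by apply: lerXn2r => //; rewrite nnegrE; [lra|exact: powR_ge0].
Qed.

Lemma pareto_front_gt0 (R : realType) (P : seq (R * R)) : (0 < size P)%N ->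
  (0 < size (pareto_front P))%N.
Proof.
case: P => // p P _; set Q := p :: P.
have [/dominated_by_front[q [hq nq _ _]]|np] := boolP (dominated Q p).
  by rewrite size_sort size_filter -has_count; apply/hasP; exists q.
by rewrite size_sort size_filter -has_count; apply/hasP; exists p; rewrite ?mem_head.
Qed.

(** Stated for any upper bound [H] on the front size, to be used with the number of points and with
    the front size itself. In terms of [x = sqrt L], a bound quadratic in [L] is a multiple of
    [x ^ 4]. *)
Lemma pareto_algorithm_time (R : realType) (P : seq (R * R)) (H : nat) :
  (0 < size P)%N -> general_position P -> pareto_promise P ->
  (size (pareto_front P) <= H)%N ->
  runs_within pareto_algorithm (word_size pareto_algorithm (size P))
    (fun c => output c == pareto_front P) (initial P)
    ((size P)%:R * 2 `^ (31 * Num.sqrt (loglog H%:R))).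
Proof.
move=> n0 gp promise hH; set L := loglog _.
have L1 : 1 <= L by rewrite /L /loglog le_max lexx.
have [j0 hj0 hJ] := first_long_phase L1 (ln_le_loglog R (pareto_front_gt0 n0) hH).
apply: runs_within_le (pareto_algorithm_runs (main_value n0 gp promise hJ)) _.
have x1 : 1 <= Num.sqrt L by rewrite -[X in X <= _]sqrtr1 ler_sqrt //; lra.
apply: le_trans (ler_wpM2l _ (polylog_bound x1)) => //.
have -> : Num.sqrt L ^+ 4 = L ^+ 2.
  by rewrite (exprM _ 2 2) sqr_sqrtr //; lra.
set n := size P; set m := (j0 + 2)%N.
(* From [j0 <= L + 17] and [L >= 1]. The square gives 400, which together with 8 machine steps per
   unit and the constant 1500 stays below [2 ^ 23]. *)
have hm : m%:R <= 20 * L by rewrite natrD; lra.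
have hm2 : (m ^ 2)%N%:R <= (20 * L) ^+ 2.
  by rewrite natrX; apply: lerXn2r; rewrite ?nnegrE //; lra.
rewrite natrM [(_ * n)%:R]natrM; set N : R := n%:R; have N0 : 0 <= N by [].
have : N * (m ^ 2)%N%:R <= N * (20 * L) ^+ 2 by exact: ler_wpM2l.
have e23 : 8 * 1500 * 400 <= 2 ^+ 23 :> R by rewrite !exprS expr0; lra.
have : N * L ^+ 2 * (8 * 1500 * 400) <= N * L ^+ 2 * 2 ^+ 23.
  by apply: ler_wpM2l => //; apply: mulr_ge0 => //; exact: sqr_ge0.
lra.
Qed.

Lemma pareto_algorithm_computes (R : realType) : computes_pareto_front R pareto_algorithm.
Proof.
move=> P gp promise; have [P0|n0] := posnP (size P); last first.
  by have [] := runs_within_correct (pareto_algorithm_time n0 gp promise (leqnn _)).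
by have [] := runs_within_correct (pareto_algorithm_runs (main_empty P0)).
Qed.

Theorem corollary14 (R : realType) :
  (exists A : algorithm,
     computes_pareto_front R A /\
     exists a b : R, 0 < a /\ 0 < b /\
       forall P : seq (R * R), (0 < size P)%N ->
         general_position P -> pareto_promise P ->
         (expected_time A P <=
          (a * ((size P)%:R *
             2 `^ (b * Num.sqrt (loglog (size P)%:R))))%:E)%E) /\
  (exists A : algorithm,
     computes_pareto_front R A /\
     exists b : R, 0 < b /\
       forall P : seq (R * R), (0 < size P)%N ->
         general_position P -> pareto_promise P ->
         (expected_time A P <=
          ((size P)%:R *
             2 `^ (b * Num.sqrt (loglog (size (pareto_front P))%:R)))%:E)%E).
Proof.
have c := @pareto_algorithm_computes R; have b0 : 0 < 31 :> R by [].
split; exists pareto_algorithm; split=> //.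
  exists 1, 31; split=> //; split=> // P n0 gp promise; rewrite mul1r.
  apply: (runs_within_correct (pareto_algorithm_time n0 gp promise _)).2.
  by rewrite size_sort size_filter count_size.
exists 31; split=> // P n0 gp promise.
exact: (runs_within_correct (pareto_algorithm_time n0 gp promise (leqnn _))).2.
Qed.
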